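(* $$F_{char}^Q(\widehat{\mathcal{R}_n};q)=\sum\limits_{\lambda\vdash n}\sum\limits_{Q\in\text{SYT}(\lambda)} q^{\text{maj}(Q)}s_{\lambda}=F_{char}(\mathcal{R}_n;q)$$
   Context: Let $\mathcal{R}_n=\mathbb{C}[x_1,\dots,x_n]/\langle e_1(x_1,\dots,x_n),\dots,e_n(x_1,\dots,x_n)\rangle$ be the coinvariant algebra, with $\mathfrak{S}_n$ acting by permuting variables; $F_{char}(\mathcal{R}_n;q)$ is its graded (symmetric) Frobenius characteristic. $\mathcal{R}_n$ has basis the sub-staircase monomials $\mathcal{A}_n=\{x_1^{\alpha_1}\cdots x_n^{\alpha_n}\mid 0\leq \alpha_j<j\}$. Let $\widehat{\mathcal{R}_n}$ denote the vector space $\mathcal{R}_n$ with the $0$-Hecke algebra $\mathcal{H}_n(0)$ (generators $\overline{\pi}_i$ with $\overline{\pi}_i^2=-\overline{\pi}_i$, $\overline{\pi}_i\overline{\pi}_j=\overline{\pi}_j\overline{\pi}_i$ for $|i-j|\ge 2$, $\overline{\pi}_i\overline{\pi}_{i+1}\overline{\pi}_i=\overline{\pi}_{i+1}\overline{\pi}_i\overline{\pi}_{i+1}$) acting on the basis $\mathcal{A}_n$ by $\overline{\pi}_i(x^{\alpha})=0$ if $\alpha_i=\alpha_{i+1}$; $\overline{\pi}_i(x^{\alpha})=-x^{\alpha}$ if $\alpha_i<\alpha_{i+1}$; $\overline{\pi}_i(x^{\alpha})=x^{s_i(\alpha)}$ (exponents in positions $i,i+1$ swapped) if $\alpha_i>\alpha_{i+1}$.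 The graded quasisymmetric Frobenius characteristic $F_{char}^Q(\cdot;q)$ (Krob–Thibon) is computed from a composition series whose one-dimensional quotients are spanned by monomials $x^{\alpha}$, each contributing $q^{\deg(x^{\alpha})}F_{\{i\mid \overline{\pi}_i(x^{\alpha})=-x^{\alpha}\}}$, where $F_I$ is Gessel's fundamental quasisymmetric function. For a standard Young tableau $Q$ (French notation), $\text{ides}(Q)=\{i\mid i\text{ is south of } i+1 \text{ in } Q\}$ and $\text{maj}(Q)=\sum_{i\in\text{ides}(Q)} i$; $s_\lambda$ is the Schur function. *)

(* Defs.v *)
From HB Require Import structures.
From mathcomp Require Import all_boot all_order all_algebra perm.
From mathcomp Require Import classical_sets boolp functions fsbigop reals complex.
From mathcomp Require Import mpoly ring_quotient.

Set Implicit Arguments.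
Unset Strict Implicit.
Unset Printing Implicit Defensive.

Import GRing.Theory.
Local Open Scope ring_scope.
Local Open Scope quotient_scope.

Lemma finite_dim_exists (F : fieldType) (V : lmodType F) (m : nat)
    (b : 'I_m -> V) :
  (forall v, exists c : 'rV[F]_m, v = \sum_(i < m) c 0 i *: b i) ->
  exists k, exists v2r : V -> 'rV[F]_k, linear v2r /\ bijective v2r.
Proof.
move=> spanb.
pose P k := `[< exists b : 'I_k -> V,
  forall v, exists c : 'rV[F]_k, v = \sum_(i < k) c 0 i *: b i >].
have exP : exists k, P k by exists m; apply/asboolP; exists b.
case: (ex_minnP exP) => k /asboolP[{}b {}spanb] mink.
have free (c : 'rV[F]_k) : \sum_(i < k) c 0 i *: b i = 0 -> c = 0.
  move=> c0; apply/rowP => j; rewrite mxE; apply/eqP/negPn/negP => cj.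
  case: k => [|k] in b spanb mink c c0 j cj *; first by case: j cj.
  suff : (k.+1 <= k)%N by rewrite ltnn.
  apply: mink; apply/asboolP; exists (b \o lift j) => v.
  have [d ->] := spanb v.
  have bj : b j = \sum_(i < k) - (c 0 (lift j i) / c 0 j) *: b (lift j i).
    move: c0; rewrite (bigD1_ord j) //= => /eqP; rewrite addr_eq0 => /eqP e.
    apply: (scalerI cj); rewrite e scaler_sumr -sumrN; apply: eq_bigr => i _.
    by rewrite scalerA mulrN mulrCA divff // mulr1 scaleNr.
  exists (\row_i (d 0 (lift j i) - d 0 j * (c 0 (lift j i) / c 0 j))).
  rewrite (bigD1_ord j) //= bj scaler_sumr -big_split; apply: eq_bigr => i _.
  by rewrite /= mxE scalerA -scalerDl mulrN addrC.
pose v2r v := sval (cid (spanb v)).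
have v2rE v : v = \sum_(i < k) v2r v 0 i *: b i by rewrite /v2r; case: cid.
have uniq v (c : 'rV[F]_k) : v = \sum_(i < k) c 0 i *: b i -> v2r v = c.
  move=> e; apply/eqP; rewrite -subr_eq0; apply/eqP/free.
  under eq_bigr do rewrite !mxE scalerBl.
  by rewrite sumrB -v2rE -e subrr.
exists k, v2r; split.
  move=> a u v; apply: uniq; under eq_bigr do rewrite !mxE scalerDl -scalerA.
  by rewrite big_split /= -scaler_sumr -!v2rE.
exists (fun c : 'rV[F]_k => \sum_(i < k) c 0 i *: b i) => [v|c]; first by rewrite -v2rE.
exact: uniq.
Qed.

Section Coinvariant.
Variables (F : fieldType) (n : nat).

Definition coinv_ideal : {pred {mpoly F[n]}} := fun p =>
  `[< exists f : 'I_n -> {mpoly F[n]}, p = \sum_(i < n) f i * mesym n F i.+1 >].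

Lemma coinv_idealr_closed : idealr_closed coinv_ideal.
Proof.
split=> [||a u v /asboolP[f ->] /asboolP[g ->]].
- by apply/asboolP; exists (fun=> 0); rewrite big1 // => i _; rewrite mul0r.
- apply/negP => /asboolP[f /(congr1 (meval (fun=> 0)))].
  rewrite rmorph1 rmorph_sum big1 => [/eqP|i _]; first by rewrite oner_eq0.
  rewrite rmorphM /= [X in _ * X]rmorph_sum big1 ?mulr0 // => h /eqP hi.
  rewrite rmorph_prod /=; have [j jh] : exists j, j \in h.
    by apply/set0Pn; rewrite -card_gt0 hi.
  by rewrite (bigD1 j) //= mevalXU mul0r.
- apply/asboolP; exists (fun i => a * f i + g i).
  by rewrite mulr_sumr -big_split; apply: eq_bigr => i _; rewrite mulrDl mulrA.
Qed.

HB.instance Definition _ :=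
  isIdealr.Build {mpoly F[n]} coinv_ideal coinv_idealr_closed.

Definition coinvariant := {ideal_quot coinv_ideal}.
HB.instance Definition _ := EqQuotient.on coinvariant.
HB.instance Definition _ := GRing.ComNzRing.on coinvariant.

Definition coinv_pi (p : {mpoly F[n]}) : coinvariant := \pi_(coinvariant) p.

Lemma coinv_pi_zmod : zmod_morphism coinv_pi.
Proof. exact: (rmorphB (\pi_{ideal_quot coinv_ideal})). Qed.
Lemma coinv_pi_monoid : monoid_morphism coinv_pi.
Proof. split; [exact: (rmorph1 (\pi_{ideal_quot coinv_ideal}))|].
exact: (rmorphM (\pi_{ideal_quot coinv_ideal})). Qed.
HB.instance Definition _ :=
  GRing.isZmodMorphism.Build {mpoly F[n]} coinvariant coinv_pi coinv_pi_zmod.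
HB.instance Definition _ :=
  GRing.isMonoidMorphism.Build {mpoly F[n]} coinvariant coinv_pi coinv_pi_monoid.

Lemma coinv_piP p q : (coinv_pi p == coinv_pi q) = (p - q \in coinv_ideal).
Proof. by rewrite /coinv_pi -Quotient.idealrBE. Qed.

Lemma coinv_reprK x : coinv_pi (repr x) = x.
Proof. exact: (@reprK _ coinvariant). Qed.

Definition coinv_scale (c : F) (x : coinvariant) : coinvariant :=
  coinv_pi c%:MP * x.

Lemma coinv_scaleA a b v :
  coinv_scale a (coinv_scale b v) = coinv_scale (a * b) v.
Proof. by rewrite /coinv_scale mpolyCM rmorphM mulrA. Qed.
Lemma coinv_scale1 : left_id 1 coinv_scale.
Proof. by move=> v; rewrite /coinv_scale rmorph1 mul1r. Qed.
Lemma coinv_scaleDr : right_distributive coinv_scale +%R.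
Proof. by move=> a u v; rewrite /coinv_scale mulrDr. Qed.
Lemma coinv_scaleDl v : {morph coinv_scale^~ v : a b / a + b}.
Proof. by move=> a b; rewrite /coinv_scale mpolyCD rmorphD mulrDl. Qed.

HB.instance Definition _ := GRing.Zmodule_isLmodule.Build F coinvariant
  coinv_scaleA coinv_scale1 coinv_scaleDr coinv_scaleDl.

Lemma coinv_scaleAl a (u v : coinvariant) : a *: (u * v) = (a *: u) * v.
Proof. exact: mulrA. Qed.
HB.instance Definition _ :=
  GRing.Lmodule_isLalgebra.Build F coinvariant coinv_scaleAl.
HB.instance Definition _ := GRing.Lalgebra_isComAlgebra.Build F coinvariant.

Lemma coinv_pi_scalable : scalable coinv_pi.
Proof. by move=> c p; rewrite -mul_mpolyC rmorphM. Qed.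
HB.instance Definition _ :=
  GRing.isScalable.Build F {mpoly F[n]} coinvariant *:%R coinv_pi
    coinv_pi_scalable.

Lemma coinv_var_nilp (i : 'I_n) : coinv_pi 'X_i ^+ n = 0.
Proof.
have [cs csE] : exists cs : n.-tuple {mpoly F[n]}, forall i, tnth cs i = 'X_i.
  by exists [tuple 'X_i | i < n] => j; rewrite tnth_mktuple.
have eX k : (mesym n {mpoly F[n]} k).@[tnth cs] = mesym n F k.
  rewrite /mesym rmorph_sum; apply: eq_bigr => h _.
  rewrite rmorph_prod; apply: eq_bigr => j _.
  by rewrite -csE; exact: mevalXU.
have : (\prod_(c <- cs) ('X - c%:P)).['X_i] = 0.
  apply/rootP; rewrite root_prod_XsubC; apply/tnthP; exists i.
  by rewrite csE.
rewrite horner_coef size_prod_XsubC size_tuple (reindex_inj rev_ord_inj).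
rewrite (eq_bigr (fun k : 'I_n.+1 =>
   (-1) ^+ k * mesym n F k * 'X_i ^+ (n - k))); last first.
  by move=> k _; rewrite -[val (rev_ord k)]/(n.+1 - k.+1)%N subSS mroots_coeff eX.
rewrite big_ord_recl /= expr0 mesym0E !mul1r subn0.
move=> /(congr1 coinv_pi); rewrite rmorphD rmorph0 rmorphXn /= => /eqP.
rewrite addr_eq0 => /eqP ->; apply/eqP; rewrite oppr_eq0.
rewrite rmorph_sum /=; apply/eqP; rewrite big1 // => k _.
rewrite !rmorphM /=; suff -> : coinv_pi (mesym n F k.+1) = 0.
  by rewrite mulr0 mul0r.
apply/eqP; rewrite -(rmorph0 coinv_pi) coinv_piP subr0.
apply/asboolP; exists (fun j => (j == k)%:R).
by rewrite (bigD1 k) //= eqxx mul1r big1 ?addr0 // => j /negPf ->; rewrite mul0r.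
Qed.

Lemma coinv_finite_dim :
  exists k, exists v2r : coinvariant -> 'rV[F]_k, linear v2r /\ bijective v2r.
Proof.
pose T := {ffun 'I_n -> 'I_n}.
pose mon (t : T) := coinv_pi 'X_[[multinom (t i : nat) | i < n]].
apply: (@finite_dim_exists F coinvariant #|T| (mon \o enum_val)) => v.
pose Q v := exists c : T -> F, v = \sum_t c t *: mon t.
have Qsum (I : Type) (r : seq I) f : (forall i, Q (f i)) -> Q (\sum_(i <- r) f i).
  move=> Qf; apply: big_ind => //.
    by exists (fun=> 0); rewrite big1 // => t _; rewrite scale0r.
  move=> _ _ [c ->] [d ->]; exists (fun t => c t + d t).
  by rewrite -big_split; apply: eq_bigr => t _; rewrite scalerDl.
have [c ->] : Q v.
  rewrite -[v]coinv_reprK [repr v]mpolyE rmorph_sum /=; apply: Qsum => m.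
  rewrite linearZ /=.
  have [/forallP mn|] := boolP [forall i, (m i < n)%N].
    pose t : T := [ffun i => Ordinal (mn i)].
    exists (fun t' => (t' == t)%:R * (repr v)@_m).
    rewrite (bigD1 t) //= eqxx mul1r big1 => [|t' /negPf ->]; last first.
      by rewrite mul0r scale0r.
    rewrite addr0; congr (_ *: coinv_pi 'X_[_]); apply/mnmP => i.
    by rewrite mnmE ffunE.
  rewrite negb_forall; case/existsP => i; rewrite -leqNgt => ni.
  exists (fun=> 0); rewrite [RHS]big1 => [|t _]; last by rewrite scale0r.
  rewrite mpolyXE_id rmorph_prod (bigD1 i) //= rmorphXn /=.
  by rewrite -(subnK ni) exprD coinv_var_nilp mulr0 mul0r scaler0.
exists (\row_i c (enum_val i)).
rewrite (reindex (enum_val : 'I_#|T| -> T)) /=; last first.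
  by apply: onW_bij; exact: enum_val_bij.
by apply: eq_bigr => i _; rewrite mxE.
Qed.

Lemma coinv_vector_axiom : Vector.axiom (sval (cid coinv_finite_dim)) coinvariant.
Proof. by case: cid => k /= /cid[f [lf bf]]; exists f. Qed.

HB.instance Definition _ :=
  Lmodule_hasFinDim.Build F coinvariant coinv_vector_axiom.

(* The image in [coinvariant] of the polynomials homogeneous of degree d.     *)
Definition coinv_deg (d : nat) : {vspace coinvariant} :=
  <<[seq coinv_pi 'X_[m] | m : 'X_{1..n < d.+1}
                         in [pred m : 'X_{1..n < d.+1} | mdeg m == d]]>>%VS.

Definition coinv_msym (s : 'S_n) (x : coinvariant) : coinvariant :=
  coinv_pi (msym s (repr x)).

Lemma coinv_msymE s p : coinv_msym s (coinv_pi p) = coinv_pi (msym s p).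
Proof.
apply/eqP; rewrite coinv_piP -msymB.
have : repr (coinv_pi p) - p \in coinv_ideal by rewrite -coinv_piP coinv_reprK.
move=> /asboolP[f ->]; apply/asboolP; exists (fun i => msym s (f i)).
rewrite rmorph_sum; apply: eq_bigr => i _; rewrite rmorphM; congr (_ * _).
by rewrite /=; have /issymP -> := mesym_sym n F i.+1.
Qed.

Lemma coinv_msym_linear s : linear (coinv_msym s).
Proof.
move=> c x y; rewrite -[x]coinv_reprK -[y]coinv_reprK -linearZ -linearD.
by rewrite !coinv_msymE msymD msymZ linearD linearZ.
Qed.
HB.instance Definition _ s := GRing.isLinear.Build F coinvariant coinvariant
  *:%R (coinv_msym s) (coinv_msym_linear s).

Definition coinv_perm (s : 'S_n) : 'End(coinvariant) := linfun (coinv_msym s).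

Lemma coinv_permE s p : coinv_perm s (coinv_pi p) = coinv_pi (msym s p).
Proof. by rewrite lfunE /= coinv_msymE. Qed.

End Coinvariant.

(* [lpos i] and [rpos i] are the positions i and i.+1 among 0, ..., n.-1.     *)
(* Positions, descents and generators are numbered from 0: [i : 'I_n.-1]      *)
(* stands for i.+1 in {1, ..., n - 1}.                                        *)
Definition lpos n (i : 'I_n.-1) : 'I_n := widen_ord (leq_pred n) i.

Lemma rpos_subproof n (i : 'I_n.-1) : (i.+1 < n)%N.
Proof. by rewrite -ltn_predRL. Qed.
Definition rpos n (i : 'I_n.-1) : 'I_n := Ordinal (rpos_subproof i).

(* Symmetric and quasisymmetric functions are represented by their images in  *)
(* N variables, N arbitrary: an identity in the inverse limit over N is the   *)
(* family of its instances.                                                   *)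
Section SymmetricFunctions.
Variables (K : comNzRingType) (N : nat).

Definition power_sum (k : nat) : {mpoly K[N]} := \sum_(i < N) 'X_i ^+ k.

(* F_I is the sum of x_{w_1} ... x_{w_n} over w_1 <= ... <= w_n with          *)
(* w_i < w_{i+1} whenever i is in I.                                          *)
Definition fundamental_qsym n (I : {set 'I_n.-1}) : {mpoly K[N]} :=
  \sum_(w : {ffun 'I_n -> 'I_N} |
        [forall i : 'I_n.-1, (w (lpos i) <= w (rpos i))%N &&
                             ((i \in I) ==> (w (lpos i) < w (rpos i))%N)])
    \prod_(j < n) 'X_(w j).

End SymmetricFunctions.

(* A partition of n is padded with zeros to exactly n parts.                  *)
Definition is_partition n (la : {ffun 'I_n -> 'I_n.+1}) : bool :=
  [forall i : 'I_n, forall j : 'I_n, (i <= j)%N ==> (la j <= la i)%N] &&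
  (\sum_i la i == n)%N.

(* A cell is a pair (row, column); in the French convention row 0 is the      *)
(* southernmost one.                                                          *)
Definition cell n (la : {ffun 'I_n -> 'I_n.+1}) : Type :=
  {c : 'I_n * 'I_n | (c.2 < la c.1)%N}.
HB.instance Definition _ n (la : {ffun 'I_n -> 'I_n.+1}) :=
  Finite.copy (cell la) {c : 'I_n * 'I_n | (c.2 < la c.1)%N}.

Section Tableaux.
Variables (n : nat) (la : {ffun 'I_n -> 'I_n.+1}).

Definition row_of (c : cell la) : 'I_n := (val c).1.
Definition col_of (c : cell la) : 'I_n := (val c).2.

Definition is_ssyt N (T : {ffun cell la -> 'I_N}) : bool :=
  [forall c, forall d,
    ((row_of c == row_of d) && (col_of c < col_of d)%N ==> (T c <= T d)%N) &&
    ((col_of c == col_of d) && (row_of c < row_of d)%N ==> (T c < T d)%N)].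

(* The entry e : 'I_n stands for e.+1. When [la] is a partition of n there    *)
(* are n cells, so that an injective filling uses every entry once.           *)
Definition is_syt (Q : {ffun cell la -> 'I_n}) : bool :=
  injectiveb Q &&
  [forall c, forall d,
    ((row_of c == row_of d) && (col_of c < col_of d)%N ==> (Q c < Q d)%N) &&
    ((col_of c == col_of d) && (row_of c < row_of d)%N ==> (Q c < Q d)%N)].

Definition ides (Q : {ffun cell la -> 'I_n}) : {set 'I_n.-1} :=
  [set i | [exists c, exists d,
     [&& Q c == lpos i, Q d == rpos i & (row_of c < row_of d)%N]]].

Definition maj (Q : {ffun cell la -> 'I_n}) : nat :=
  (\sum_(i in ides Q) i.+1)%N.

Definition schur (K : comNzRingType) (N : nat) : {mpoly K[N]} :=
  \sum_(T : {ffun cell la -> 'I_N} | is_ssyt T) \prod_c 'X_(T c).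

End Tableaux.

(* The graded series sum_d q^d f_d, with q = 'X; all but finitely many f_d    *)
(* are expected to vanish (otherwise the sum is 0).                           *)
Definition graded_sum (F : fieldType) (N : nat) (f : nat -> {mpoly F[N]}) :
    {mpoly {poly F}[N]} :=
  \sum_(d \in [set: nat]) 'X^d *: map_mpoly (@polyC F) (f d).

Section Frobenius.
Variables (F : fieldType) (V : vectType F) (n : nat).

(* The trace of the restriction of f to a subspace U that it preserves.       *)
Definition trace_on (U : {vspace V}) (f : 'End(V)) : F :=
  \sum_(i < \dim U) coord (vbasis U) i (f (vbasis U)`_i).

(* ch(U) = 1/n! sum_s chi_U(s) p_{cycle type of s}.                           *)
Definition frobenius_char (rho : 'S_n -> 'End(V)) (U : {vspace V}) (N : nat) :
    {mpoly F[N]} :=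
  (n`!)%:R^-1 *:
    \sum_(s : 'S_n) trace_on U (rho s) *:
      \prod_(c in porbits s) power_sum F N #|c|.

Definition graded_frobenius_char (rho : 'S_n -> 'End(V))
    (U : nat -> {vspace V}) (N : nat) : {mpoly {poly F}[N]} :=
  graded_sum (fun d => frobenius_char rho (U d) N).

Definition hecke0_action (op : 'I_n.-1 -> 'End(V)) : Prop :=
  [/\ forall i, (op i \o op i = - op i)%VF,
      forall i j : 'I_n.-1, (i.+1 < j)%N -> (op i \o op j = op j \o op i)%VF
    & forall i j : 'I_n.-1, j = i.+1 :> nat ->
        (op i \o op j \o op i = op j \o op i \o op j)%VF].

(* W' / W is the simple H_n(0)-module C_I: it is a line on which the i-th     *)
(* generator acts as -1 if i is in I and as 0 otherwise.                      *)
Definition hecke0_factor (op : 'I_n.-1 -> 'End(V)) (W W' : {vspace V})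
    (I : {set 'I_n.-1}) : Prop :=
  [/\ (W <= W')%VS, \dim W' = (\dim W).+1
    & forall i v, v \in W' -> op i v + (i \in I)%:R *: v \in W].

(* The list of the factors of a composition series of U, from the top down.   *)
(* All simple H_n(0)-modules are of the form C_I.                             *)
Inductive composition_factors (op : 'I_n.-1 -> 'End(V)) :
    {vspace V} -> seq {set 'I_n.-1} -> Prop :=
| CompositionNil : composition_factors op 0%VS [::]
| CompositionCons W W' I s of composition_factors op W s
    & hecke0_factor op W W' I : composition_factors op W' (I :: s).

(* The choice of a composition series is immaterial by Jordan-Hoelder; the    *)
(* value is 0 if [op] does not define an action of H_n(0) or if U is not a    *)
(* submodule.                                                                 *)
Definition qsym_frobenius_char (op : 'I_n.-1 -> 'End(V)) (U : {vspace V})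
    (N : nat) : {mpoly F[N]} :=
  \sum_(I <- xget [::]
     [set s | hecke0_action op /\ composition_factors op U s]%classic)
    fundamental_qsym F N I.

Definition graded_qsym_frobenius_char (op : 'I_n.-1 -> 'End(V))
    (U : nat -> {vspace V}) (N : nat) : {mpoly {poly F}[N]} :=
  graded_sum (fun d => qsym_frobenius_char op (U d) N).

End Frobenius.

Section HeckeCoinvariant.
Variables (F : fieldType) (n : nat).

(* Exponents of the sub-staircase monomials: alpha_j < j for j = 1, ..., n.   *)
Definition substaircase : {set {ffun 'I_n -> 'I_n}} :=
  [set a : {ffun 'I_n -> 'I_n} | [forall j, (a j <= j)%N]].

Definition exponent (a : {ffun 'I_n -> 'I_n}) : 'X_{1..n} :=
  [multinom (a j : nat) | j < n].

Definition artin_basis : #|substaircase|.-tuple (coinvariant F n) :=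
  [tuple coinv_pi 'X_[exponent (enum_val k)] | k < #|substaircase|].

Definition hecke0_monomial (i : 'I_n.-1) (m : 'X_{1..n}) : coinvariant F n :=
  if m (lpos i) == m (rpos i) then 0
  else if (m (lpos i) < m (rpos i))%N then - coinv_pi 'X_[m]
  else coinv_pi 'X_[[multinom m (tperm (lpos i) (rpos i) j) | j < n]].

Definition hecke0_coinv_fun (i : 'I_n.-1) (v : coinvariant F n) :
    coinvariant F n :=
  \sum_(k < #|substaircase|)
    coord artin_basis k v *: hecke0_monomial i (exponent (enum_val k)).

Lemma hecke0_coinv_linear i : linear (hecke0_coinv_fun i).
Proof.
move=> c x y; rewrite /hecke0_coinv_fun scaler_sumr -big_split.
by apply: eq_bigr => k _; rewrite linearP scalerDl scalerA.
Qed.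
HB.instance Definition _ i := GRing.isLinear.Build F (coinvariant F n)
  (coinvariant F n) *:%R (hecke0_coinv_fun i) (hecke0_coinv_linear i).

Definition hecke0_coinv (i : 'I_n.-1) : 'End(coinvariant F n) :=
  linfun (hecke0_coinv_fun i).

End HeckeCoinvariant.

(* Main.v *)
Require Import Defs.
From HB Require Import structures.
From mathcomp Require Import all_boot all_order all_algebra perm.
From mathcomp Require Import classical_sets boolp functions fsbigop reals complex.
From mathcomp Require Import mpoly zify.

Set Implicit Arguments.
Unset Strict Implicit.
Unset Printing Implicit Defensive.

Import GRing.Theory.

(** After multiplication by 1/((1 - q) ... (1 - q^n)), each of the three graded
    series becomes the generating function of the n-element multisets of pairs
    (k, j), weighted by q^k x_j.

    - Hecke side. A monomial x^m in C[x_1, ..., x_n] is encoded by a sub-staircase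
      exponent a and a partition nu with |a| + |nu| = |m|, where a and m have the
      same ascents. A Jordan-Hoelder argument and a composition series of
      monomials give the sum of the F_(ascents a), which becomes the sum of the
      F_(ascents m), that is the sum over the multisets listed by increasing x_j
      and then by decreasing k.
    - Schur side. A standard tableau Q and a partition make a semistandard tableau
      with the same shape (destandardization), and the Cauchy identity counts the
      pairs of semistandard tableaux of the same shape. It is proved by induction
      on the letters, from Fomin's local rule for horizontal strips.
    - Frobenius side. The products of sub-staircase monomials with monomials in
      the e_i span C[x_1, ..., x_n]; by the same encoding they are as many as the
      monomials, so they form a basis. Comparing the trace of a permutation in
      this basis and in the basis of monomials turns the graded character of the
      coinvariant algebra into the number of fixed monomials, and summing over
      the permutations counts orbits of pairs (monomial, word), i.e. multisets. *)

(** * Encoding a monomial by a sub-staircase exponent and a partition *)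

(** The factor 1/((1 - q) ... (1 - q^n)) trades the quotient for the whole polynomial ring, where a
    permutation acts on the monomials and its trace counts fixed points. On the Schur side it turns
    the generating function of maj into a principal specialization. It can be cancelled because its
    constant term is 1, so comparing coefficients degree by degree suffices and no series is ever
    inverted. The constraint that shapes the encoding is that it has two uses. Degrees must add up,
    for the count that makes the spanning family a basis, and strict ascents between adjacent
    letters must survive, since they index the fundamental quasisymmetric functions. Lowering the
    inserted letter by one for each part that it passes meets both demands: the rank absorbs exactly
    the degree that is lost, and successive ranks compare as the letters do. Working in a fixed
    degree d makes everything finite: powers of q up to d are carried by d + 1 letters, in the
    reversed form q^(d - i), so that increasing letters stand for decreasing powers. *)

(* Inserting [k] into the increasing sequence nu_0 <= nu_1 <= ... yields the
   unique rank r with nu_(r-1) + r <= k <= nu_r + r; the part k - r is inserted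
   at that position, so that the total of the parts and of r is unchanged. *)
Fixpoint ins_rank (nu : seq nat) (k : nat) : nat :=
  if nu is x :: s then if k <= x then 0 else (ins_rank s k.-1).+1 else 0.

Fixpoint ins_part (nu : seq nat) (k : nat) : seq nat :=
  if nu is x :: s then if k <= x then k :: nu else x :: ins_part s k.-1
  else [:: k].

Fixpoint del_part (nu : seq nat) (r : nat) : nat * seq nat :=
  match nu, r with
  | [::], _ => (0, [::])
  | x :: s, 0 => (x, s)
  | x :: s, r.+1 => let p := del_part s r in (p.1.+1, x :: p.2)
  end.

Lemma size_ins_part nu k : size (ins_part nu k) = (size nu).+1.
Proof. by elim: nu k => //= x s IH k; case: ifP => //= _; rewrite IH. Qed.

Lemma ins_rank_size nu k : ins_rank nu k <= size nu.
Proof. by elim: nu k => //= x s IH k; case: ifP => // _; rewrite ltnS. Qed.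

Lemma sumn_ins_part nu k : sumn (ins_part nu k) + ins_rank nu k = sumn nu + k.
Proof.
elim: nu k => [|x s IH] k /=; first by rewrite !addn0.
case: ifP => /= [_|/negbT]; first lia.
by rewrite -ltnNge => xk; have := IH k.-1; lia.
Qed.

Lemma path_ins_part y nu k : path leq y nu -> y <= k -> path leq y (ins_part nu k).
Proof.
elim: nu y k => [|x s IH] y k /=; first by move=> _ ->.
move=> /andP[yx xs] yk; case: ifP => /= [->|/negbT]; first by rewrite yk xs.
by rewrite -ltnNge => xk; rewrite yx IH //; lia.
Qed.

Lemma sorted_ins_part nu k : sorted leq nu -> sorted leq (ins_part nu k).
Proof.
have -> s : sorted leq s = path leq 0 s by case: s.
have -> s : sorted leq s = path leq 0 s by case: s.
by move=> nus; apply: path_ins_part.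
Qed.

Lemma ins_partK nu k : del_part (ins_part nu k) (ins_rank nu k) = (k, nu).
Proof.
elim: nu k => //= x s IH k; case: ifP => //= /negbT.
by rewrite -ltnNge => xk; rewrite IH /=; congr (_, _); lia.
Qed.

Lemma size_del_part nu r : r < size nu -> size (del_part nu r).2 = (size nu).-1.
Proof.
elim: nu r => //= x s IH [|r] //= rs; rewrite IH //; lia.
Qed.

Lemma path_del_part y nu r : path leq y nu -> r < size nu ->
  y <= (del_part nu r).1 /\ path leq y (del_part nu r).2.
Proof.
elim: nu r y => //= x s IH [|r] y /andP[yx xs] /= rs.
  split=> //; case: s xs {IH rs} => //= z s /andP[xz ->].
  by rewrite (leq_trans yx).
have [xd ->] := IH r x xs rs; split; first by lia.
by rewrite yx.
Qed.

Lemma del_partK nu r : sorted leq nu -> r < size nu ->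
  ins_part (del_part nu r).2 (del_part nu r).1 = nu /\
  ins_rank (del_part nu r).2 (del_part nu r).1 = r.
Proof.
elim: nu r => //= x s IH [|r] /= xs rs.
  by case: s xs {IH rs} => //= z s /andP[->].
have [xd _] := path_del_part xs rs.
have [] := IH r (path_sorted xs) rs => e1 e2.
by rewrite leqNgt ltnS xd /= e1 e2.
Qed.

(* The reason why a word and its code have the same ascents. *)
Lemma ins_rank_ltn nu k l :
  (ins_rank nu k < ins_rank (ins_part nu k) l) = (k < l).
Proof.
elim: nu k l => [|x s IH] k l /=; first by case: (leqP l k).
case: (leqP k x) => /= kx; first by case: (leqP l k).
case: (leqP l x) => lx; first by rewrite ltn0; lia.
by rewrite ltnS IH; lia.
Qed.

(* The words are read from right to left: the head of the list is the letter
   that is inserted last. *)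
Fixpoint rcode (k : seq nat) : seq nat * seq nat :=
  if k is x :: s then
    let p := rcode s in (ins_rank p.2 x :: p.1, ins_part p.2 x)
  else ([::], [::]).

Fixpoint rdecode (a nu : seq nat) : seq nat :=
  if a is r :: a' then
    let p := del_part nu r in p.1 :: rdecode a' p.2
  else [::].

(** The bound [size a'] is the number of letters inserted earlier, so this is the sub-staircase
    condition read from right to left. *)
Fixpoint bounded_code (a : seq nat) : bool :=
  if a is r :: a' then (r <= size a') && bounded_code a' else true.

Lemma size_rcode k : size (rcode k).1 = size k /\ size (rcode k).2 = size k.
Proof. by elim: k => //= x s [-> e]; rewrite size_ins_part e. Qed.

Lemma size_rdecode a nu : size (rdecode a nu) = size a.
Proof. by elim: a nu => //= r a IH nu; rewrite IH. Qed.

Lemma rcode_bounded k : bounded_code (rcode k).1.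
Proof.
elim: k => //= x s ->; rewrite andbT.
by have [-> <-] := size_rcode s; exact: ins_rank_size.
Qed.

Lemma rcode_sorted k : sorted leq (rcode k).2.
Proof. by elim: k => //= x s IH; apply: sorted_ins_part. Qed.

Lemma sumn_rcode k : sumn (rcode k).1 + sumn (rcode k).2 = sumn k.
Proof. by elim: k => //= x s; have := sumn_ins_part (rcode s).2 x; lia. Qed.

Lemma rcodeK k : rdecode (rcode k).1 (rcode k).2 = k.
Proof. by elim: k => //= x s IH; rewrite ins_partK /= IH. Qed.

Lemma rdecodeK a nu : bounded_code a -> sorted leq nu -> size nu = size a ->
  rcode (rdecode a nu) = (a, nu).
Proof.
elim: a nu => [|r a IH] nu /=; first by case: nu.
move=> /andP[ra ba] nus snu; have rnu : r < size nu by rewrite snu ltnS.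
have [e1 e2] := del_partK nus rnu.
rewrite IH //=; first by rewrite e1 e2.
  have -> : sorted leq (del_part nu r).2 = path leq 0 (del_part nu r).2.
    by case: (_.2).
  by apply: (path_del_part (y := 0) _ rnu).2; case: nu nus {rnu e1 e2 snu}.
by rewrite size_del_part // snu.
Qed.

Lemma nth_rcode_ltn k i : i.+1 < size k ->
  (nth 0 (rcode k).1 i.+1 < nth 0 (rcode k).1 i) = (nth 0 k i.+1 < nth 0 k i).
Proof.
elim: k i => //= x s IH [|i] //=; last exact: IH.
by case: s {IH} => //= y s _; exact: ins_rank_ltn.
Qed.

(** * Codes of exponent vectors *)

Section Code.
Variable n : nat.
Implicit Types m a nu : 'X_{1..n}.

Definition substair m := [forall j, m j <= j].
Definition increasing m := sorted leq m.

Definition mnm_of (s : seq nat) : 'X_{1..n} := [multinom nth 0 s i | i < n].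

Lemma mnm_ofK s : size s = n -> mnm_of s = s :> seq nat.
Proof.
move=> sn; apply: (@eq_from_nth _ 0); first by rewrite size_tuple.
rewrite size_tuple => i ltin; have := mnm_nth 0 (mnm_of s) (Ordinal ltin).
by rewrite mnmE => <-.
Qed.

Lemma mnm_of_id m : mnm_of m = m.
Proof. by apply/mnmP => i; rewrite mnmE (mnm_nth 0). Qed.

(** The two reversals make letter 0 the first one inserted. The rank of letter j is then taken among
    the j parts already present, whence [codeA m j <= j]. *)
Definition codeA m := mnm_of (rev (rcode (rev m)).1).
Definition codeN m := mnm_of (rcode (rev m)).2.
Definition decode a nu := mnm_of (rev (rdecode (rev a) nu)).

Lemma bounded_codeP s :
  reflect (forall i, i < size s -> nth 0 s i <= size s - i.+1) (bounded_code s).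
Proof.
elim: s => [|x s IH] /=; first by apply: ReflectT.
apply: (iffP andP) => [[xs /IH bs] [|i] /= lt|H].
- by rewrite subn1.
- by rewrite subSS; apply: bs.
- split; first by have := H 0; rewrite subn1 /=; apply.
  by apply/IH => i lt; have := H i.+1; rewrite subSS /=; apply.
Qed.

Lemma substair_bounded m : substair m = bounded_code (rev m).
Proof.
have sm : size m = n by rewrite size_tuple.
apply/forallP/bounded_codeP => [H i|H j].
  rewrite size_rev sm => lt; rewrite nth_rev ?sm //.
  have lt' : n - i.+1 < n by lia.
  by have := H (Ordinal lt'); rewrite (mnm_nth 0).
have lt : n - j.+1 < n by have := ltn_ord j; lia.
have := H (n - j.+1); rewrite size_rev sm nth_rev ?sm // (mnm_nth 0) => /(_ lt).
have e : n - (n - j.+1).+1 = j by have := ltn_ord j; lia.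
by rewrite e.
Qed.

Let size_rc m : size (rcode (rev m)).1 = n /\ size (rcode (rev m)).2 = n.
Proof. by have [-> ->] := size_rcode (rev m); rewrite size_rev size_tuple. Qed.

Lemma codeA_substair m : substair (codeA m).
Proof.
rewrite substair_bounded mnm_ofK ?size_rev ?(size_rc m).1 // revK.
exact: rcode_bounded.
Qed.

Lemma codeN_increasing m : increasing (codeN m).
Proof. by rewrite /increasing mnm_ofK ?(size_rc m).2 // rcode_sorted. Qed.

Lemma mdeg_sumn m : mdeg m = sumn m.
Proof. by rewrite /mdeg sumnE. Qed.

Lemma mdeg_code m : (mdeg (codeA m) + mdeg (codeN m))%N = mdeg m.
Proof.
rewrite !mdeg_sumn !mnm_ofK ?size_rev ?(size_rc m).1 ?(size_rc m).2 //.
by rewrite sumn_rev sumn_rcode sumn_rev.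
Qed.

Lemma codeK m : decode (codeA m) (codeN m) = m.
Proof.
rewrite /decode !mnm_ofK ?size_rev ?(size_rc m).1 ?(size_rc m).2 //.
by rewrite revK rcodeK revK mnm_of_id.
Qed.

Let rcode_decode a nu : substair a -> increasing nu ->
  rcode (rev (decode a nu)) = (rev a, val nu : seq nat).
Proof.
rewrite substair_bounded => sa inu.
rewrite /decode mnm_ofK ?size_rev ?size_rdecode ?size_rev ?size_tuple ?revK //.
by rewrite rdecodeK // size_rev !size_tuple.
Qed.

Lemma codeA_decode a nu : substair a -> increasing nu -> codeA (decode a nu) = a.
Proof. by move=> sa inu; rewrite /codeA rcode_decode //= revK mnm_of_id. Qed.

Lemma codeN_decode a nu : substair a -> increasing nu -> codeN (decode a nu) = nu.
Proof. by move=> sa inu; rewrite /codeN rcode_decode //= mnm_of_id. Qed.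

Lemma mdeg_decode a nu : substair a -> increasing nu ->
  mdeg (decode a nu) = (mdeg a + mdeg nu)%N.
Proof. by move=> sa inu; rewrite -mdeg_code codeA_decode ?codeN_decode. Qed.

(** Letter j is inserted immediately after letter i, so [ins_rank_ltn] compares their ranks. *)
Lemma codeA_ascent m (i j : 'I_n) : j = i.+1 :> nat ->
  (codeA m i < codeA m j) = (m i < m j).
Proof.
move=> ji; have sm : size m = n by rewrite size_tuple.
have ltj := ltn_ord j.
rewrite !mnmE ji !nth_rev ?(size_rc m).1 -?ji ?ltj ?(ltnW ltj) //.
have -> : n - j = (n - j.+1).+1 by lia.
rewrite nth_rcode_ltn ?size_rev ?sm; last by lia.
rewrite !nth_rev ?sm; [|lia..].
have -> : n - (n - j.+1).+2 = i by lia.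
have -> : n - (n - j.+1).+1 = j by lia.
by rewrite !(mnm_nth 0).
Qed.
End Code.

Local Open Scope ring_scope.
(** * Spanning of polynomials over the elementary symmetric polynomials *)

Section Elementary.
Variables (F : fieldType) (n : nat).
Local Notation S := {mpoly F[n]}.
Implicit Types m a nu mu : 'X_{1..n}.

Definition mprev nu (i : 'I_n) : nat := if val i is k.+1 then nth 0%N nu k else 0.

(* A product of elementary symmetric polynomials, indexed by an increasing
   sequence so that its degree is [mdeg nu] and that it is multiplicative in
   [nu]. *)
Definition elem_mon nu : S := \prod_(i < n) mesym n F (n - i) ^+ (nu i - mprev nu i).

Lemma increasingP nu :
  reflect (forall i j : 'I_n, (i <= j)%N -> (nu i <= nu j)%N) (increasing nu).
Proof.
apply: (iffP idP) => [inu i j ij|H].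
  rewrite !(mnm_nth 0%N); apply: sorted_leq_nth ij => //; rewrite ?inE ?size_tuple //.
  exact: leq_trans.
apply/(sortedP 0%N) => i; rewrite size_tuple => lti.
by have := H (Ordinal (ltnW lti)) (Ordinal lti); rewrite !(mnm_nth 0%N); apply.
Qed.

Lemma increasing0 : increasing (0%MM : 'X_{1..n}).
Proof. by apply/increasingP => i j _; rewrite !mnm0E. Qed.

Lemma increasingD nu mu : increasing nu -> increasing mu -> increasing (nu + mu)%MM.
Proof.
move=> /increasingP H1 /increasingP H2; apply/increasingP => i j ij.
by rewrite !mnmDE leq_add ?H1 ?H2.
Qed.

Lemma mprevS nu k (lt : (k.+1 < n)%N) :
  mprev nu (Ordinal lt) = nu (Ordinal (ltnW lt)).
Proof. by rewrite (mnm_nth 0%N). Qed.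

Lemma mprev_le nu i : increasing nu -> (mprev nu i <= nu i)%N.
Proof.
move=> /increasingP H; case: i => -[|k] lt //; rewrite mprevS.
exact/H/leqnSn.
Qed.

Lemma mprevD nu mu i : mprev (nu + mu)%MM i = (mprev nu i + mprev mu i)%N.
Proof. by case: i => -[|k] lt //; rewrite !mprevS mnmDE. Qed.

Lemma elem_mon0 : elem_mon 0%MM = 1.
Proof. by rewrite /elem_mon big1 // => i _; rewrite mnm0E sub0n. Qed.

Lemma elem_monD nu mu : increasing nu -> increasing mu ->
  elem_mon (nu + mu)%MM = elem_mon nu * elem_mon mu.
Proof.
move=> inu imu; rewrite /elem_mon -big_split; apply: eq_bigr => i _ /=.
rewrite -exprD mprevD mnmDE; congr (_ ^+ _).
by have := mprev_le i inu; have := mprev_le i imu; lia.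
Qed.

Definition mstep (i : 'I_n) : 'X_{1..n} := [multinom ((i <= j)%N : nat) | j < n].

Lemma increasing_mstep i : increasing (mstep i).
Proof. by apply/increasingP => j k jk; rewrite !mnmE; lia. Qed.

Lemma elem_mon_mstep i : elem_mon (mstep i) = mesym n F (n - i).
Proof.
rewrite /elem_mon (bigD1 i) //= big1 ?mulr1 => [|j ji].
  rewrite mnmE leqnn; case: i => -[|k] lt //; rewrite mprevS.
  by rewrite mnmE /= ltnn subn0.
suff -> : (mstep i j - mprev (mstep i) j = 0)%N by [].
have {}ji : (j : nat) <> i by move=> e; case/eqP: ji; apply/val_inj.
rewrite mnmE; case: j ji => -[|k] lt ji; first by move: ji => /=; lia.
by rewrite mprevS mnmE /=; move: ji => /=; lia.
Qed.

Lemma mstep_neq0 i : mstep i != 0%MM.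
Proof. by apply/eqP => /mnmP/(_ i); rewrite mnmE mnm0E leqnn. Qed.

(** Summation by parts: the increment at i is counted once in each of g i, ..., g (k - 1).
    Monotonicity makes the truncated differences genuine. *)
Lemma abel_sum (g : nat -> nat) k : {homo g : x y / (x <= y)%N} ->
  (\sum_(i < k) (k - i) * (g i - (if i : nat is j.+1 then g j else 0)) =
  \sum_(i < k) g i)%N.
Proof.
move=> gh; elim: k => [|k IH]; first by rewrite !big_ord0.
rewrite big_ord_recr /= big_ord_recr /= -{}IH subSnn mul1n.
under eq_bigr => i _ do rewrite subSn 1?ltnW // mulSn.
rewrite big_split /= addnC addnA addnC; congr addn.
elim: k => [|k IH]; first by rewrite big_ord0 subn0 addn0.
rewrite big_ord_recr /= [(\sum_(_ < _) _ + _)%N]addnC IH.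
by have := gh k k.+1 (leqnSn k); lia.
Qed.

Lemma elem_mon_homog nu : increasing nu -> elem_mon nu \is (mdeg nu).-homog.
Proof.
move=> inu; have -> : mdeg nu = (\sum_(i < n) (n - i) * (nu i - mprev nu i))%N.
  (* The sequence is continued by its last value: the default 0 of [nth] would break monotonicity
     beyond n - 1. *)
  pose g i := nth 0%N nu (minn i n.-1).
  have nug (i : 'I_n) : nu i = g i.
    by rewrite (mnm_nth 0%N) /g; congr nth; have := ltn_ord i; lia.
  have gh : {homo g : x y / (x <= y)%N}.
    move=> x y xy; rewrite /g.
    have [n0|n0] := posnP n; first by rewrite !nth_default // size_tuple n0.
    apply: (sorted_leq_nth leq_trans leqnn 0%N inu); rewrite ?inE ?size_tuple; lia.
  rewrite mdegE (eq_bigr (fun i : 'I_n => g i)) // -(abel_sum _ gh).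
  apply: eq_bigr => i _; rewrite nug /mprev; congr (_ * (_ - _))%N.
  by case: i => -[|k] //= lt; rewrite /g; congr nth; lia.
rewrite /elem_mon; apply: (big_rec2 (fun (d : nat) (p : S) => p \is d.-homog)).
  exact: dhomog1.
move=> i d p _ Hp.
have Hi := dhomogMn (nu i - mprev nu i) (dhomog_mesym n F (n - i)).
exact: dhomogM Hi Hp.
Qed.

(** Indexing these products by m, rather than by pairs of codes, gives the family in degree d the
    same index set as the monomials of degree d; the matrices of change of basis are then square by
    construction. *)
Definition art_mon (m : 'X_{1..n}) : S := 'X_[codeA m] * elem_mon (codeN m).

Lemma art_mon_homog m : art_mon m \is (mdeg m).-homog.
Proof.
rewrite -mdeg_code; apply: dhomogM; first by rewrite dhomogX.
exact: elem_mon_homog (codeN_increasing m).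
Qed.

Lemma art_mon_decode a nu : substair a -> increasing nu ->
  art_mon (decode a nu) = 'X_[a] * elem_mon nu.
Proof. by move=> sa inu; rewrite /art_mon codeA_decode ?codeN_decode. Qed.

End Elementary.

(** * Linear spans in an infinite-dimensional algebra *)

Section LinearSpan.
Variables (F : fieldType) (A : algType F).
Implicit Types (G H : A -> Prop) (f g : A).

Inductive lspan G : A -> Prop :=
| Lspan0 : lspan G 0
| LspanD c g f of G g & lspan G f : lspan G (c *: g + f).

Lemma lspan_gen G g : G g -> lspan G g.
Proof. by move=> Gg; rewrite -[g]scale1r -[_ *: _]addr0; apply: LspanD Gg (Lspan0 G). Qed.

Lemma lspan_add G f g : lspan G f -> lspan G g -> lspan G (f + g).
Proof.
move=> Gf Gg; elim: Gf => [|c h f' Gh _ IH]; first by rewrite add0r.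
by rewrite -addrA; apply: LspanD.
Qed.

Lemma lspan_scale G c f : lspan G f -> lspan G (c *: f).
Proof.
elim=> [|d h f' Gh _ IH]; first by rewrite scaler0; apply: Lspan0.
by rewrite scalerDr scalerA; apply: LspanD.
Qed.

Lemma lspan_opp G f : lspan G f -> lspan G (- f).
Proof. by rewrite -scaleN1r; apply: lspan_scale. Qed.

Lemma lspan_sum G (I : Type) (r : seq I) (P : pred I) (f : I -> A) :
  (forall i, P i -> lspan G (f i)) -> lspan G (\sum_(i <- r | P i) f i).
Proof. by move=> Gf; apply: big_ind => //; [exact: Lspan0|exact: lspan_add]. Qed.

Lemma lspan_mul G H h f : (forall g, G g -> lspan H (h * g)) -> lspan G f ->
  lspan H (h * f).
Proof.
move=> GH; elim=> [|c g f' Gg _ IH]; first by rewrite mulr0; apply: Lspan0.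
by rewrite mulrDr -scalerAr; apply: lspan_add (lspan_scale _ (GH _ Gg)) IH.
Qed.

Lemma lspan_sub G H f : (forall g, G g -> H g) -> lspan G f -> lspan H f.
Proof.
by move=> GH; elim=> [|c g f' Gg _ IH]; [exact: Lspan0|apply: LspanD (GH _ Gg) IH].
Qed.
End LinearSpan.

(** * Spanning by descending induction on the variables *)

Section ArtinSpan.
Variables (F : fieldType) (n : nat).
Local Notation S := {mpoly F[n]}.
Implicit Types m a nu mu : 'X_{1..n}.

(** Generators over F of the span, over the symmetric polynomials, of the sub-staircase monomials in
    the x_i with i >= j. At j = n the span is the ring of symmetric polynomials; the goal is that at
    j = 0 it is everything. *)
Definition tower_gen (j : nat) (g : S) : Prop := exists a nu,
  [/\ substair a, increasing nu, forall i : 'I_n, (i < j)%N -> a i = 0%N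
    & g = 'X_[a] * elem_mon F nu].
Local Notation tower j := (lspan (tower_gen j)).

(** This is the quotient of the product of all the X - x_i by the factors with i >= j, so its
    coefficients are polynomials in the e_k and the x_i with i >= j. *)
Definition low_roots (j : nat) : {poly S} :=
  \prod_(i < n | (i < j)%N) ('X - ('X_i)%:P).

Lemma tower_le j k f : (j <= k)%N -> tower k f -> tower j f.
Proof.
move=> jk; apply: lspan_sub => g [a [nu [sa inu a0 ->]]].
by exists a, nu; split=> // i ij; apply: a0; apply: leq_trans jk.
Qed.

Lemma tower_elem j nu f : increasing nu -> tower j f -> tower j (elem_mon F nu * f).
Proof.
move=> inu; apply: lspan_mul => g [a [mu [sa imu a0 ->]]].
apply: lspan_gen; exists a, (nu + mu)%MM; split=> //; first exact: increasingD.
by rewrite mulrCA elem_monD.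
Qed.

Lemma tower_mesym j k : tower j (mesym n F k).
Proof.
case: (ltnP n k) => kn; first by rewrite mesym_geqnE //; apply: Lspan0.
have tower1 : tower j 1.
  apply: lspan_gen; exists 0%MM, 0%MM; split=> [||i _|].
  - by apply/forallP => i; rewrite mnm0E.
  - exact: increasing0.
  - by rewrite mnm0E.
  - by rewrite elem_mon0 mulr1 mpolyX0.
case: k kn => [|k] kn; first by rewrite mesym0E.
have lt : (n - k.+1 < n)%N by lia.
have := @elem_mon_mstep F n (Ordinal lt); rewrite /= subKn // => <-.
by rewrite -[elem_mon _ _]mulr1; apply: tower_elem => //; apply: increasing_mstep.
Qed.

Definition closed_above j := forall i : 'I_n, (j <= i)%N ->
  forall f, tower j f -> tower j ('X_i * f).

(** The generators for j + 1 have exponent 0 at j, where the staircase leaves room for any exponent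
    up to j. *)
Lemma tower_pow (j : 'I_n) k f : (k <= j)%N -> tower j.+1 f ->
  tower j ('X_j ^+ k * f).
Proof.
move=> kj; apply: lspan_mul => g [a [nu [/forallP sa inu a0 ->]]].
apply: lspan_gen; exists (U_(j) *+ k + a)%MM, nu; split=> //.
- apply/forallP => i; rewrite mnmDE mulmnE mnm1E; case: eqP => [<-|_].
    by rewrite a0 // mul1n addn0.
  exact: sa.
- move=> i ij; rewrite mnmDE mulmnE mnm1E a0 1?ltnW // addn0.
  by case: eqP => // ji; rewrite ji ltnn in ij.
- by rewrite mpolyXD mpolyXn mulrA.
Qed.

Lemma closed_mon j m f : closed_above j -> (forall i : 'I_n, (i < j)%N -> m i = 0%N) ->
  tower j f -> tower j ('X_[m] * f).
Proof.
move=> cj m0 tf; rewrite mpolyXE_id.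
apply: (big_ind (fun g => forall f, tower j f -> tower j (g * f))) tf => {f}.
- by move=> f; rewrite mul1r.
- by move=> x y hx hy f tf; rewrite -mulrA; apply/hx/hy.
- move=> i _ f tf; case: (ltnP i j) => ij; first by rewrite m0 // expr0 mul1r.
  elim: (m i) => [|k IH]; first by rewrite mul1r.
  by rewrite exprS -mulrA; apply: cj.
Qed.

Lemma closed_mul j f g : closed_above j -> tower j f -> tower j g -> tower j (g * f).
Proof.
move=> cj tf; rewrite mulrC; apply: lspan_mul => h [a [nu [sa inu a0 ->]]].
rewrite mulrC -mulrA; apply: closed_mon => //; exact: tower_elem.
Qed.

Lemma low_roots_monic j : low_roots j \is monic.
Proof. by apply: monic_prod => i _; apply: monicXsubC. Qed.

Lemma low_roots_step (j : 'I_n) : low_roots j.+1 = low_roots j * ('X - ('X_j)%:P).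
Proof.
rewrite /low_roots (bigD1 j) //= mulrC; congr (_ * _); apply: eq_bigl => i.
by rewrite ltnS -val_eqE /= ltn_neqAle andbC.
Qed.

Lemma size_low_roots (j : nat) : (j <= n)%N -> size (low_roots j) = j.+1.
Proof.
elim: j => [|j IH] jn; first by rewrite /low_roots big_pred0 ?size_poly1.
rewrite -[j]/(val (Ordinal jn)) low_roots_step size_Mmonic ?monicXsubC //.
  by rewrite size_XsubC IH ?addn2 // ltnW.
by rewrite monic_neq0 // low_roots_monic.
Qed.

Lemma tower_sign j k f : tower j f -> tower j ((-1) ^+ k * f).
Proof.
move=> tf; rewrite -signr_odd; case: odd; rewrite ?expr1 ?expr0 ?mul1r //.
by rewrite mulN1r; apply: lspan_opp.
Qed.

Lemma low_roots_n i : tower n (low_roots n)`_i.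
Proof.
have [ni|iln] := ltnP n i.
  by rewrite nth_default ?size_low_roots //; apply: Lspan0.
pose cs : n.-tuple S := [tuple 'X_i | i < n].
have csE j : tnth cs j = 'X_j by rewrite tnth_mktuple.
have -> : low_roots n = \prod_(c <- cs) ('X - c%:P).
  rewrite big_tuple /low_roots; apply: eq_big => [j|j _]; first by rewrite ltn_ord.
  by rewrite csE.
have lt : (n - i < n.+1)%N by rewrite ltnS leq_subr.
have := mroots_coeff cs (Ordinal lt); rewrite /= subKn // => ->.
have -> : (mesym n S (n - i)).@[tnth cs] = mesym n F (n - i).
  rewrite /mesym rmorph_sum; apply: eq_bigr => h _.
  rewrite rmorph_prod; apply: eq_bigr => k _.
  by rewrite -csE; exact: mevalXU.
exact/tower_sign/tower_mesym.
Qed.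

(* x_j is a root of the monic polynomial [low_roots j.+1] of degree j + 1,
   whose coefficients only involve the x_i with i > j and the e_k. *)
Lemma closed_step (j : 'I_n) : closed_above j.+1 ->
  (forall i, tower j.+1 (low_roots j.+1)`_i) -> closed_above j.
Proof.
move=> cj tc i ji f; apply: lspan_mul => g [a [nu [sa inu a0 ->]]].
pose b := [multinom if k == j then 0%N else a k | k < n].
have aE : a = (U_(j) *+ a j + b)%MM.
  apply/mnmP => k; rewrite mnmDE mulmnE mnm1E mnmE.
  by rewrite eq_sym; case: eqP => [->|]; rewrite ?mul1n ?addn0.
have sb : substair b.
  by apply/forallP => k; rewrite mnmE; case: eqP => // _; apply/(forallP sa).
have b0 (k : 'I_n) : (k < j.+1)%N -> b k = 0%N.
  rewrite ltnS mnmE leq_eqVlt val_eqE; case: eqP => //= _; exact: a0.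
have tb : tower j.+1 ('X_[b] * elem_mon F nu).
  by apply: lspan_gen; exists b, nu; split.
have aj : (a j <= j)%N by apply/(forallP sa).
rewrite {1}aE mpolyXD -mpolyXn -!mulrA.
move: ji; rewrite leq_eqVlt => /predU1P[/val_inj <-|ji]; last first.
  by rewrite mulrCA; apply: tower_pow => //; apply: cj.
have e (h : S) k : 'X_j * ('X_j ^+ k * h) = 'X_j ^+ k.+1 * h by rewrite exprS mulrA.
rewrite {}e; move: aj; rewrite leq_eqVlt => /predU1P[->|aj]; last first.
  exact: tower_pow.
(* Only the power x_j^(j + 1) leaves the staircase; the monic relation replaces it by lower powers
   of x_j with coefficients in the span for j + 1. *)
have : root (low_roots j.+1) 'X_j.
  by rewrite low_roots_step rootM root_XsubC eqxx orbT.
move=> /rootP; rewrite horner_coef size_low_roots // big_ord_recr /=.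
have -> : (low_roots j.+1)`_j.+1 = 1.
  by have := low_roots_monic j.+1; rewrite monicE /lead_coef size_low_roots // => /eqP.
rewrite mul1r addrC => /eqP; rewrite addr_eq0 => /eqP ->.
rewrite mulNr; apply: lspan_opp; rewrite mulr_suml; apply: lspan_sum => k _.
rewrite mulrAC mulrC; apply: tower_pow; first by rewrite -ltnS.
exact: closed_mul.
Qed.

(** Synthetic division by X - x_j: coefficient i of the quotient is coefficient i + 1 of the
    dividend plus x_j times coefficient i + 1 of the quotient. The induction runs down from the
    leading coefficient. *)
Lemma low_roots_coef_step (j : 'I_n) : closed_above j ->
  (forall i, tower j.+1 (low_roots j.+1)`_i) -> forall i, tower j (low_roots j)`_i.
Proof.
move=> cj tc i; have [k] := ubnP (j.+1 - i)%N.
elim: k i => // k IH i ik; have [ji|ij] := ltnP j i.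
  by rewrite nth_default ?size_low_roots ?(ltnW (ltn_ord j)) //; apply: Lspan0.
have := congr1 (fun p : {poly S} => p`_i.+1) (low_roots_step j).
rewrite mulrBr coefB coefMX coefMC /= => /eqP; rewrite eq_sym subr_eq => /eqP ->.
apply: lspan_add; first exact: tower_le (leqnSn j) (tc _).
by rewrite mulrC; apply: cj => //; apply: IH; lia.
Qed.

(** Closure under the variables and control of the coefficients of [low_roots] feed each other, so
    they descend together from j = n, where the first is vacuous and the second is the expression of
    coefficients by the e_k. *)
Lemma tower_total f : tower 0 f.
Proof.
have closed k : (k <= n)%N ->
    closed_above (n - k) /\ forall i, tower (n - k) (low_roots (n - k))`_i.
  elim: k => [|k IH] kn.
    by rewrite subn0; split=> [i|]; [rewrite leqNgt ltn_ord|exact: low_roots_n].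
  have [] := IH (ltnW kn); have lt : (n - k.+1 < n)%N by lia.
  have -> : (n - k = (Ordinal lt).+1)%N by rewrite /=; lia.
  move=> c1 t1; have c2 := closed_step c1 t1.
  split=> //; exact: (low_roots_coef_step c2 t1).
have [] := closed n (leqnn n); rewrite subnn => c0 _.
rewrite [f]mpolyE; apply: lspan_sum => m _; apply: lspan_scale.
rewrite -['X_[m]]mulr1; apply: closed_mon => //.
by rewrite -(mesym0E n F); apply: tower_mesym.
Qed.

(** Projecting on the homogeneous component of degree [mdeg m] discards the generators of other
    degrees and leaves a finite sum over a fixed index set. *)
Lemma art_mon_span m : exists c : 'X_{1..n} -> F,
  'X_[m] = \sum_(k : 'X_{1..n < (mdeg m).+1} | mdeg k == mdeg m) c k *: art_mon F k.
Proof.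
suff H f : tower 0 f -> exists c : 'X_{1..n} -> F, pihomog (@mdeg n) (mdeg m) f =
    \sum_(k : 'X_{1..n < (mdeg m).+1} | mdeg k == mdeg m) c k *: art_mon F k.
  by have := H _ (tower_total 'X_[m]); rewrite pihomog_dE ?dhomogX.
elim=> [|d g {}f [a [nu [sa inu _ ->]]] _ [c IH]].
  by exists (fun=> 0); rewrite raddf0 big1 // => k _; rewrite scale0r.
rewrite pihomog_is_linear {}IH.
rewrite -art_mon_decode //; set k0 := decode a nu.
have [dm|dm] := eqVneq (mdeg k0) (mdeg m); last first.
  by exists c; rewrite (pihomog_ne0 dm) ?art_mon_homog // scaler0 add0r.
exists (fun k => (k == k0)%:R * d + c k).
have lt : (mdeg k0 < (mdeg m).+1)%N by rewrite dm.
under [RHS]eq_bigr do rewrite scalerDl; rewrite big_split /=; congr (_ + _).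
have h0 := art_mon_homog F k0; rewrite dm in h0.
rewrite pihomog_dE // (bigD1 (BMultinom lt)) /= ?dm //.
rewrite eqxx mul1r big1 ?addr0 // => k /andP[_ kk0].
rewrite (_ : (k == k0 :> 'X_{1..n}) = false) ?mul0r ?scale0r //.
by apply: contra_neqF kk0 => /eqP e; apply/val_inj.
Qed.
End ArtinSpan.

(** * The Artin basis and traces *)

(** A left inverse of a square matrix is a right inverse. This is where equality of cardinals turns
    spanning into freeness. *)
Lemma sum_inverse (F : fieldType) (T : finType) (P Q : T -> T -> F) :
  (forall i j, \sum_k Q i k * P k j = (i == j)%:R) ->
  forall i j, \sum_k P i k * Q k j = (i == j)%:R.
Proof.
move=> QP i j.
pose mx (A : T -> T -> F) := \matrix_(i < #|T|, j < #|T|) A (enum_val i) (enum_val j).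
have mxM A B : mx A *m mx B = mx (fun i j => \sum_k A i k * B k j).
  apply/matrixP => a b; rewrite !mxE [RHS](reindex (@enum_val T T)) /=.
    by apply: eq_bigr => k _; rewrite !mxE.
  by apply: onW_bij; exact: enum_val_bij.
have mx1 : mx Q *m mx P = 1%:M.
  by rewrite mxM; apply/matrixP => a b; rewrite !mxE QP (inj_eq enum_val_inj).
have := mulmx1C mx1; rewrite mxM => /matrixP/(_ (enum_rank i) (enum_rank j)).
by rewrite !mxE !enum_rankK (inj_eq enum_rank_inj).
Qed.

Lemma big_bmnm_widen (V : nmodType) n D E (P : pred 'X_{1..n}) (G : 'X_{1..n} -> V) :
  (E <= D)%N ->
  \sum_(m : 'X_{1..n < E} | P m) G m =
  \sum_(m : 'X_{1..n < D} | P m && (mdeg m < E)%N) G m.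
Proof.
move=> ED.
pose h (m : 'X_{1..n < E}) : 'X_{1..n < D} := BMultinom (leq_trans (bmdeg m) ED).
pose h' (m : 'X_{1..n < D}) : option 'X_{1..n < E} := insub (val m).
rewrite [RHS](reindex_omap h h') /h' /=.
  apply: eq_bigl => m; rewrite bmdeg andbT; case: insubP => [u _ e|/negP[]] /=.
    by rewrite (_ : u = m) ?eqxx ?andbT //; apply: val_inj.
  exact: bmdeg.
move=> m /andP[_ mE]; case: insubP => [u _ e|]; last by rewrite mE.
by congr Some; apply: val_inj.
Qed.

Section ArtinCoordinates.
Variables (F : fieldType) (n : nat).
Local Notation S := {mpoly F[n]}.
Implicit Types m k a nu mu : 'X_{1..n}.
Implicit Types f g : S.

Definition art_coef m k : F :=
  if mdeg k == mdeg m then sval (cid (art_mon_span F m)) k else 0.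

Lemma art_coef_neq m k : mdeg k != mdeg m -> art_coef m k = 0.
Proof. by rewrite /art_coef => /negPf ->. Qed.

Lemma art_coefE m D : (mdeg m < D)%N ->
  'X_[m] = \sum_(k : 'X_{1..n < D}) art_coef m k *: art_mon F k.
Proof.
move=> mD; rewrite {1}(svalP (cid (art_mon_span F m))).
rewrite (big_bmnm_widen (fun k => mdeg k == mdeg m)
  (fun k => sval (cid (art_mon_span F m)) k *: art_mon F k) mD) /=.
rewrite [RHS](bigID (fun k : 'X_{1..n < D} => mdeg k == mdeg m)) /=.
rewrite [X in _ + X]big1 ?addr0 => [|k /negPf kn]; last first.
  by rewrite /art_coef kn scale0r.
apply: eq_big => [k|k /andP[/eqP e _]]; last by rewrite /art_coef e eqxx.
by case: eqP => //= ->; rewrite ltnS leqnn.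
Qed.

(** Stopping at degree [mdeg k] loses nothing, since [art_coef m k] vanishes unless m and k have the
    same degree. *)
Definition art_coord k (f : S) : F :=
  \sum_(m : 'X_{1..n < (mdeg k).+1}) f@_m * art_coef m k.

Lemma art_coord_linear k : linear_for *%R (art_coord k).
Proof.
move=> c f g; rewrite /art_coord mulr_sumr -big_split; apply: eq_bigr => m _.
by rewrite mcoeffD mcoeffZ mulrDl mulrA.
Qed.
HB.instance Definition _ k := GRing.isLinear.Build F S F *%R (art_coord k) (art_coord_linear k).

Lemma art_coordX k m : art_coord k 'X_[m] = art_coef m k.
Proof.
rewrite /art_coord; have [mk|mk] := ltnP (mdeg m) (mdeg k).+1.
  rewrite (bigD1 (BMultinom mk)) //= mcoeffX eqxx mul1r big1 ?addr0 // => j jm.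
  rewrite mcoeffX [m == _](_ : _ = false) ?mul0r //.
  by apply: contra_neqF jm => /eqP e; apply/val_inj.
rewrite big1 => [|j _]; first by rewrite /art_coef ltn_eqF.
rewrite mcoeffX [m == _](_ : _ = false) ?mul0r //.
by apply: contraTF mk => /eqP ->; rewrite -ltnNge bmdeg.
Qed.

Lemma art_coord_expand f D : (msize f <= D)%N ->
  f = \sum_(k : 'X_{1..n < D}) art_coord k f *: art_mon F k.
Proof.
move=> fD; rewrite {1}[f](mpolywE fD).
under eq_bigr => m _ do rewrite (art_coefE (bmdeg m)) scaler_sumr.
rewrite exchange_big; apply: eq_bigr => k _ /=.
under eq_bigr => m _ do rewrite scalerA.
rewrite -scaler_suml; congr (_ *: _).
rewrite [f in RHS](mpolywE fD) linear_sum; apply: eq_bigr => m _.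
by rewrite linearZ /= art_coordX.
Qed.

(* The [art_mon F m] span and are as many as the monomials in each degree,
   thanks to the bijection m <-> (codeA m, codeN m), so they are free. *)
Lemma art_coord_art_mon k m : art_coord k (art_mon F m) = (m == k)%:R.
Proof.
have [e|ne] := eqVneq (mdeg m) (mdeg k); last first.
  rewrite [m == k](_ : _ = false); last by apply: contra_neqF ne => /eqP ->.
  rewrite /art_coord big1 // => j _; have [jk|jk] := eqVneq (mdeg j) (mdeg k).
    rewrite (dhomog_nemf_coeff (art_mon_homog F m)) ?mul0r //= jk.
    by rewrite eq_sym.
  by rewrite /art_coef eq_sym (negPf jk) mulr0.
pose T := 'X_{1..n < (mdeg k).+1}.
have inv := @sum_inverse F T (fun i j => (art_mon F i)@_j) (fun i j => art_coef i j).
have lm : (mdeg m < (mdeg k).+1)%N by rewrite e.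
have := inv _ (BMultinom lm) (BMultinom (ltnSn _)).
rewrite /= -val_eqE /=; apply=> i j.
have := congr1 (mcoeff j) (art_coefE (bmdeg i)).
rewrite mcoeffX raddf_sum /= -val_eqE /= => ->.
by apply: eq_bigr => l _; rewrite mcoeffZ.
Qed.

Lemma art_mon_mul_elem nu m : increasing nu ->
  elem_mon F nu * art_mon F m = art_mon F (decode (codeA m) (codeN m + nu)%MM).
Proof.
move=> inu; have im := codeN_increasing m; have sm := codeA_substair m.
rewrite art_mon_decode ?increasingD // /art_mon /= elem_monD //.
by rewrite mulrCA [elem_mon F nu * _]mulrC.
Qed.

(** Multiplication by [elem_mon F nu] permutes basis vectors into basis vectors: it fixes [codeA]
    and adds nu to [codeN], which is injective. *)
Lemma art_coord_mul_elem a nu f : substair a -> increasing nu ->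
  art_coord (decode a nu) (elem_mon F nu * f) = art_coord (decode a 0%MM) f.
Proof.
move=> sa inu; rewrite {1}[f](art_coord_expand (leqnn _)) [f in RHS](art_coord_expand (leqnn _)).
rewrite mulr_sumr !linear_sum /=; apply: eq_bigr => k _.
rewrite -scalerAr !linearZ /=; congr (_ * _).
rewrite art_mon_mul_elem // !art_coord_art_mon; congr (nat_of_bool _)%:R.
apply/eqP/eqP => [e|->].
  have := congr1 (@codeA n) e; have := congr1 (@codeN n) e.
  rewrite !codeA_decode ?codeN_decode ?increasingD ?codeA_substair ?codeN_increasing //.
  move=> e2 e1; rewrite -(codeK k) e1; congr decode.
  by apply/(@addIm _ nu); rewrite e2 add0m.
by rewrite codeA_decode ?codeN_decode ?increasing0 // add0m.
Qed.

(** After the shift by nu no basis vector has [codeN] equal to 0. Hence these coordinates kill the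
    coinvariant ideal and descend to the quotient. *)
Lemma art_coord_elem0 a nu f : substair a -> increasing nu -> nu != 0%MM ->
  art_coord (decode a 0%MM) (elem_mon F nu * f) = 0.
Proof.
move=> sa inu nu0; rewrite [f](art_coord_expand (leqnn _)).
rewrite mulr_sumr linear_sum big1 //= => k _.
rewrite -scalerAr linearZ /= art_mon_mul_elem // art_coord_art_mon.
rewrite [_ == _](_ : _ = false) ?mulr0 //; apply: contra_neqF nu0 => /eqP e.
have := congr1 (@codeN n) e.
rewrite !codeN_decode ?increasingD ?increasing0 ?codeA_substair ?codeN_increasing //.
by move=> /eqP; rewrite mnmD_eq0 => /andP[_ /eqP].
Qed.

(* The trace of [s] in degree d is computed in the bases of monomials and of
   the [art_mon F m]; the matrices of the change of basis cancel. *)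
Lemma trace_art_mon (s : 'S_n) d :
  \sum_(m : 'X_{1..n < d.+1} | mdeg m == d) art_coord m (msym s (art_mon F m)) =
  \sum_(m : 'X_{1..n < d.+1} | mdeg m == d) ([multinom m (s i) | i < n] == m)%:R.
Proof.
have homx (m : 'X_{1..n < d.+1}) : mdeg m == d ->
    art_mon F m = \sum_(j : 'X_{1..n < d.+1} | mdeg j == d) (art_mon F m)@_j *: 'X_[j].
  move=> /eqP md; have sz : (msize (art_mon F m) <= d.+1)%N.
    rewrite msizeE; apply/bigmax_leqP_seq => k km _; rewrite ltnS.
    by rewrite (dhomog_mf (art_mon_homog F m) km) md.
  rewrite {1}[art_mon F m](mpolywE sz).
  rewrite (bigID (fun j : 'X_{1..n < d.+1} => mdeg j == d)) /=.
  rewrite [X in _ + X]big1 ?addr0 // => j /negPf jd.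
  rewrite (dhomog_nemf_coeff (art_mon_homog F m)) ?scale0r //=.
  by rewrite md jd.
transitivity (\sum_(j : 'X_{1..n < d.+1} | mdeg j == d)
   \sum_(m : 'X_{1..n < d.+1} | mdeg m == d)
     (art_mon F m)@_j * art_coord m (msym s 'X_[j])).
  rewrite exchange_big; apply: eq_bigr => m md.
  rewrite {1}(homx m md) [msym s _]raddf_sum linear_sum; apply: eq_bigr => j _ /=.
  by rewrite msymZ linearZ.
apply: eq_bigr => j /eqP jd; rewrite msymX.
set j' := [multinom _ | _ < _].
have j'd : mdeg j' = d by rewrite /j' mdeg_mperm.
have lj' : (mdeg j' < d.+1)%N by rewrite j'd.
have := congr1 (mcoeff j) (art_coefE lj').
rewrite mcoeffX raddf_sum /= (bigID (fun m : 'X_{1..n < d.+1} => mdeg m == d)) /=.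
rewrite [X in _ + X]big1 ?addr0 => [|m md]; last first.
  have /negPf {}md : mdeg m != mdeg j' by rewrite j'd.
  by rewrite /art_coef md scale0r mcoeff0.
move=> e; transitivity ((j' == j)%:R : F).
  by rewrite e; apply: eq_bigr => m _; rewrite art_coordX mcoeffZ mulrC.
congr (nat_of_bool _)%:R; apply/eqP/eqP => /mnmP e'; apply/mnmP => i.
  by have := e' (s i); rewrite !mnmE permK => <-.
by have := e' (s^-1 i)%g; rewrite !mnmE permKV => <-.
Qed.
End ArtinCoordinates.

(** * The coinvariant algebra *)

(** An instance of tr(AB) = tr(BA), with A expanding [vbasis U] along u and B expanding the f (u i)
    along [vbasis U]. It frees the trace from the unknown basis [vbasis U]. *)
Lemma trace_on_dual (F : fieldType) (V : vectType F) (U : {vspace V}) (f : 'End(V))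
    (T : finType) (P : pred T) (u : T -> V) (l : T -> {scalar V}) :
  (forall i, P i -> f (u i) \in U) ->
  {in U, forall v, v = \sum_(i | P i) l i v *: u i} ->
  trace_on U f = \sum_(i | P i) l i (f (u i)).
Proof.
move=> fU uE; rewrite /trace_on.
transitivity (\sum_(k < \dim U) \sum_(i | P i)
   l i (vbasis U)`_k * coord (vbasis U) k (f (u i))).
  apply: eq_bigr => k _; rewrite {1}[(vbasis U)`_k]uE.
    by rewrite linear_sum linear_sum; apply: eq_bigr => i _; rewrite !linearZ.
  by apply/vbasis_mem/mem_nth; rewrite size_tuple.
rewrite exchange_big; apply: eq_bigr => i Pi /=.
rewrite [f (u i) in RHS](coord_vbasis (fU i Pi)) linear_sum; apply: eq_bigr => k _.
by rewrite linearZ mulrC.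
Qed.

Section CoinvariantBasis.
Variables (F : fieldType) (n : nat).
Local Notation S := {mpoly F[n]}.
Local Notation R := (coinvariant F n).
Implicit Types m k a nu mu : 'X_{1..n}.
Implicit Types f g : S.

Lemma coinv_pi_mesym (k : nat) : (0 < k <= n)%N -> coinv_pi (mesym n F k) = 0.
Proof.
case: k => // k /= kn; apply/eqP; rewrite -(rmorph0 (@coinv_pi F n)) coinv_piP subr0.
apply/asboolP; exists (fun j => (j == Ordinal kn)%:R).
rewrite (bigD1 (Ordinal kn)) //= eqxx mul1r big1 ?addr0 // => j /negPf ->.
by rewrite mul0r.
Qed.

Lemma coinv_pi_elem nu : increasing nu -> nu != 0%MM -> coinv_pi (elem_mon F nu) = 0.
Proof.
(* At the first nonzero entry of nu the exponent of e_(n - i) is the entry itself, hence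
   positive. *)
move=> inu nu0; have [i ni pi0] : exists2 i, nu i != 0%N & mprev nu i = 0%N.
  have [j nj] : exists j, nu j != 0%N.
    apply/existsP; apply: contraNT nu0; rewrite negb_exists => /forallP H.
    by apply/eqP/mnmP => i; have := H i; rewrite negbK mnm0E => /eqP.
  have ex : exists k : nat, (k < n)%N && (nth 0%N nu k != 0%N).
    by exists j; rewrite ltn_ord -(mnm_nth 0%N).
  case: (ex_minnP ex) => k /andP[kn nk] kmin; exists (Ordinal kn).
    by rewrite (mnm_nth 0%N).
  case: k kn nk kmin => [|k] kn nk kmin //; rewrite mprevS.
  apply/eqP; rewrite (mnm_nth 0%N) /=; apply: contraTT (ltnSn k) => nk'.
  by rewrite -leqNgt; apply: kmin; rewrite nk' ltnW.
rewrite /elem_mon rmorph_prod (bigD1 i) //= pi0 subn0 rmorphXn /=.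
rewrite coinv_pi_mesym; first by rewrite expr0n (negPf ni) mul0r.
by have := ltn_ord i; lia.
Qed.

(** Defined through a representative; the value 0 off the staircase makes it a linear form for every
    a. *)
Definition coinv_coord (a : 'X_{1..n}) (v : R) : F :=
  if substair a then art_coord (decode a 0%MM) (repr v) else 0.

(** Independence of the representative: two of them differ by a combination of the e_(i + 1), each
    an [elem_mon] of a nonzero sequence. *)
Lemma coinv_coord_pi a f : substair a -> coinv_coord a (coinv_pi f) = art_coord (decode a 0%MM) f.
Proof.
rewrite /coinv_coord => sa; rewrite sa; apply/eqP; rewrite -subr_eq0 -linearB /=.
have : repr (coinv_pi f) - f \in @coinv_ideal F n by rewrite -coinv_piP coinv_reprK.
move=> /asboolP[g ->]; rewrite linear_sum big1 // => i _.
have lt : (n - i.+1 < n)%N by have := ltn_ord i; lia.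
have -> : i.+1 = (n - Ordinal lt)%N by rewrite /= subKn.
rewrite -elem_mon_mstep mulrC; apply: art_coord_elem0 => //; first exact: increasing_mstep.
exact: mstep_neq0.
Qed.

Lemma coinv_coord_linear a : linear_for *%R (coinv_coord a).
Proof.
move=> c u v; rewrite -[u]coinv_reprK -[v]coinv_reprK -linearP.
have [sa|/negPf na] := boolP (substair a); last by rewrite /coinv_coord na mulr0 addr0.
by rewrite !coinv_coord_pi // linearP.
Qed.
HB.instance Definition _ a := GRing.isLinear.Build F R F *%R (coinv_coord a) (coinv_coord_linear a).


Lemma decode0_inj a b : substair a -> substair b ->
  decode a 0%MM = decode b 0%MM -> a = b.
Proof.
move=> sa sb /(congr1 (@codeA n)).
by rewrite !codeA_decode ?increasing0.
Qed.

Lemma art_mon_decode0 a : substair a -> art_mon F (decode a 0%MM) = 'X_[a].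
Proof. by move=> sa; rewrite art_mon_decode ?increasing0 // elem_mon0 mulr1. Qed.

Lemma coinv_coord_X a b : substair a -> substair b -> coinv_coord a (coinv_pi 'X_[b]) = (b == a)%:R.
Proof.
move=> sa sb; rewrite coinv_coord_pi // -art_mon_decode0 // art_coord_art_mon.
congr (nat_of_bool _)%:R; apply/eqP/eqP => [|->//].
exact: decode0_inj.
Qed.

(** In the quotient only the basis vectors with [codeN] equal to 0 survive, and these are the
    sub-staircase monomials. *)
Lemma coinv_pi_expand f D : (msize f <= D)%N ->
  coinv_pi f = \sum_(a : 'X_{1..n < D} | substair a)
    art_coord (decode a 0%MM) f *: coinv_pi 'X_[a].
Proof.
move=> fD; rewrite {1}(art_coord_expand fD) linear_sum /=.
rewrite (bigID (fun k : 'X_{1..n < D} => codeN k == 0%MM)) /= [X in _ + X]big1 ?addr0.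
  pose h (a : 'X_{1..n < D}) : 'X_{1..n < D} := insubd a (decode a 0%MM).
  pose h' (k : 'X_{1..n < D}) : 'X_{1..n < D} := insubd k (codeA k).
  have hE (a : 'X_{1..n < D}) : substair a -> h a = decode a 0%MM :> 'X_{1..n}.
    by move=> sa; rewrite val_insubd mdeg_decode ?increasing0 // mdeg0 addn0 bmdeg.
  have h'E (k : 'X_{1..n < D}) : h' k = codeA k :> 'X_{1..n}.
    rewrite val_insubd (leq_ltn_trans _ (bmdeg k)) // -[mdeg (bmnm k)]mdeg_code.
    exact: leq_addr.
  rewrite (reindex_onto h h') => [|k /eqP k0].
    apply: eq_big => [a|a /andP[/eqP ka /eqP ha]].
      apply/andP/idP => [[/eqP _ /eqP <-]|sa].
        by rewrite h'E codeA_substair.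
      rewrite -[_ == a]val_eqE /= h'E hE // codeA_decode ?codeN_decode ?increasing0 //.
    have sa : substair a by rewrite -ha h'E codeA_substair.
    by rewrite linearZ /= hE // art_mon_decode0.
  apply: val_inj; rewrite /= hE h'E ?codeA_substair // -k0; exact: codeK.
move=> k k0; rewrite linearZ /= /art_mon rmorphM /= coinv_pi_elem ?mulr0 ?scaler0 //.
exact: codeN_increasing.
Qed.

Lemma coinv_pi_homog_expand d m : mdeg m = d ->
  coinv_pi 'X_[m] = \sum_(a : 'X_{1..n < d.+1} | substair a && (mdeg a == d))
    coinv_coord a (coinv_pi 'X_[m]) *: coinv_pi 'X_[a] :> R.
Proof.
move=> md; rewrite {1}(@coinv_pi_expand _ d.+1) ?msizeX ?md //.
rewrite (bigID (fun a : 'X_{1..n < d.+1} => mdeg a == d)) /=.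
rewrite [X in _ + X]big1 ?addr0 => [|a /andP[sa da]].
  by apply: eq_bigr => a /andP[sa da]; rewrite coinv_coord_pi.
rewrite art_coordX art_coef_neq ?scale0r //.
by rewrite mdeg_decode ?increasing0 // mdeg0 addn0 md.
Qed.

Lemma mem_coinv_deg d m : mdeg m = d -> coinv_pi 'X_[m] \in coinv_deg F n d.
Proof.
move=> md; have lt : (mdeg m < d.+1)%N by rewrite md.
apply: memv_span.
apply/mapP; exists (BMultinom lt) => //.
by rewrite mem_enum inE /= md.
Qed.

Lemma coinv_deg_expand d (v : R) : v \in coinv_deg F n d ->
  v = \sum_(a : 'X_{1..n < d.+1} | substair a && (mdeg a == d))
        coinv_coord a v *: coinv_pi 'X_[a].
Proof.
pose X : seq R := [seq coinv_pi 'X_[m] | m : 'X_{1..n < d.+1}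
                         in [pred m : 'X_{1..n < d.+1} | mdeg m == d]].
move=> vdeg; have vX : v \in <<X>>%VS by [].
have XE i : (i < size X)%N -> exists2 m, mdeg m = d & X`_i = coinv_pi 'X_[m].
  move=> iX; have : X`_i \in X by apply: mem_nth.
  by case/mapP => m; rewrite mem_enum inE => /eqP md ->; exists m.
pose L := \sum_(a : 'X_{1..n < d.+1} | substair a && (mdeg a == d))
        coinv_coord a v *: coinv_pi 'X_[a] : R.
rewrite -/L (coord_span (X := in_tuple X) vX) /L.
under [RHS]eq_bigr => a _.
  rewrite {1}(coord_span (X := in_tuple X) vX) linear_sum scaler_suml; over.
rewrite exchange_big; apply: eq_bigr => i _ /=.
under eq_bigr => a _ do rewrite linearZ -scalerA.
rewrite -scaler_sumr; congr (_ *: _).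
by have [m md ->] := XE i (ltn_ord i); apply: coinv_pi_homog_expand.
Qed.

Lemma coinv_perm_deg d (s : 'S_n) m : mdeg m = d ->
  coinv_perm F s (coinv_pi 'X_[m]) \in coinv_deg F n d.
Proof.
by move=> md; rewrite coinv_permE msymX; apply: mem_coinv_deg; rewrite mdeg_mperm.
Qed.

Lemma trace_coinv_deg d (s : 'S_n) :
  trace_on (coinv_deg F n d) (coinv_perm F s) =
  \sum_(a : 'X_{1..n < d.+1} | substair a && (mdeg a == d))
     art_coord (decode a 0%MM) (msym s 'X_[a]).
Proof.
rewrite (@trace_on_dual F R _ _ 'X_{1..n < d.+1}
   (fun a : 'X_{1..n < d.+1} => substair a && (mdeg a == d))
   (fun a : 'X_{1..n < d.+1} => coinv_pi 'X_[a])
   (fun a : 'X_{1..n < d.+1} => coinv_coord a)).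
- by apply: eq_bigr => a /andP[sa _]; rewrite /= coinv_permE coinv_coord_pi.
- by move=> a /andP[_ /eqP]; apply: coinv_perm_deg.
- exact: coinv_deg_expand.
Qed.

Lemma msym_elem_mon (s : 'S_n) nu : msym s (elem_mon F nu) = elem_mon F nu.
Proof.
rewrite /elem_mon rmorph_prod; apply: eq_bigr => i _; rewrite rmorphXn /=.
by have /issymP -> := mesym_sym n F (n - i).
Qed.

(** Since the e_k are invariant, s acts on the factor ['X_[codeA m]] alone, and the diagonal
    coefficient at m depends only on [codeA m]. The trace on polynomials thereby becomes a
    convolution of traces on the coinvariant algebra. *)
Lemma sum_trace_code d (s : 'S_n) :
  \sum_(m : 'X_{1..n < d.+1} | mdeg m == d)
     art_coord (decode (codeA m) 0%MM) (msym s 'X_[codeA m]) =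
  \sum_(m : 'X_{1..n < d.+1} | mdeg m == d) ([multinom m (s i) | i < n] == m)%:R :> F.
Proof.
rewrite -trace_art_mon; apply: eq_bigr => m _.
rewrite /art_mon msymM /= msym_elem_mon mulrC -{3}[bmnm m]codeK.
by rewrite art_coord_mul_elem ?codeA_substair ?codeN_increasing.
Qed.

Lemma exponent_substair (k : 'I_#|substaircase n|) : substair (exponent (enum_val k)).
Proof.
have := enum_valP k; rewrite inE => /forallP sk.
by apply/forallP => j; rewrite mnmE.
Qed.

Lemma exponent_inj : injective (@exponent n).
Proof.
move=> a b /mnmP e; apply/ffunP => j; apply: val_inj.
by have := e j; rewrite !mnmE.
Qed.

Lemma artin_nth (i : 'I_#|substaircase n|) :
  (artin_basis F n)`_i = coinv_pi 'X_[exponent (enum_val i)].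
Proof. by rewrite (nth_map i) ?size_enum_ord // nth_ord_enum. Qed.

Lemma coinv_coord_artin (i j : 'I_#|substaircase n|) :
  coinv_coord (exponent (enum_val i)) (artin_basis F n)`_j = (j == i)%:R.
Proof.
rewrite artin_nth coinv_coord_X ?exponent_substair //.
by rewrite (inj_eq exponent_inj) (inj_eq enum_val_inj).
Qed.

Lemma artin_free : free (artin_basis F n).
Proof.
apply/freeP => c c0 i; have := congr1 (coinv_coord (exponent (enum_val i))) c0.
under eq_bigr do rewrite artin_nth.
have kX j : coinv_coord (exponent (enum_val i)) (coinv_pi 'X_[exponent (enum_val j)] : R) =
    (j == i :> 'I_#|substaircase n|)%:R by rewrite -artin_nth coinv_coord_artin.
rewrite linear0 linear_sum (bigD1 i) //= linearZ /= kX eqxx mulr1.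
rewrite big1 ?addr0 // => j /negPf ji.
by rewrite linearZ /= kX ji mulr0.
Qed.

Lemma substair_exponent a : substair a ->
  exists i : 'I_#|substaircase n|, exponent (enum_val i) = a.
Proof.
move=> /forallP sa.
pose b : {ffun 'I_n -> 'I_n} := [ffun j => Ordinal (leq_ltn_trans (sa j) (ltn_ord j))].
have bs : b \in substaircase n.
  by rewrite inE; apply/forallP => j; rewrite ffunE /=; exact: sa.
exists (enum_rank_in bs b); rewrite enum_rankK_in //.
by apply/mnmP => j; rewrite mnmE ffunE.
Qed.

Lemma artin_coord_X (i j : 'I_#|substaircase n|) :
  coord (artin_basis F n) i (coinv_pi 'X_[exponent (enum_val j)]) = (i == j)%:R.
Proof. by rewrite -artin_nth coord_free ?artin_free // eq_sym. Qed.

End CoinvariantBasis.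

(** * Jordan-Hoelder and the 0-Hecke action *)

Section JordanHolder.
Variables (F : fieldType) (V : vectType F) (n : nat) (op : 'I_n.-1 -> 'End(V)).
Implicit Types (U W : {vspace V}) (s : seq {set 'I_n.-1}).

Lemma composition_stable U s : composition_factors op U s ->
  forall i v, v \in U -> op i v \in U.
Proof.
case=> [i v|W W' I {}s _ [WW' _ H] i v vW].
  by rewrite !memv0 => /eqP ->; rewrite linear0.
have := memvB (subvP WW' _ (H i v vW)) (memvZ (i \in I)%:R vW).
by rewrite addrK.
Qed.

Lemma composition_dim U s : composition_factors op U s -> size s = \dim U.
Proof.
by elim=> [|W W' I {}s _ IH [_ dW _]] /=; rewrite ?dimv0 ?IH.
Qed.

Lemma hecke0_factor_uniq W W' I J :
  hecke0_factor op W W' I -> hecke0_factor op W W' J -> I = J.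
Proof.
move=> [WW' dW HI] [_ _ HJ]; apply/setP => i.
have /subvPn[v vW' vW] : ~~ (W' <= W)%VS.
  by apply/negP => /dimvS; rewrite dW ltnn.
have := memvB (HI i v vW') (HJ i v vW').
rewrite opprD addrACA subrr add0r -scalerBl.
case: (i \in I); case: (i \in J) => //; rewrite ?subr0 ?sub0r ?scaleN1r ?memvN ?scale1r.
  by move=> vW1; rewrite vW1 in vW.
by move=> vW1; rewrite vW1 in vW.
Qed.

(** Diamond argument: if W differs from the top submodule W0 of the given series, their intersection
    has factor I in W0 and I0 in W. The induction hypothesis for W0 gives a series of the
    intersection, which I0 extends to W. *)
Lemma composition_exchange U s : composition_factors op U s ->
  forall W I, hecke0_factor op W U I ->
  exists2 s', composition_factors op W s' & perm_eq (I :: s') s.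
Proof.
elim=> [|W0 U' I0 {}s C IH f0] W I f.
  by have [_] := f; rewrite dimv0.
have [W0W|W0W] := eqVneq W W0.
  exists s; first by rewrite W0W.
  by rewrite -W0W in f0; rewrite (hecke0_factor_uniq f f0).
have [WU dU H] := f; have [W0U dU0 H0] := f0.
have dWW0 : \dim W = \dim W0 by apply: succn_inj; rewrite -dU -dU0.
(* Two distinct subspaces of codimension one have the whole of U' as sum, so their intersection has
   codimension one in each. *)
have sumU : (W + W0)%VS = U'.
  apply/eqP; rewrite eqEdim subv_add WU W0U /= dU0.
  have [sub|] := boolP (W <= W0)%VS.
    by case/eqP: W0W; apply/eqP; rewrite eqEdim sub dWW0 leqnn.
  move=> nsub; rewrite ltnNge; apply: contra nsub => le.
  have /eqP -> : W0 == (W + W0)%VS by rewrite eqEdim addvSr le.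
  exact: addvSl.
have dX := dimv_sum_cap W W0; rewrite sumU in dX.
have dXW0 : \dim W0 = (\dim (W :&: W0)).+1 by lia.
have st0 := composition_stable C.
have stX (J : {set 'I_n.-1}) (A : {vspace V}) :
   (forall i v, v \in U' -> op i v + (i \in J)%:R *: v \in A) -> (A <= U')%VS -> forall i v, v \in A -> op i v \in A.
  move=> HJ AU i v vA; have := memvB (HJ i v (subvP AU v vA)) (memvZ (i \in J)%:R vA).
  by rewrite addrK.
have fW0 : hecke0_factor op (W :&: W0) W0 I.
  split=> // [|i v vW0]; first exact: capvSr.
  rewrite memv_cap H ?(subvP W0U) //= memvD ?memvZ //; exact: st0.
have fW : hecke0_factor op (W :&: W0) W I0.
  split=> [||i v vW]; [exact: capvSl|by rewrite dWW0|].
  rewrite memv_cap H0 ?(subvP WU) // andbT memvD ?memvZ //.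
  exact: (stX I W H WU).
have [s1 C1 p1] := IH _ _ fW0.
exists (I0 :: s1); first exact: CompositionCons C1 fW.
rewrite -(perm_cons I0) in p1.
exact: perm_trans (permEl (perm_catCA [:: I] [:: I0] s1)) p1.
Qed.

Lemma composition_perm U s s' :
  composition_factors op U s -> composition_factors op U s' -> perm_eq s s'.
Proof.
move=> C; elim: C s' => [|W W' I {}s _ IH f] s' C'.
  by have := composition_dim C'; rewrite dimv0 => /size0nil ->.
have [s1 C1 p1] := composition_exchange C' f.
by rewrite (perm_trans _ p1) // perm_cons IH.
Qed.

Lemma qsym_frobenius_charE U N s :
  hecke0_action op -> composition_factors op U s ->
  qsym_frobenius_char op U N = \sum_(I <- s) fundamental_qsym F N I.
Proof.
move=> act C; rewrite /qsym_frobenius_char; set P := [set _ | _]%classic.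
have [_ C'] : P (xget [::] P) by apply: xgetI; split; [exact: act|exact: C].
by apply: perm_big; apply: composition_perm C' C.
Qed.
End JordanHolder.

(** * The 0-Hecke relations on sub-staircase monomials *)

Section HeckeAction.
Variables (F : fieldType) (n : nat).
Local Notation R := (coinvariant F n).
Local Notation op := (@hecke0_coinv F n).
Implicit Types m : 'X_{1..n}.

Definition mswap (i : 'I_n.-1) m : 'X_{1..n} :=
  [multinom m (tperm (lpos i) (rpos i) j) | j < n].

Lemma lpos_neq_rpos (i : 'I_n.-1) : lpos i != rpos i.
Proof. by rewrite -val_eqE /= neq_ltn ltnSn. Qed.

Lemma mswapL i m : mswap i m (lpos i) = m (rpos i).
Proof. by rewrite mnmE tpermL. Qed.
Lemma mswapR i m : mswap i m (rpos i) = m (lpos i).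
Proof. by rewrite mnmE tpermR. Qed.
Lemma mswapD i m j : lpos i != j -> rpos i != j -> mswap i m j = m j.
Proof. by move=> lj rj; rewrite mnmE tpermD. Qed.

(** The larger exponent moves right, where the bound is weaker, and the smaller one fits under the
    bound that the larger one satisfied. *)
Lemma mswap_substair i m : (m (rpos i) < m (lpos i))%N -> substair m ->
  substair (mswap i m).
Proof.
move=> rl /forallP sm; apply/forallP => j.
have [<-|lj] := eqVneq (lpos i) j; first by rewrite mswapL (leq_trans (ltnW rl)).
have [<-|rj] := eqVneq (rpos i) j; last by rewrite mswapD.
by rewrite mswapR (leq_trans (sm _)) //= leqnSn.
Qed.

Lemma hecke0_coinvX i m : substair m -> op i (coinv_pi 'X_[m]) = hecke0_monomial F i m.
Proof.
move=> /substair_exponent[k <-]; rewrite lfunE /= /hecke0_coinv_fun (bigD1 k) //=.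
rewrite artin_coord_X eqxx scale1r big1 ?addr0 // => j /negPf jk.
by rewrite artin_coord_X jk scale0r.
Qed.

Lemma hecke0_eq i m : substair m -> m (lpos i) = m (rpos i) -> op i (coinv_pi 'X_[m]) = 0.
Proof. by move=> sm e; rewrite hecke0_coinvX // /hecke0_monomial e eqxx. Qed.

Lemma hecke0_lt i m : substair m -> (m (lpos i) < m (rpos i))%N ->
  op i (coinv_pi 'X_[m]) = - coinv_pi 'X_[m].
Proof. by move=> sm lt; rewrite hecke0_coinvX // /hecke0_monomial ltn_eqF // lt. Qed.

Lemma hecke0_gt i m : substair m -> (m (rpos i) < m (lpos i))%N ->
  op i (coinv_pi 'X_[m]) = coinv_pi 'X_[mswap i m].
Proof.
by move=> sm lt; rewrite hecke0_coinvX // /hecke0_monomial gtn_eqF // ltnNge ltnW.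
Qed.

Lemma end_coinv_eq (f g : 'End(R)) :
  (forall m, substair m -> f (coinv_pi 'X_[m]) = g (coinv_pi 'X_[m])) -> f = g.
Proof.
move=> fg; apply/lfunP => v; rewrite -[v]coinv_reprK (coinv_pi_expand (leqnn _)).
rewrite !linear_sum; apply: eq_bigr => a sa.
by rewrite !linearZ /= fg.
Qed.

Lemma hecke0_coinv_action : hecke0_action op.
Proof.
split=> [i|i j ij|i j ji]; apply: end_coinv_eq => m sm; rewrite ?opp_lfunE !comp_lfunE /=.
- case: (ltngtP (m (lpos i)) (m (rpos i))) => c.
  + by rewrite hecke0_lt // linearN /= hecke0_lt.
  + rewrite (@hecke0_gt i m) // hecke0_lt ?mswap_substair // ?mswapL ?mswapR //.
  + by rewrite hecke0_eq // linear0 oppr0.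
- have [d1 d2] : lpos i != lpos j /\ lpos i != rpos j by rewrite -!val_eqE /=; lia.
  have [d3 d4] : rpos i != lpos j /\ rpos i != rpos j by rewrite -!val_eqE /=; lia.
  have comm : mswap i (mswap j m) = mswap j (mswap i m).
    apply/mnmP => k; rewrite !mnmE -!permM conjgC tpermJ !tpermD // eq_sym //.
  have ij1 : mswap i m (lpos j) = m (lpos j) by rewrite mswapD.
  have ij2 : mswap i m (rpos j) = m (rpos j) by rewrite mswapD.
  have ji1 : mswap j m (lpos i) = m (lpos i) by rewrite mswapD // eq_sym.
  have ji2 : mswap j m (rpos i) = m (rpos i) by rewrite mswapD // eq_sym.
  case: (ltngtP (m (lpos i)) (m (rpos i))) => ci;
  case: (ltngtP (m (lpos j)) (m (rpos j))) => cj.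
  + by rewrite !hecke0_lt // !linearN /= !hecke0_lt.
  + by rewrite [in RHS]hecke0_lt // (hecke0_gt sm cj) linearN /= (hecke0_gt sm cj) hecke0_lt
      ?mswap_substair ?ji1 ?ji2.
  + by rewrite (hecke0_eq sm cj) linear0 hecke0_lt // linearN /= (hecke0_eq sm cj) oppr0.
  + by rewrite [in LHS]hecke0_lt // (hecke0_gt sm ci) linearN /= (hecke0_gt sm ci) hecke0_lt
      ?mswap_substair ?ij1 ?ij2.
  + by rewrite (hecke0_gt sm ci) (hecke0_gt sm cj) !hecke0_gt ?mswap_substair
      ?ij1 ?ij2 ?ji1 ?ji2 // comm.
  + by rewrite (hecke0_eq sm cj) linear0 (hecke0_gt sm ci) hecke0_eq ?mswap_substair
      ?ij1 ?ij2.
  + by rewrite (hecke0_eq sm ci) linear0 hecke0_lt // linearN /= (hecke0_eq sm ci) oppr0.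
  + by rewrite (hecke0_eq sm ci) linear0 (hecke0_gt sm cj) hecke0_eq ?mswap_substair
      ?ji1 ?ji2.
  + by rewrite (hecke0_eq sm ci) (hecke0_eq sm cj) !linear0.
- have e : rpos i = lpos j by apply: val_inj; rewrite /= ji.
  have pq : lpos i != lpos j by rewrite -e lpos_neq_rpos.
  have pr : lpos i != rpos j by rewrite -val_eqE /= ji; lia.
  have qr := lpos_neq_rpos j.
  have braid : mswap i (mswap j (mswap i m)) = mswap j (mswap i (mswap j m)).
    apply/mnmP => k; rewrite !mnmE -!permM; congr (m (fun_of_perm _ k)).
    have conjE (x y z t : 'I_n) :
      (tperm x y * (tperm z t * tperm x y) = tperm z t ^ tperm x y)%g.
      by rewrite conjgE tpermV.
    rewrite -?mulgA !conjE !tpermJ.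
    by rewrite e tpermL tpermR !tpermD // eq_sym.
  have iL m' : mswap i m' (lpos i) = m' (lpos j) by rewrite mswapL e.
  have iR m' : mswap i m' (lpos j) = m' (lpos i) by rewrite -e mswapR.
  have iO m' : mswap i m' (rpos j) = m' (rpos j) by rewrite mswapD // e.
  have jL m' : mswap j m' (lpos j) = m' (rpos j) by rewrite mswapL.
  have jR m' : mswap j m' (rpos j) = m' (lpos j) by rewrite mswapR.
  have jO m' : mswap j m' (lpos i) = m' (lpos i) by rewrite mswapD // eq_sym.
  have ssi m' : (m' (lpos j) < m' (lpos i))%N -> substair m' -> substair (mswap i m').
    by rewrite -e; apply: mswap_substair.
  have ssj m' : (m' (rpos j) < m' (lpos j))%N -> substair m' -> substair (mswap j m').
    exact: mswap_substair.
  have i_eq m' : substair m' -> m' (lpos i) = m' (lpos j) -> op i (coinv_pi 'X_[m']) = 0.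
    by rewrite -e; apply: hecke0_eq.
  have i_lt m' : substair m' -> (m' (lpos i) < m' (lpos j))%N ->
      op i (coinv_pi 'X_[m']) = - coinv_pi 'X_[m'].
    by rewrite -e; apply: hecke0_lt.
  have i_gt m' : substair m' -> (m' (lpos j) < m' (lpos i))%N ->
      op i (coinv_pi 'X_[m']) = coinv_pi 'X_[mswap i m'].
    by rewrite -e; apply: hecke0_gt.
  have j_eq := @hecke0_eq j; have j_lt := @hecke0_lt j; have j_gt := @hecke0_gt j.
  have i0 : op i 0 = 0 by rewrite linear0.
  have j0 : op j 0 = 0 by rewrite linear0.
  have iN v : op i (- v) = - op i v by rewrite linearN.
  have jN v : op j (- v) = - op j v by rewrite linearN.
  pose V := (iL, iR, iO, jL, jR, jO).
  (* In each relative order of the three exponents both sides are computed generator by generator.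
     Three successive swaps occur only for strictly decreasing exponents, which is where [braid]
     enters. *)
  case: (ltngtP (m (lpos i)) (m (lpos j))) => c1;
  case: (ltngtP (m (lpos j)) (m (rpos j))) => c2;
  case: (ltngtP (m (lpos i)) (m (rpos j))) => c3; try lia;
  repeat first
    [ rewrite i0 | rewrite j0 | rewrite iN | rewrite jN
    | rewrite i_eq; [|by rewrite ?(ssi, ssj) // ?V|by rewrite ?V; lia]
    | rewrite j_eq; [|by rewrite ?(ssi, ssj) // ?V|by rewrite ?V; lia]
    | rewrite i_lt; [|by rewrite ?(ssi, ssj) // ?V|by rewrite ?V; lia]
    | rewrite j_lt; [|by rewrite ?(ssi, ssj) // ?V|by rewrite ?V; lia]
    | rewrite i_gt; [|by rewrite ?(ssi, ssj) // ?V|by rewrite ?V; lia]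
    | rewrite j_gt; [|by rewrite ?(ssi, ssj) // ?V|by rewrite ?V; lia] ];
  rewrite ?oppr0 ?opprK ?braid //.
Qed.
End HeckeAction.

(** * Composition series of monomials *)

Section Composition.
Variables (F : fieldType) (n : nat).
Local Notation R := (coinvariant F n).
Local Notation op := (@hecke0_coinv F n).
Implicit Types m : 'X_{1..n}.

Definition ascents m : {set 'I_n.-1} := [set i | m (lpos i) < m (rpos i)]%N.

(* [moment] increases when an adjacent descent is swapped, hence it orders the
   monomials into a composition series. *)
Definition moment m : nat := (\sum_(j < n) j * m j)%N.

Lemma moment_mswap i m : (m (rpos i) < m (lpos i))%N -> (moment m < moment (mswap i m))%N.
Proof.
have split2 (f : 'I_n -> nat) : (\sum_j f j =
    f (lpos i) + (f (rpos i) + \sum_(j | (j != lpos i) && (j != rpos i)) f j))%N.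
  rewrite (bigD1 (lpos i)) //= (bigD1 (rpos i)) //=.
  by rewrite eq_sym lpos_neq_rpos.
move=> lt; rewrite /moment !split2.
rewrite mswapL mswapR.
rewrite [X in (_ < _ + (_ + X))%N](eq_bigr (fun j : 'I_n => j * m j)%N).
  by rewrite /= !mulSn; lia.
by move=> j /andP[jl jr]; rewrite mswapD // eq_sym.
Qed.

Lemma mdeg_mswap i m : mdeg (mswap i m) = mdeg m.
Proof. exact: mdeg_mperm. Qed.

Local Notation mons l := [seq (coinv_pi 'X_[a] : R) | a <- l].

Lemma coinv_coord_span0 (l : seq 'X_{1..n}) m : substair m -> all (@substair n) l -> m \notin l ->
  forall v, v \in <<mons l>>%VS -> coinv_coord m v = 0.
Proof.
move=> sm sl ml v vl; rewrite (coord_span (X := in_tuple (mons l)) vl) linear_sum.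
apply: big1 => i _; rewrite linearZ /=.
have : (mons l)`_i \in mons l by apply: mem_nth.
case/mapP => a al ->; rewrite coinv_coord_X //; last exact: (allP sl).
rewrite [_ == _](_ : _ = false) ?mulr0 //.
by apply: contraNF ml => /eqP <-.
Qed.

Lemma free_mons (l : seq 'X_{1..n}) : all (@substair n) l -> uniq l -> free (mons l).
Proof.
elim: l => [|a l IH] /=; first by rewrite nil_free.
move=> /andP[sa sl] /andP[al ul]; rewrite free_cons IH // andbT.
apply/negP => /(coinv_coord_span0 sa sl al)/eqP.
by rewrite coinv_coord_X // eqxx oner_eq0.
Qed.

(** The head has the least moment, so the tail is still stable under swaps and spans a submodule. On
    the quotient line a generator acts by -1 at an ascent; a swap lands in the tail and acts by
    0. *)
Lemma composition_mons (l : seq 'X_{1..n}) :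
  all (@substair n) l -> uniq l -> sorted (relpre moment leq) l ->
  (forall i a, a \in l -> (a (rpos i) < a (lpos i))%N -> mswap i a \in l) ->
  composition_factors op <<mons l>>%VS [seq ascents a | a <- l].
Proof.
elim: l => [|a l IH] /=; first by rewrite span_nil => *; apply: CompositionNil.
move=> /andP[sa sl] /andP[al ul] pal cl.
have le_a b : b \in l -> (moment a <= moment b)%N.
  have tr : transitive (relpre moment leq) by move=> x y z; apply: leq_trans.
  by move=> bl; have /allP/(_ b bl) := order_path_min tr pal.
(* A swap cannot produce the head a, as it strictly increases the moment. *)
have cl' i b : b \in a :: l -> (b (rpos i) < b (lpos i))%N -> mswap i b \in l.
  move=> bl lt; have := cl i b bl lt; rewrite inE => /predU1P[e|//].
  have := moment_mswap lt; rewrite e ltnNge.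
  by move: bl; rewrite inE => /predU1P[->|/le_a ->]; rewrite ?leqnn.
have {}IH := IH sl ul (path_sorted pal)
  (fun i b bl => cl' i b (mem_behead (s := a :: l) bl)).
apply: (CompositionCons IH _); split.
- by rewrite span_cons addvSr.
- have fl := free_mons sl ul; have fal : free (mons (a :: l)).
    by apply: free_mons => /=; rewrite ?sa ?sl ?al.
  by rewrite (eqP fl : \dim <<mons l>>%VS = _) (eqP fal : \dim <<mons (a :: l)>>%VS = _) /=.
move=> i v; rewrite span_cons => /memv_addP[_ /vlineP[c ->] [w wl ->]].
rewrite linearD scalerDr addrACA memvD //; last first.
  by rewrite memvD ?memvZ //; exact: (composition_stable IH).
rewrite linearZ /= scalerA mulrC -scalerA -scalerDr memvZ // inE.
case: (ltngtP (a (lpos i)) (a (rpos i))) => lr.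
- by rewrite hecke0_lt // scale1r addNr mem0v.
- rewrite hecke0_gt // scale0r addr0; apply/memv_span/map_f.
  by rewrite cl' ?mem_head.
- by rewrite hecke0_eq // scale0r addr0 mem0v.
Qed.

Lemma qsym_coinv_deg N d :
  qsym_frobenius_char op (coinv_deg F n d) N =
  \sum_(a : 'X_{1..n < d.+1} | substair a && (mdeg a == d)) fundamental_qsym F N (ascents a).
Proof.
pose P (a : 'X_{1..n < d.+1}) := substair a && (mdeg a == d).
pose l0 : seq 'X_{1..n} := [seq bmnm a | a <- enum P].
have l0P a : (a \in l0) = substair a && (mdeg a == d).
  apply/mapP/idP => [[b]|/andP[sa da]]; first by rewrite mem_enum => bP ->.
  have lt : (mdeg a < d.+1)%N by rewrite (eqP da).
  by exists (BMultinom lt) => //; rewrite mem_enum unfold_in /= sa.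
have tot : total (relpre moment leq) by move=> x y; apply: leq_total.
pose l := sort (relpre moment leq) l0.
have lP a : (a \in l) = substair a && (mdeg a == d) by rewrite mem_sort l0P.
have ul : uniq l.
  by rewrite sort_uniq map_inj_uniq ?enum_uniq //; apply: val_inj.
have sl : all (@substair n) l by apply/allP => a; rewrite lP => /andP[].
have C : composition_factors op <<mons l>>%VS [seq ascents a | a <- l].
  apply: composition_mons => // [|i a]; first exact: sort_sorted.
  by rewrite !lP mdeg_mswap => /andP[sa ->] lt; rewrite mswap_substair.
have spanE : <<mons l>>%VS = coinv_deg F n d.
  apply/eqP; rewrite eqEsubv; apply/andP; split.
    apply/span_subvP => _ /mapP[a + ->]; rewrite lP => /andP[_ /eqP].
    exact: mem_coinv_deg.
  apply/subvP => v /coinv_deg_expand ->; apply: memv_suml => a Pa.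
  by apply/memvZ/memv_span/map_f; rewrite lP.
rewrite (qsym_frobenius_charE N (hecke0_coinv_action F n) (s := [seq ascents a | a <- l])).
  rewrite big_map (perm_big l0) /=; last by rewrite perm_sort.
  by rewrite big_map big_enum.
by rewrite -spanE.
Qed.
End Composition.

(** * Horizontal strips, Pieri rule and Cauchy identity *)

Section HorizontalStrips.
Variable n : nat.
Local Notation shape := 'X_{1..n.+1}.
Local Notation bshape := 'X_{1..n.+1 < n.+1}.
Implicit Types la mu rho kap : shape.

(** Interlacing la_(r+1) <= mu_r <= la_r: the skew shape la/mu has at most one cell per column. It
    forces both shapes to be partitions. *)
Definition hstrip la mu :=
  [forall r : 'I_n.+1, (mu r <= la r)%N && (nth 0%N la r.+1 <= mu r)%N].

Lemma nth_shape_out la r : (n < r)%N -> nth 0%N la r = 0%N.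
Proof. by move=> nr; rewrite nth_default // size_tuple. Qed.

Lemma hstripP la mu : reflect
  (forall r, (nth 0 mu r <= nth 0 la r)%N /\ (nth 0 la r.+1 <= nth 0 mu r)%N)
  (hstrip la mu).
Proof.
apply: (iffP forallP) => [H r|H r]; last first.
  by rewrite !(mnm_nth 0%N); have [-> ->] := H r.
have [nr|rn] := ltnP n r; first by rewrite !nth_shape_out // ltnW.
by have := H (Ordinal (rn : (r < n.+1)%N)); rewrite !(mnm_nth 0%N) => /andP.
Qed.

Lemma mdeg_nth la : mdeg la = (\sum_(r < n.+1) nth 0 la r)%N.
Proof. by rewrite mdegE; apply: eq_bigr => r _; rewrite (mnm_nth 0%N). Qed.

Definition mkshape (f : nat -> nat) : shape := [multinom f i | i < n.+1].

Lemma nth_mkshape (f : nat -> nat) r :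
  nth 0%N (mkshape f) r = if (r < n.+1)%N then f r else 0%N.
Proof.
case: ltnP => rn; last by rewrite nth_shape_out.
by rewrite -[r]/(nat_of_ord (Ordinal rn)) -(mnm_nth 0%N) mnmE.
Qed.

Lemma hstrip_mdeg la mu : hstrip la mu -> (mdeg mu <= mdeg la)%N.
Proof.
by move=> /hstripP H; rewrite !mdeg_nth; apply: leq_sum => r _; case: (H r).
Qed.

(** Interlacing makes la decreasing, and n + 1 nonempty rows would need n + 1 cells. The empty last
    row is the room that the row shift of the local rule requires. *)
Lemma hstrip_last la mu : hstrip la mu -> (mdeg la <= n)%N -> nth 0%N la n = 0%N.
Proof.
move=> /hstripP H; rewrite mdeg_nth => sz.
have dec r : (r <= n -> nth 0 la n <= nth 0 la (n - r))%N.
  elim: r => [|r IH] rn; first by rewrite subn0.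
  apply: leq_trans (IH (ltnW rn)) _; have [a b] := H (n - r.+1)%N.
  by rewrite (_ : n - r = (n - r.+1).+1)%N; [exact: leq_trans b a|lia].
apply/eqP; rewrite -leqn0 leqNgt; apply/negP => pos.
suff : (n.+1 <= n)%N by rewrite ltnn.
apply: leq_trans sz; rewrite -[X in (X <= _)%N]muln1 -[X in (X * _)%N]card_ord -sum_nat_const.
apply: leq_sum => r _; apply: leq_trans pos _.
by have := dec (n - r)%N (leq_subr _ _); rewrite subKn // -ltnS.
Qed.

(* Fomin's local rule: for fixed [la] and [rho], [local_up] and [local_down]
   exchange the shapes [mu] below both with the shapes [kap] of size [e] above
   both, by reflecting row r of [mu] into row r + 1 of [kap]. *)
Definition local_up e la rho mu : shape := mkshape (fun r =>
  if r is r'.+1 then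
    maxn (nth 0 la r) (nth 0 rho r) + minn (nth 0 la r') (nth 0 rho r') - nth 0 mu r'
  else maxn (nth 0 la 0) (nth 0 rho 0) + (mdeg mu + e - (mdeg la + mdeg rho)))%N.

Definition local_down la rho kap : shape := mkshape (fun r =>
  maxn (nth 0 la r.+1) (nth 0 rho r.+1) + minn (nth 0 la r) (nth 0 rho r)
    - nth 0 kap r.+1)%N.

Section Local.
Variables (e : nat) (la rho : shape).
Hypotheses (la_n : (mdeg la <= n)%N) (rho_n : (mdeg rho <= n)%N) (e_n : (e <= n)%N).

Let f := nth 0%N la.
Let g := nth 0%N rho.

Let upE mu r : nth 0%N (local_up e la rho mu) r =
  if (r < n.+1)%N then
    (if r is r'.+1 then maxn (f r) (g r) + minn (f r') (g r') - nth 0 mu r'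
     else maxn (f 0) (g 0) + (mdeg mu + e - (mdeg la + mdeg rho)))%N else 0%N.
Proof. exact: nth_mkshape. Qed.

Let downE kap r : nth 0%N (local_down la rho kap) r =
  if (r < n.+1)%N then
    (maxn (f r.+1) (g r.+1) + minn (f r) (g r) - nth 0 kap r.+1)%N else 0%N.
Proof. exact: nth_mkshape. Qed.

Let sum_max_min : (\sum_(r < n.+1) maxn (f r) (g r) + \sum_(r < n.+1) minn (f r) (g r) =
  mdeg la + mdeg rho)%N.
Proof.
rewrite !mdeg_nth -!big_split; apply: eq_bigr => r _ /=; rewrite /f /g; lia.
Qed.

Lemma local_upP mu : hstrip la mu -> hstrip rho mu ->
  (mdeg la + mdeg rho <= mdeg mu + e)%N ->
  [/\ hstrip (local_up e la rho mu) la, hstrip (local_up e la rho mu) rho,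
      mdeg (local_up e la rho mu) = e & local_down la rho (local_up e la rho mu) = mu].
Proof.
move=> lm rm sz; have fn := hstrip_last lm la_n; have gn := hstrip_last rm rho_n.
move/hstripP: (lm) => H1; move/hstripP: (rm) => H2.
have H r : (nth 0 mu r <= f r /\ nth 0 mu r <= g r /\ f r.+1 <= nth 0 mu r /\
  g r.+1 <= nth 0 mu r)%N by rewrite /f /g; have := H1 r; have := H2 r; lia.
have out r : (n <= r)%N -> (f r = 0 /\ g r = 0 /\ nth 0 mu r = 0)%N.
  rewrite leq_eqVlt => /predU1P[<-|nr]; last by rewrite /f /g !nth_shape_out.
  by have := H n; rewrite /f /g fn gn; lia.
split.
- apply/hstripP => r; rewrite -/(f r) !upE.
  case: r => [|r]; [have := H 0%N|have := H r; have := H r.+1; have := out r.+1];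
  have := H 1%N; have := out 1%N; rewrite ?ltn0Sn; do ?case: ifP; lia.
- apply/hstripP => r; rewrite -/(g r) !upE.
  case: r => [|r]; [have := H 0%N|have := H r; have := H r.+1; have := out r.+1];
  have := H 1%N; have := out 1%N; rewrite ?ltn0Sn; do ?case: ifP; lia.
- rewrite mdeg_nth; have S := sum_max_min.
  have M := mdeg_nth mu; rewrite big_ord_recr /= in M.
  rewrite !big_ord_recr /= -/f -/g in S.
  rewrite big_ord_recl upE /=.
  have -> : (\sum_(i < n) nth 0 (local_up e la rho mu) (lift ord0 i) =
     \sum_(i < n) maxn (f i.+1) (g i.+1) + \sum_(i < n) minn (f i) (g i)
     - \sum_(i < n) nth 0 mu i)%N.
    apply/eqP; rewrite -(eqn_add2r (\sum_(i < n) nth 0 mu i)) subnK.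
      rewrite -!big_split; apply/eqP/eq_bigr => i _; rewrite lift0 upE ltnS ltn_ord /=.
      by have := H i; rewrite /f /g /=; lia.
    rewrite -big_split; apply: leq_sum => i _; have := H i; rewrite /f /g /=; lia.
  have R : (\sum_(i < n) maxn (f i) (g i) + maxn (f n) (g n) =
     maxn (f 0%N) (g 0%N) + \sum_(i < n) maxn (f i.+1) (g i.+1))%N.
    by rewrite -(big_ord_recr n (fun i => maxn (f i) (g i))) big_ord_recl.
  have Le : (\sum_(i < n) nth 0 mu i <= \sum_(i < n) minn (f i) (g i))%N.
    by apply: leq_sum => i _; have := H i; lia.
  have := out n (leqnn n); move: M S R Le sz.
  move: (\sum_(i < n) maxn (f i) (g i))%N => X1.
  move: (\sum_(i < n) maxn (f i.+1) (g i.+1))%N => X2.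
  move: (\sum_(i < n) minn (f i) (g i))%N => X3.
  move: (\sum_(i < n) nth 0 mu i)%N => X4.
  move: (f n) (g n) (f 0%N) (g 0%N) => F1 F2 F3 F4; lia.
- apply/mnmP => r; rewrite !(mnm_nth 0%N) downE ltn_ord upE.
  have := H r; have := out r; have := out r.+1; have := ltn_ord r.
  by case: ifP; lia.
Qed.

Lemma local_downP kap : hstrip kap la -> hstrip kap rho -> mdeg kap = e ->
  [/\ hstrip la (local_down la rho kap), hstrip rho (local_down la rho kap),
      (mdeg la + mdeg rho <= mdeg (local_down la rho kap) + e)%N
    & local_up e la rho (local_down la rho kap) = kap].
Proof.
move=> kl kr ek; have kn := hstrip_last kl; rewrite ek in kn; have {}kn := kn e_n.
move/hstripP: (kl) => H1; move/hstripP: (kr) => H2.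
pose k := nth 0%N kap.
have H r : (f r <= k r /\ g r <= k r /\ k r.+1 <= f r /\ k r.+1 <= g r)%N.
  by rewrite /f /g /k; have := H1 r; have := H2 r; lia.
have out r : (n <= r)%N -> (f r = 0 /\ g r = 0 /\ k r = 0)%N.
  rewrite leq_eqVlt => /predU1P[<-|nr]; last by rewrite /f /g /k !nth_shape_out.
  by have := H n; rewrite /k kn; lia.
(* The overhang of the first row of kap is forgotten by [local_down]; this identity shows that
   [local_up] recovers it from the sizes. *)
have sz : (mdeg la + mdeg rho + (k 0 - maxn (f 0) (g 0)) =
    mdeg (local_down la rho kap) + e)%N.
  rewrite (mdeg_nth (local_down _ _ _)) -ek (mdeg_nth kap) -sum_max_min -/k.
  have R (h : nat -> nat) : h n = 0%N ->
     (\sum_(i < n.+1) h i = h 0%N + \sum_(i < n.+1) h i.+1 - h n.+1)%N.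
    move=> hn; rewrite big_ord_recl [in RHS]big_ord_recr /=.
    by rewrite addnA addnK.
  have h0 h : h n.+1 = 0%N -> h n = 0%N ->
     (\sum_(i < n.+1) h i = h 0%N + \sum_(i < n.+1) h i.+1)%N.
    by move=> e1 e2; rewrite R // e1 subn0.
  have := out n (leqnn n); have := out n.+1 (leqnSn n) => -[fS [gS kS]] [fn [gn kn']].
  rewrite (h0 (fun i => maxn (f i) (g i))) ?fS ?gS ?fn ?gn //.
  rewrite (h0 k) //.
  have : (\sum_(r < n.+1) nth 0 (local_down la rho kap) r + \sum_(i < n.+1) k i.+1 =
    \sum_(r < n.+1) maxn (f r.+1) (g r.+1) + \sum_(r < n.+1) minn (f r) (g r))%N.
    rewrite -!big_split; apply: eq_bigr => r _ /=; rewrite downE ltn_ord -/(k _).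
    by have := H r; have := H r.+1; lia.
  by have := H 0%N; lia.
split.
- apply/hstripP => r; rewrite -!/(f _) !downE -!/(k _).
  have := H r; have := H r.+1; have := out r; have := out r.+1; case: ifP; lia.
- apply/hstripP => r; rewrite -!/(g _) !downE -!/(k _).
  have := H r; have := H r.+1; have := out r; have := out r.+1; case: ifP; lia.
- by rewrite -sz leq_addr.
- apply/mnmP => r; rewrite !(mnm_nth 0%N) upE ltn_ord.
  case: r => -[|r] lt /=; first by rewrite -sz -/(k 0%N); have := H 0%N; lia.
  rewrite downE (ltnW lt) -!/(k _); have := H r; have := H r.+1; lia.
Qed.

(** A constant summand suffices: in the Pieri rule the term depends on rho and on the size e
    only. *)
Lemma local_sum (V : nmodType) (c : V) :
  \sum_(kap : bshape | [&& hstrip kap la, hstrip kap rho & mdeg kap == e]) c =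
  \sum_(mu : bshape | [&& hstrip la mu, hstrip rho mu
                        & (mdeg la + mdeg rho <= mdeg mu + e)%N]) c.
Proof.
pose h (mu : bshape) : bshape := insubd mu (local_up e la rho mu).
pose h' (kap : bshape) : bshape := insubd kap (local_down la rho kap).
rewrite (reindex_onto h h') => [|kap /and3P[kl kr /eqP ke]].
  apply: eq_bigl => mu; apply/andP/and3P => [[/and3P[]]|].
    set kap := h mu => kl kr /eqP ke /eqP <-.
    have [lm rm sz _] := local_downP kl kr ke.
    have h'E : h' kap = local_down la rho kap :> shape.
      by rewrite val_insubd (leq_ltn_trans (hstrip_mdeg lm)).
    by rewrite h'E.
  move=> [lm rm sz]; have [kl kr ke dE] := local_upP lm rm sz.
  have hE : h mu = local_up e la rho mu :> shape by rewrite val_insubd ke ltnS e_n.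
  split; first by rewrite hE kl kr ke eqxx.
  rewrite -val_eqE /= val_insubd hE dE bmdeg; exact/eqP.
have [lm rm sz uE] := local_downP kl kr ke.
have h'E : h' kap = local_down la rho kap :> shape.
  by rewrite val_insubd (leq_ltn_trans (hstrip_mdeg lm)).
by apply: val_inj; rewrite val_insubd h'E uE bmdeg.
Qed.
End Local.
End HorizontalStrips.

(** * Pieri rule and Cauchy identity *)

Section Cauchy.
Variables (n : nat) (A : comNzRingType).
Local Notation shape := 'X_{1..n.+1}.
Local Notation bshape := 'X_{1..n.+1 < n.+1}.
Implicit Types (x y : nat -> A) (la mu rho kap : shape).

(* The Schur polynomial of [la] in x_0, ..., x_{j-1}, by removing the cells
   that contain the largest letter. *)
Fixpoint strip_schur x (j : nat) la : A :=
  if j is j'.+1 then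
    \sum_(mu : bshape | hstrip la mu) x j' ^+ (mdeg la - mdeg mu) * strip_schur x j' mu
  else (la == 0%MM)%:R.

(** The complete homogeneous polynomial h_t in x_0, ..., x_{j-1}, by powers of the last variable. *)
Fixpoint strip_h x (j t : nat) : A :=
  if j is j'.+1 then \sum_(a < t.+1) x j' ^+ a * strip_h x j' (t - a)
  else (t == 0)%:R.

Lemma hstrip00 : hstrip (0%MM : shape) 0%MM.
Proof.
apply/hstripP => r; split=> //.
by have := nth_mkshape n (fun=> 0%N) r.+1; rewrite /mkshape; case: ifP => _ ->.
Qed.

(** Removing the last letter on both sides leaves sums over rho of its Schur polynomial: on the
    right through shapes kap above la and rho, on the left, by induction, through shapes mu below
    both. The local rule with e = |la| + t exchanges them. *)
Lemma pieri x j la t : (mdeg la + t <= n)%N ->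
  strip_h x j t * strip_schur x j la =
  \sum_(kap : bshape | hstrip kap la && (mdeg kap == mdeg la + t)%N) strip_schur x j kap.
Proof.
elim: j la t => [|j IH] la t lat /=.
  rewrite -natrM mulnb; have [/andP[/eqP-> /eqP->]|not0] := boolP (_ && _).
    have lt0 : (mdeg (0%MM : shape) < n.+1)%N by rewrite mdeg0.
    rewrite (bigD1 (BMultinom lt0)) /=; last first.
      by rewrite mdeg0 addn0 eqxx andbT hstrip00.
    rewrite eqxx big1 ?addr0 // => k /andP[_ kn].
    rewrite (_ : (_ == _) = false) //; apply: contra_neqF kn => /eqP e.
    exact: val_inj.
  rewrite big1 // => kap /andP[kl /eqP ke].
  have [k0|//] := eqVneq (kap : shape) 0%MM; case/negP: not0.
  have := hstrip_mdeg kl; rewrite k0 mdeg0 leqn0 mdeg_eq0 => /eqP l0.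
  by move: ke; rewrite k0 l0 !mdeg0 add0n => <-; rewrite !eqxx.
have lan : (mdeg la <= n)%N by apply: leq_trans lat; apply: leq_addr.
transitivity (\sum_(rho : bshape)
   \sum_(mu : bshape | [&& hstrip la mu, hstrip rho mu
                         & mdeg la + mdeg rho <= mdeg mu + (mdeg la + t)]%N)
     x j ^+ (mdeg la + t - mdeg rho) * strip_schur x j rho); last first.
  rewrite [RHS](exchange_big_dep predT) //=; apply: eq_bigr => rho _.
  rewrite -(local_sum lan _ lat); last by rewrite -ltnS bmdeg.
  apply: eq_big => [kap|kap /and3P[_ _ /eqP ->] //].
  by rewrite -andbA [hstrip kap rho && _]andbC.
rewrite mulr_suml.
transitivity (\sum_(a < t.+1) \sum_(mu : bshape | hstrip la mu)
   \sum_(rho : bshape | hstrip rho mu && (mdeg rho == mdeg mu + (t - a))%N)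
     x j ^+ (a + (mdeg la - mdeg mu)) * strip_schur x j rho).
  apply: eq_bigr => a _; rewrite mulr_sumr; apply: eq_bigr => mu lm.
  rewrite mulrACA -exprD IH ?mulr_sumr //.
  have := hstrip_mdeg lm; have := ltn_ord a; move: lat; lia.
rewrite exchange_big /=.
transitivity (\sum_(mu : bshape | hstrip la mu) \sum_(rho : bshape | hstrip rho mu)
   \sum_(a < t.+1 | (mdeg rho == mdeg mu + (t - a))%N)
     x j ^+ (a + (mdeg la - mdeg mu)) * strip_schur x j rho).
  apply: eq_bigr => mu lm; rewrite (exchange_big_dep (fun rho : bshape => hstrip rho mu)) //=.
    by apply: eq_bigr => rho rm; apply: eq_bigl => a; rewrite rm.
  by move=> a rho _ /andP[].
rewrite (exchange_big_dep predT) //=; apply: eq_bigr => rho _.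
rewrite [RHS](eq_bigl (fun mu : bshape => (hstrip la mu && hstrip rho mu) &&
    (mdeg la + mdeg rho <= mdeg mu + (mdeg la + t))%N)); last by move=> mu; rewrite andbA.
rewrite [RHS]big_mkcondr /=; apply: eq_bigr => mu /andP[lm rm].
have := hstrip_mdeg lm; have := hstrip_mdeg rm => rm' lm'.
case: ifP => [le|gt].
  (* The sizes determine the power taken from [strip_h]: a = |mu| + t - |rho|. *)
  have lt : (mdeg mu + t - mdeg rho < t.+1)%N by lia.
  rewrite (bigD1 (Ordinal lt)) /=; last by apply/eqP; lia.
  rewrite big1 ?addr0 => [|a /andP[/eqP ea na]].
    by congr (_ ^+ _ * _); lia.
  by case/negP: na; apply/eqP/val_inj => /=; have := ltn_ord a; lia.
by rewrite big_pred0 // => a; apply/eqP => ea; have := ltn_ord a; lia.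
Qed.

Lemma strip_schur0 x j : strip_schur x j 0%MM = 1.
Proof.
elim: j => [|j IH] /=; first by rewrite eqxx.
have lt0 : (mdeg (0%MM : shape) < n.+1)%N by rewrite mdeg0.
rewrite (bigD1 (BMultinom lt0)) ?hstrip00 //= IH subnn mul1r big1 ?addr0 // => mu.
move=> /andP[/hstrip_mdeg + mn]; rewrite mdeg0 leqn0 mdeg_eq0 => /eqP m0.
by case/eqP: mn; apply: val_inj.
Qed.

(** Induction on the letters y: stripping the last one and applying the Pieri rule in the letters x
    releases the factor sum_a h_a(x) y_M^a, the product over j of the geometric series in x_j
    y_M. *)
Lemma cauchy_strip x y N M e : (e <= n)%N ->
  \sum_(kap : bshape | mdeg kap == e) strip_schur y M kap * strip_schur x N kap =
  (\prod_(i < M) \prod_(j < N) \sum_(a < n.+1) (x j * y i) ^+ a *: 'X^a : {poly A})`_e.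
Proof.
(* The geometric series 1/(1 - cX), cut at degree n, beyond which no coefficient is read. *)
pose Ex (c : A) : {poly A} := \sum_(a < n.+1) c ^+ a *: 'X^a.
have ExE c a : (a <= n)%N -> (Ex c)`_a = c ^+ a.
  move=> an; rewrite /Ex coef_sum (bigD1 (Ordinal (an : (a < n.+1)%N))) //=.
  rewrite coefZ coefXn eqxx mulr1 big1 ?addr0 // => i ia.
  rewrite coefZ coefXn (_ : (a == i) = false) ?mulr0 //.
  by apply: contra_neqF ia => /eqP e'; apply: val_inj.
have hE (z : nat -> A) j t : (t <= n)%N -> strip_h z j t = (\prod_(i < j) Ex (z i))`_t.
  elim: j t => [|j IH] t tn /=; first by rewrite big_ord0 coef1.
  rewrite [in RHS]big_ord_recr /= coefMr; apply: eq_bigr => a _.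
  have := ltn_ord a; rewrite ltnS => at_.
  by rewrite IH ?ExE ?(leq_trans at_) ?(leq_trans (leq_subr _ _)) // mulrC.
have hM (c : A) j t : strip_h (fun i => x i * c) j t = c ^+ t * strip_h x j t.
  elim: j t => [|j IH] t /=; first by case: t => [|t]; rewrite ?mulr0 ?mul1r ?expr0.
  rewrite mulr_sumr; apply: eq_bigr => a _; rewrite IH exprMn.
  have -> : c ^+ t = c ^+ a * c ^+ (t - a) by rewrite -exprD subnKC // -ltnS.
  by rewrite -!mulrA mulrCA; congr (_ * _); rewrite mulrCA.
rewrite -[RHS]/((\prod_(i < M) \prod_(j < N) Ex (x j * y i))`_e).
elim: M e => [|M IH] e en /=.
  rewrite big_ord0 coef1; have [->|e0] := eqVneq e 0%N.
    have lt0 : (mdeg (0%MM : shape) < n.+1)%N by rewrite mdeg0.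
    rewrite (bigD1 (BMultinom lt0)) /= ?mdeg0 //.
    rewrite !eqxx mul1r big1 ?addr0 => [|k /andP[k0 kn]]; first exact: strip_schur0.
    rewrite (_ : (_ == _) = false) ?mul0r //; move: k0; rewrite mdeg_eq0 => k0.
    by apply: contra_neqF kn => /eqP e'; apply: val_inj.
  rewrite big1 // => k /eqP ke; rewrite (_ : (_ == _) = false) ?mul0r //.
  by apply: contra_neqF e0 => /eqP k0; rewrite -ke k0 mdeg0.
rewrite [in RHS]big_ord_recr /= coefMr.
transitivity (\sum_(a < e.+1) y M ^+ a * strip_h x N a *
   \sum_(la : bshape | (mdeg la == e - a)%N) strip_schur y M la * strip_schur x N la).
  transitivity (\sum_(la : bshape | (mdeg la <= e)%N)
    \sum_(kap : bshape | hstrip kap la && (mdeg kap == e)) y M ^+ (e - mdeg la) *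
      strip_schur y M la * strip_schur x N kap).
    rewrite (exchange_big_dep (fun kap : bshape => mdeg kap == e)) /=; last first.
      by move=> la kap _ /andP[].
    apply: eq_bigr => kap /eqP ke; rewrite mulr_suml ke; apply: eq_bigl => la.
    by rewrite eqxx andbT; case kl: hstrip; rewrite ?andbF // -ke (hstrip_mdeg kl).
  transitivity (\sum_(la : bshape | (mdeg la <= e)%N) y M ^+ (e - mdeg la) *
      strip_schur y M la * (strip_h x N (e - mdeg la) * strip_schur x N la)).
    apply: eq_bigr => la lae; rewrite pieri ?subnKC // mulr_sumr.
    by apply: eq_bigl => kap; rewrite ?subnKC.
  rewrite [RHS](eq_bigr (fun a : 'I_e.+1 => \sum_(la : bshape | (mdeg la == e - a)%N)
     y M ^+ a * strip_h x N a * (strip_schur y M la * strip_schur x N la))); last first.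
    by move=> a _; rewrite mulr_sumr.
  rewrite (exchange_big_dep (fun la : bshape => (mdeg la <= e)%N)) /=; last first.
    by move=> a la _ /eqP ->; apply: leq_subr.
  apply: eq_bigr => la lae; have lt : (e - mdeg la < e.+1)%N by rewrite ltnS leq_subr.
  rewrite (big_pred1 (Ordinal lt)) => [|a]; last first.
    apply/eqP/eqP => [h|->]; last by rewrite /= subKn.
    by apply: val_inj => /=; have := ltn_ord a; lia.
  by rewrite /= mulrACA.
apply: eq_bigr => a _; have := ltn_ord a; rewrite ltnS => ae.
rewrite IH ?(leq_trans (leq_subr _ _)) // mulrC; congr (_ * _).
by rewrite -hM hE // (leq_trans ae).
Qed.

Lemma cauchy x y N M :
  \sum_(kap : bshape | mdeg kap == n) strip_schur y M kap * strip_schur x N kap =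
  \sum_(B : {ffun 'I_M * 'I_N -> 'I_n.+1} | (\sum_p B p == n)%N)
     \prod_(p : 'I_M * 'I_N) (x p.2 * y p.1) ^+ B p.
Proof.
rewrite cauchy_strip // pair_bigA bigA_distr_bigA coef_sum /=.
rewrite [RHS]big_mkcond; apply: eq_bigr => B _ /=.
under eq_bigr do rewrite -mul_polyC.
rewrite big_split /= -rmorph_prod /= mul_polyC coefZ prodrXr coefXn eq_sym.
by case: eqP => _; rewrite ?mulr1 ?mulr0.
Qed.
End Cauchy.

(** * Semistandard tableaux *)

Lemma initial_segment n (P : pred 'I_n) :
  (forall c d : 'I_n, (d <= c)%N -> P c -> P d) -> forall c, P c = (c < #|P|)%N.
Proof.
move=> down c; apply/idP/idP => [Pc|].
  rewrite -[X in (X < _)%N](card_ord c).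
  have inj : injective (widen_ord (ltnW (ltn_ord c)) : 'I_c -> 'I_n).
    by move=> x y /(congr1 val) /= e; apply: val_inj.
  rewrite -(card_codom inj); apply: proper_card; apply/properP; split.
    by apply/fintype.subsetP => _ /codomP[d ->]; apply: down Pc; exact: ltnW (ltn_ord d).
  by exists c => //; apply/codomP => -[d /(congr1 val) /= e]; have := ltn_ord d; rewrite -e ltnn.
apply: contraTT => nPc; rewrite -leqNgt -[X in (_ <= X)%N](card_ord c).
have inj : injective (widen_ord (ltnW (ltn_ord c)) : 'I_c -> 'I_n).
  by move=> x y /(congr1 val) /= e; apply: val_inj.
rewrite -(card_codom inj); apply/subset_leq_card/fintype.subsetP => d Pd.
have dc : (d < c)%N.
  by rewrite ltnNge; apply: contra nPc => cd; apply: down cd Pd.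
by apply/codomP; exists (Ordinal dc); apply: val_inj.
Qed.

Section Boxes.
Variables (n N : nat) (A : comNzRingType) (x : nat -> A).
Local Notation shape := 'X_{1..n.+1}.
Local Notation bshape := 'X_{1..n.+1 < n.+1}.
Local Notation box := ('I_n.+1 * 'I_n)%type.
Local Notation filling := {ffun box -> 'I_N.+1}.
Implicit Types (la mu : shape) (u : filling) (p q : box).

Definition incell la p := (p.2 < la p.1)%N.

Definition ordered la u := forall p q, incell la p -> incell la q ->
   (p.1 = q.1 -> (p.2 < q.2)%N -> (u p <= u q)%N) /\
   (p.2 = q.2 -> (p.1 < q.1)%N -> (u p < u q)%N).

(* Fillings of the whole box: the cells outside of [la] carry the dummy value N
   ([ord_max]), so that removing the largest letter does not change the type. *)
Definition tab (j : nat) la u :=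
  [forall p, if incell la p then (u p < j)%N else u p == ord_max] &&
  [forall p, forall q, incell la p ==> incell la q ==>
    ((p.1 == q.1) && (p.2 < q.2)%N ==> (u p <= u q)%N) &&
    ((p.2 == q.2) && (p.1 < q.1)%N ==> (u p < u q)%N)].

Lemma tabP j la u : reflect
  ((forall p, if incell la p then is_true (u p < j)%N else u p = ord_max) /\ ordered la u)
  (tab j la u).
Proof.
apply: (iffP andP) => [[/forallP H1 /forallP H2]|[H1 H2]]; split.
- by move=> p; have := H1 p; case: ifP => // _ /eqP.
- move=> p q cp cq; have /forallP/(_ q) := H2 p; rewrite cp cq /= => /andP[/implyP h1 /implyP h2].
  by split=> e lt; [apply: h1|apply: h2]; rewrite e eqxx lt.
- by apply/forallP => p; have := H1 p; case: ifP => // _ ->.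
- apply/forallP => p; apply/forallP => q; apply/implyP => cp; apply/implyP => cq.
  have [h1 h2] := H2 p q cp cq.
  by apply/andP; split; apply/implyP => /andP[/eqP e lt]; [apply: h1|apply: h2].
Qed.

Definition low_shape (j : nat) u : shape :=
  [multinom #|[pred c : 'I_n | (u (r, c) < j)%N]| | r < n.+1].

Definition low_part (j : nat) u : filling :=
  [ffun p => if (u p < j)%N then u p else ord_max].

Definition add_strip (j : nat) la mu u : filling :=
  [ffun p => if incell mu p then u p else if incell la p then inord j else ord_max].

Definition partition_shape la := forall r s : 'I_n.+1, (r <= s)%N -> (la s <= la r)%N.

Section Step.
Variables (j : nat) (jN : (j < N)%N).

(** Rows are weakly increasing, so the cells with a letter below j start the row and are determined
    by their number. The dummy value N never counts, as j < N. *)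
Lemma low_shapeE la u p : tab j.+1 la u -> incell (low_shape j u) p = (u p < j)%N.
Proof.
move=> /tabP[H1 H2]; case: p => r c; rewrite /incell mnmE /=.
rewrite -(initial_segment (P := fun c => (u (r, c) < j)%N)) // => {}c d dc uc.
have := H1 (r, c); case: ifP => cc; last by move=> e; move: uc; rewrite e /= ltnNge ltnW.
move=> _; move: dc; rewrite leq_eqVlt => /predU1P[/val_inj -> //|dc].
have cd : incell la (r, d) by move: cc; rewrite /incell /=; apply: ltn_trans.
by have [/(_ erefl dc) h _] := H2 (r, d) (r, c) cd cc; apply: leq_ltn_trans h uc.
Qed.

Lemma tab_low la u : tab j.+1 la u -> tab j (low_shape j u) (low_part j u).
Proof.
move=> t; have lE p := low_shapeE p t; have /tabP[H1 H2] := t.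
apply/tabP; split=> [p|p q].
  by rewrite lE ffunE; case: (ltnP (u p) j).
have inc p' : (u p' < j)%N -> incell la p'.
  by have := H1 p'; case: ifP => // _ ->; rewrite ltnNge ltnW.
by rewrite !lE !ffunE => up uq; rewrite up uq; apply: H2; apply: inc.
Qed.

Lemma add_low la u : tab j.+1 la u -> add_strip j la (low_shape j u) (low_part j u) = u.
Proof.
move=> t; have lE p := low_shapeE p t; have /tabP[H1 _] := t.
apply/ffunP => p; rewrite ffunE lE ffunE; case: ltnP => // up.
have := H1 p; case: ifP => // _; rewrite ltnS => up'.
by apply: val_inj; rewrite /= inordK; [apply/eqP; rewrite eqn_leq up up'|lia].
Qed.

Lemma tab_add la mu u : hstrip la mu -> partition_shape mu -> partition_shape la ->
  tab j mu u ->
  tab j.+1 la (add_strip j la mu u).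
Proof.
move=> /hstripP h pmu pla /tabP[H1 H2].
have mula p : incell mu p -> incell la p.
  rewrite /incell !(mnm_nth 0%N) => lt; apply: leq_trans lt _; by have [] := h p.1.
have jK : (inord j : 'I_N.+1) = j :> nat by rewrite inordK // ltnS ltnW.
apply/tabP; split=> [p|p q lp lq].
  rewrite ffunE; case mp: (incell mu p).
    by rewrite mula //; have := H1 p; rewrite mp ltnS; apply: ltnW.
  by case inla: (incell la p); rewrite ?jK.
rewrite !ffunE lp lq; have := H1 p; have := H1 q; have := @H2 p q.
case mp: (incell mu p); case mq: (incell mu q) => h2 hq hp.
- exact: h2.
- by rewrite jK; split=> _ _ //; apply: ltnW.
- split=> [e lt|e lt]; case/negP: (negbT mp); move: mq; rewrite /incell.
    by rewrite e; apply: ltn_trans.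
  by rewrite e => mq; apply: leq_trans mq _; apply: pmu; apply: ltnW.
- split=> [_ _ //|e lt]; case/negP: (negbT mp).
  move: lq; rewrite /incell e => lq; apply: leq_trans lq _.
  have lt' : (p.1.+1 < n.+1)%N by apply: leq_ltn_trans lt _.
  apply: leq_trans (pla (Ordinal lt') q.1 lt) _.
  by rewrite !(mnm_nth 0%N) /=; have [] := h p.1.
Qed.

Lemma card_ltn k : (k <= n)%N -> #|[pred c : 'I_n | (c < k)%N]| = k.
Proof.
move=> kn; have inj : injective (widen_ord kn : 'I_k -> 'I_n).
  by move=> a b /(congr1 val) /= e; apply: val_inj.
rewrite -[RHS](card_ord k) -(card_codom inj); apply: eq_card => c.
rewrite inE; apply/idP/codomP => [ck|[d ->]]; last exact: (ltn_ord d).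
by exists (Ordinal ck); apply: val_inj.
Qed.

Lemma low_add la mu u : hstrip la mu -> (forall r, la r <= n)%N -> tab j mu u ->
  low_shape j (add_strip j la mu u) = mu /\ low_part j (add_strip j la mu u) = u.
Proof.
move=> /hstripP h lan /tabP[H1 H2].
have jK : (inord j : 'I_N.+1) = j :> nat by rewrite inordK // ltnS ltnW.
have E p : (add_strip j la mu u p < j)%N = incell mu p.
  rewrite ffunE; have := H1 p; case: ifP => // _ _.
  by case: ifP => _; rewrite ?jK ?ltnn //= ltnNge ltnW.
split; last first.
  by apply/ffunP => p; rewrite ffunE E; have := H1 p; rewrite [in X in _ -> X]ffunE; case: ifP.
apply/mnmP => r; rewrite mnmE.
rewrite (eq_card (B := [pred c : 'I_n | (c < mu r)%N])).
  by apply: card_ltn; apply: leq_trans (lan r); rewrite !(mnm_nth 0%N); have [] := h r.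
by move=> c; rewrite !inE E.
Qed.

(** A cell below one of row r + 1 carries a letter strictly smaller than a letter at most j; hence
    row r + 1 of la is no longer than row r of the low shape. *)
Lemma hstrip_low la u : partition_shape la -> (forall r, la r <= n)%N ->
  tab j.+1 la u -> hstrip la (low_shape j u).
Proof.
move=> pla lan t; have lE p := low_shapeE p t; have /tabP[H1 H2] := t.
apply/forallP => r; apply/andP; split.
  rewrite mnmE -[X in (_ <= X)%N](card_ltn (lan r)).
  apply/subset_leq_card/fintype.subsetP => c; rewrite !inE => uc.
  have := H1 (r, c); case: ifP => [//|_ e]; move: uc.
  by rewrite e /= ltnNge ltnW.
have [rn|rn] := ltnP r.+1 n.+1; last by rewrite nth_shape_out.
rewrite -[r.+1]/(nat_of_ord (Ordinal rn)) -(mnm_nth 0%N) mnmE.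
rewrite -[X in (X <= _)%N](card_ltn (lan _)).
apply/subset_leq_card/fintype.subsetP => c; rewrite !inE => lc.
have lc' : incell la (r, c) by rewrite /incell /=; apply: leq_trans lc (pla _ _ _) => /=.
have lcs : incell la (Ordinal rn, c) by [].
have [_ /(_ erefl (ltnSn r)) lt] := H2 _ _ lc' lcs.
have := H1 (Ordinal rn, c); rewrite lcs ltnS; exact: leq_trans.
Qed.

End Step.

Definition box_sum (j : nat) la : A :=
  \sum_(u : filling | tab j la u) \prod_(p | incell la p) x (u p).

Lemma mdeg_ge la r : (la r <= mdeg la)%N.
Proof. by rewrite mdegE (bigD1 r) //= leq_addr. Qed.

Lemma hstrip_partition la mu : hstrip la mu -> partition_shape mu.
Proof.
move=> /hstripP h r s; rewrite !(mnm_nth 0%N).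
have dec i : (nth 0 mu i.+1 <= nth 0 mu i)%N.
  by have [_ a] := h i; have [b _] := h i.+1; apply: leq_trans b a.
by move=> /subnKC <-; elim: (s - r)%N => [|k IH]; rewrite ?addn0 // addnS (leq_trans (dec _)).
Qed.

Lemma card_incell la : (forall r, la r <= n)%N -> #|incell la| = mdeg la.
Proof.
move=> lan; rewrite -sum1_card mdegE.
rewrite (eq_bigl (fun p => true && (p.2 < la p.1)%N)) //.
rewrite -(pair_big_dep xpredT (fun r (c : 'I_n) => (c < la r)%N) (fun _ _ => 1%N)) /=.
by apply: eq_bigr => r _; rewrite sum1_card card_ltn.
Qed.

Lemma box_sum_strip j la : (j <= N)%N -> (mdeg la <= n)%N -> partition_shape la ->
  box_sum j la = strip_schur x j la.
Proof.
elim: j la => [|j IH] la jN sz pla /=.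
  have [->|la0] := eqVneq la 0%MM.
    have out p : incell 0%MM p = false by rewrite /incell mnm0E.
    rewrite /box_sum (big_pred1 [ffun=> ord_max]) => [|u].
      by rewrite big_pred0.
    apply/tabP/eqP => [[H1 _]|->].
      by apply/ffunP => p; rewrite ffunE; have := H1 p; rewrite out.
    by split=> p; rewrite ?out ?ffunE // => q; rewrite out.
  rewrite /box_sum big_pred0 // => u; apply/tabP => -[H1 _]; case/eqP: la0.
  apply/mnmP => r; rewrite mnm0E; apply/eqP; rewrite -leqn0 leqNgt; apply/negP => lr.
  have ln := leq_trans (mdeg_ge la r) sz.
  have := H1 (r, Ordinal (leq_trans lr ln)).
  by rewrite /incell /= lr.
have lan r : (la r <= n)%N by apply: leq_trans sz; apply: mdeg_ge.
have lsz u : tab j.+1 la u -> (mdeg (low_shape j u) < n.+1)%N.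
  by move=> t; apply: leq_ltn_trans (hstrip_mdeg (hstrip_low jN pla lan t)) _.
have lt0 : (mdeg (0%MM : shape) < n.+1)%N by rewrite mdeg0.
(* The default empty shape is not reached on tableaux, by [lsz]. *)
pose m0 u : bshape := insubd (BMultinom lt0) (low_shape j u).
have m0E u : tab j.+1 la u -> m0 u = low_shape j u :> shape.
  by move=> /lsz lt; rewrite val_insubd lt.
rewrite /box_sum (partition_big m0 (fun mu : bshape => hstrip la mu)) => [|u t] /=.
  apply: eq_bigr => mu lm; rewrite -IH ?(ltnW jN) //; last first.
  - exact: hstrip_partition lm.
  - by rewrite -ltnS bmdeg.
  rewrite /box_sum mulr_sumr (reindex_onto (add_strip j la mu) (low_part j)) => [|u /andP[t /eqP <-]].
    apply: eq_big => [u|u tu].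
      apply/andP/idP => [[/andP[t /eqP e1] /eqP e2]|tu].
        by have := tab_low jN t; rewrite -(m0E _ t) e1 e2.
      have ta := tab_add jN lm (hstrip_partition lm) pla tu.
      have [lE pE] := low_add jN lm lan tu.
      split; last by rewrite pE.
      by rewrite ta -val_eqE /= m0E // lE eqxx.
    have {}tu : tab j mu u.
      case/andP: tu => /andP[t /eqP e1] /eqP e2.
      by have := tab_low jN t; rewrite -(m0E _ t) e1 e2.
    have sub p : incell mu p -> incell la p.
      move: lm => /hstripP h; rewrite /incell !(mnm_nth 0%N) => lt.
      by apply: leq_trans lt _; have [] := h p.1.
    rewrite (bigID (incell mu)) /= mulrC; congr (_ * _).
      rewrite (eq_bigr (fun=> x j)) => [|p /andP[lp /negPf mp]]; last first.
        by rewrite ffunE mp lp inordK // ltnS ltnW.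
      rewrite prodr_const; congr (_ ^+ _).
      rewrite -(card_incell lan) -card_incell => [|r]; last first.
        by rewrite (leq_trans (mdeg_ge _ _)) // -ltnS bmdeg.
      rewrite -[#|incell la|](cardID (incell mu)).
      rewrite [X in (X + _ - _)%N](eq_card (B := incell mu)) ?addKn.
        by apply: eq_card => p; rewrite !inE andbC.
      by move=> p; rewrite !inE; case mp: (p \in incell mu); rewrite ?andbF ?andbT //; apply: sub.
    apply: eq_big => [p|p mp]; last by rewrite ffunE (andP mp).2.
    by case mp: (incell mu p); rewrite ?andbF ?andbT // sub.
  by rewrite m0E // add_low.
by rewrite m0E //; apply: hstrip_low.
Qed.
End Boxes.

(** Reindexing along a map known to be injective and onto, with the inverse supplied by [pick]; most
    bijections below have no convenient explicit inverse. *)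
Lemma big_image_in (R : Type) (idx : R) (op : Monoid.com_law idx) (I J : finType)
    (P : pred I) (Q : pred J) (h : I -> J) (G : J -> R) :
  {in P &, injective h} -> (forall i, P i -> Q (h i)) ->
  (forall j, Q j -> exists2 i, P i & h i = j) ->
  \big[op/idx]_(j | Q j) G j = \big[op/idx]_(i | P i) G (h i).
Proof.
move=> inj PQ QP; pose h' j := [pick i | P i && (h i == j)].
rewrite (reindex_omap h h') /=.
  apply: eq_bigl => i; rewrite /h'; case: pickP => [i' /andP[Pi' /eqP e]|no].
    apply/andP/idP => [[_ /eqP[<-]] //|Pi]; split; first exact: PQ.
    by apply/eqP; congr Some; apply: inj.
  by apply/andP/idP => [[] //|Pi]; have := no i; rewrite Pi eqxx.
move=> j /QP[i Pi e]; rewrite /h'; case: pickP => [i' /andP[_ /eqP e']|/(_ i)].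
  by rewrite /= e'.
by rewrite Pi e eqxx.
Qed.

(** * From boxed fillings to tableaux on cells *)

Section Shapes.
Variable n : nat.
Local Notation shape := 'X_{1..n.+1}.
Local Notation bshape := 'X_{1..n.+1 < n.+1}.
Implicit Types (la : {ffun 'I_n -> 'I_n.+1}).

(* With n + 1 rows, the last row of a partition of size at most n is empty. *)
Definition shape_of la : shape :=
  [multinom oapp (fun i : 'I_n => la i : nat) 0%N (insub (r : nat)) | r < n.+1].

Lemma shape_of_lt la (r : 'I_n.+1) (rn : (r < n)%N) : shape_of la r = la (Ordinal rn).
Proof. by rewrite mnmE insubT. Qed.

Lemma shape_of_max la : shape_of la ord_max = 0%N.
Proof. by rewrite mnmE insubF //= ltnn. Qed.

Lemma shape_of_widen la (i : 'I_n) : shape_of la (widen_ord (leqnSn n) i) = la i.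
Proof.
have lt : (widen_ord (leqnSn n) i < n)%N := ltn_ord i.
by rewrite (shape_of_lt _ lt); congr (nat_of_ord (la _)); apply: val_inj.
Qed.

Lemma mdeg_shape_of la : mdeg (shape_of la) = (\sum_i la i)%N.
Proof.
rewrite mdegE big_ord_recr /= shape_of_max addn0.
by apply: eq_bigr => i _; rewrite shape_of_widen.
Qed.

Lemma is_partitionP la : reflect
  ((forall i j : 'I_n, (i <= j)%N -> (la j <= la i)%N) /\ (\sum_i la i = n)%N)
  (is_partition la).
Proof.
apply: (iffP andP) => [[/forallP H /eqP ->]|[H ->]]; split=> //.
  by move=> i j ij; have /forallP/(_ j) := H i; rewrite ij.
by apply/forallP => i; apply/forallP => j; apply/implyP; apply: H.
Qed.

Lemma partition_shape_of la : is_partition la -> partition_shape (shape_of la).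
Proof.
move=> /is_partitionP[H _] r s rs.
have [sn|ns] := ltnP s n; last first.
  have -> : s = ord_max by apply: val_inj => /=; have := ltn_ord s; lia.
  by rewrite shape_of_max.
have rn := leq_ltn_trans rs sn.
by rewrite (@shape_of_lt _ _ sn) (@shape_of_lt _ _ rn); apply: H.
Qed.

Lemma hstrip_partition_l (la mu : shape) : hstrip la mu -> partition_shape la.
Proof.
move=> /hstripP h r s; rewrite !(mnm_nth 0%N).
have dec i : (nth 0 la i.+1 <= nth 0 la i)%N.
  by have [a b] := h i; apply: leq_trans b a.
by move=> /subnKC <-; elim: (s - r)%N => [|k IH]; rewrite ?addn0 // addnS (leq_trans (dec _)).
Qed.

Lemma strip_schur_partition (A : comNzRingType) (x : nat -> A) j (la : shape) :
  strip_schur x j la != 0 -> partition_shape la.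
Proof.
case: j => [|j] /=.
  have [-> _ r s _|_] := eqVneq la 0%MM; first by rewrite !mnm0E.
  by rewrite eqxx.
have [mu hm|no] := pickP (fun mu : bshape => hstrip la mu).
  by move=> _; apply: hstrip_partition_l hm.
by rewrite big_pred0 ?eqxx.
Qed.

(** The support condition holds for Schur polynomials, whose recursion vanishes on shapes that are
    not partitions. *)
Lemma sum_partitions (V : nmodType) (G : shape -> V) :
  (forall ka, G ka != 0 -> partition_shape ka) ->
  \sum_(ka : bshape | mdeg ka == n) G ka =
  \sum_(la : {ffun 'I_n -> 'I_n.+1} | is_partition la) G (shape_of la).
Proof.
move=> G0.
rewrite (bigID (fun ka : bshape => G ka != 0)) /= addrC big1 ?add0r; last first.
  by move=> ka /andP[_]; rewrite negbK => /eqP.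
rewrite [RHS](bigID (fun la => G (shape_of la) != 0)) /= [RHS]addrC.
rewrite [X in X + _]big1 ?add0r; last first.
  by move=> ka /andP[_]; rewrite negbK => /eqP.
have lt0 : (mdeg (0%MM : shape) < n.+1)%N by rewrite mdeg0.
pose h la : bshape := insubd (BMultinom lt0) (shape_of la).
have hE la : is_partition la -> h la = shape_of la :> shape.
  by move=> /is_partitionP[_ e]; rewrite val_insubd mdeg_shape_of e ltnSn.
rewrite (@big_image_in _ _ _ _ _ (fun la => is_partition la && (G (shape_of la) != 0)) _ h).
- by apply: eq_bigr => la /andP[pl _]; rewrite hE.
- move=> la mu /andP[pl _] /andP[pm _] /(congr1 (@bmnm _ _)); rewrite !hE // => e.
  by apply/ffunP => i; apply: val_inj; rewrite /= -!shape_of_widen e.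
- move=> la /andP[pl Gl]; rewrite hE // Gl mdeg_shape_of.
  by move: pl => /is_partitionP[_ ->]; rewrite eqxx.
move=> ka /andP[/eqP kn Gk]; have pk := G0 _ Gk.
pose la : {ffun 'I_n -> 'I_n.+1} := [ffun i => inord (ka (widen_ord (leqnSn n) i))].
have kle r : (ka r <= n)%N by rewrite (leq_trans (mdeg_ge ka r)) ?kn.
have laE i : la i = ka (widen_ord (leqnSn n) i) :> nat
  by rewrite ffunE inordK // ltnS kle.
have kmax : ka ord_max = 0%N.
  rewrite (mnm_nth 0%N); apply: (@hstrip_last _ _ ka); last by rewrite kn.
  apply/forallP => r; rewrite leqnn /=; have [rn|rn] := ltnP r.+1 n.+1.
    by rewrite -[r.+1]/(nat_of_ord (Ordinal rn)) -(mnm_nth 0%N) pk /=.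
  by rewrite nth_shape_out.
have sE : shape_of la = ka.
  apply/mnmP => r; have [rn|rn] := ltnP r n.
    by rewrite (@shape_of_lt _ _ rn) laE; congr (fun_of_multinom _ _); apply: val_inj.
  have -> : r = ord_max by apply: val_inj => /=; have := ltn_ord r; lia.
  by rewrite shape_of_max kmax.
have pl : is_partition la.
  apply/is_partitionP; split=> [i j ij|]; first by rewrite !laE; apply: pk.
  by rewrite -mdeg_shape_of sE.
by exists la; [rewrite pl sE|apply: val_inj; rewrite /= hE // sE].
Qed.

Variables (N : nat) (A : comNzRingType) (x : nat -> A).

Lemma is_ssytP la (T : {ffun cell la -> 'I_N}) : reflect
  (forall c d, (row_of c = row_of d -> (col_of c < col_of d)%N -> (T c <= T d)%N) /\
     (col_of c = col_of d -> (row_of c < row_of d)%N -> (T c < T d)%N)) (is_ssyt T).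
Proof.
apply: (iffP forallP) => [H c d|H c].
  have /forallP/(_ d)/andP[/implyP h1 /implyP h2] := H c.
  by split=> e lt; [apply: h1|apply: h2]; rewrite e eqxx.
apply/forallP => d; have [h1 h2] := H c d.
by apply/andP; split; apply/implyP => /andP[/eqP e lt]; [apply: h1|apply: h2].
Qed.

Definition boxcell la (c : cell la) : 'I_n.+1 * 'I_n :=
  (widen_ord (leqnSn n) (row_of c), col_of c).

Lemma boxcell_inj la : injective (@boxcell la).
Proof.
move=> c d e; apply: val_inj; rewrite /= [val c]surjective_pairing [val d]surjective_pairing.
congr (_, _); last exact: (congr1 snd e).
by apply: val_inj; have /(congr1 val) := congr1 fst e.
Qed.

Lemma boxcell_in la (c : cell la) : incell (shape_of la) (boxcell c).
Proof. by rewrite /incell /= shape_of_widen; apply: (valP c). Qed.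

Lemma incell_boxcell la p : incell (shape_of la) p -> exists c : cell la, boxcell c = p.
Proof.
case: p => r c; rewrite /incell /=; have [rn|rn] := ltnP r n.
  rewrite (@shape_of_lt _ _ rn) => lt.
  exists (exist (fun c : 'I_n * 'I_n => (c.2 < la c.1)%N) (Ordinal rn, c) lt).
  by rewrite /boxcell /row_of /col_of /=; congr (_, _); apply: val_inj.
have -> : r = ord_max by apply: val_inj => /=; have := ltn_ord r; lia.
by rewrite shape_of_max.
Qed.

Lemma ssyt_sum la : is_partition la ->
  \sum_(T : {ffun cell la -> 'I_N} | is_ssyt T) \prod_c x (T c) =
  strip_schur x N (shape_of la).
Proof.
move=> pl; have pls := partition_shape_of pl.
have sz : (mdeg (shape_of la) <= n)%N.
  by rewrite mdeg_shape_of; move: pl => /is_partitionP[_ ->].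
rewrite -(@box_sum_strip _ N _ _ N) // /box_sum; apply/esym.
pose h (T : {ffun cell la -> 'I_N}) : {ffun 'I_n.+1 * 'I_n -> 'I_N.+1} :=
  [ffun p => if [pick c | boxcell c == p] is Some c then widen_ord (leqnSn N) (T c)
             else ord_max].
have hE T c : h T (boxcell c) = T c :> nat.
  rewrite ffunE; case: pickP => [c' /eqP/boxcell_inj -> //|/(_ c)].
  by rewrite eqxx.
have hO T p : ~~ incell (shape_of la) p -> h T p = ord_max.
  by rewrite ffunE; case: pickP => // c /eqP <-; rewrite boxcell_in.
rewrite (@big_image_in _ _ _ _ _ (@is_ssyt n la N) _ h).
- apply: eq_bigr => T _.
  rewrite (@big_image_in _ _ _ _ _ predT _ (@boxcell la)) //.
  + by apply: eq_bigr => c _; rewrite hE.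
  + by move=> c d _ _; apply: boxcell_inj.
  + by move=> c _; apply: boxcell_in.
  + by move=> p /incell_boxcell[c <-]; exists c.
- move=> T T' _ _ e; apply/ffunP => c; apply: val_inj.
  by rewrite /= -!hE e.
- move=> T /is_ssytP sT; apply/tabP; split=> [p|p q].
    case: ifP => [/incell_boxcell[c <-]|/negbT]; first by rewrite hE.
    exact: hO.
  move=> /incell_boxcell[c <-] /incell_boxcell[d <-]; rewrite !hE.
  have [h1 h2] := sT c d; split=> /= [/(congr1 val) e|e]; last exact: h2.
  by apply: h1; apply: val_inj.
move=> u /tabP[H1 H2].
have uN (c : cell la) : (u (boxcell c) < N)%N by have := H1 (boxcell c); rewrite boxcell_in.
pose T : {ffun cell la -> 'I_N} := [ffun c => Ordinal (uN c)].
exists T.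
  apply/is_ssytP => c d; rewrite !ffunE /=.
  have [h1 h2] := H2 _ _ (boxcell_in c) (boxcell_in d).
  by split=> e; [apply: h1; rewrite /= e|apply: h2].
apply/ffunP => p; apply: val_inj.
case ip: (incell (shape_of la) p).
  by have [c <-] := incell_boxcell ip; rewrite /= hE ffunE.
by have := H1 p; rewrite ip => ->; rewrite hO // ip.
Qed.
End Shapes.

(** * Standardization *)

Section Standardization.
Variables (n : nat) (la : {ffun 'I_n -> 'I_n.+1}) (M : nat).
Hypothesis pla : is_partition la.
Implicit Types (Q : {ffun cell la -> 'I_n}) (T : {ffun cell la -> 'I_M})
  (k : {ffun 'I_n -> 'I_M}) (c d : cell la).

Definition compatible (I : {set 'I_n.-1}) k :=
  [forall i : 'I_n, forall j : 'I_n, (i <= j)%N ==> (k i <= k j)%N] &&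
  [forall i in I, (k (lpos i) < k (rpos i))%N].

Lemma compatibleP (I : {set 'I_n.-1}) k : reflect
  ((forall i j : 'I_n, (i <= j)%N -> (k i <= k j)%N) /\
   (forall i, i \in I -> (k (lpos i) < k (rpos i))%N)) (compatible I k).
Proof.
apply: (iffP andP) => [[/forallP H1 /forall_inP H2]|[H1 H2]]; split=> //.
- by move=> i j ij; have /forallP/(_ j) := H1 i; rewrite ij.
- by apply/forallP => i; apply/forallP => j; apply/implyP; apply: H1.
- exact/forall_inP.
Qed.

Lemma card_cell : #|{: cell la}| = n.
Proof.
have /is_partitionP[_ e] := pla.
rewrite -[RHS]e card_sub -sum1_card.
rewrite (eq_bigl (fun p : 'I_n * 'I_n => true && (p.2 < la p.1)%N)) //.
rewrite -(pair_big_dep xpredT (fun r (c : 'I_n) => (c < la r)%N) (fun _ _ => 1%N)) /=.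
by apply: eq_bigr => r _; rewrite sum1_card card_ltn // -ltnS.
Qed.

Lemma is_sytP Q : reflect (injective Q /\
  (forall c d, (row_of c = row_of d -> (col_of c < col_of d)%N -> (Q c < Q d)%N) /\
     (col_of c = col_of d -> (row_of c < row_of d)%N -> (Q c < Q d)%N))) (is_syt Q).
Proof.
apply: (iffP andP) => [[/injectiveP H0 /forallP H]|[H0 H]]; split=> //; first last.
- apply/forallP => c; apply/forallP => d; have [h1 h2] := H c d.
  by apply/andP; split; apply/implyP => /andP[/eqP e lt]; [apply: h1|apply: h2].
- exact/injectiveP.
move=> c d; have /forallP/(_ d)/andP[/implyP h1 /implyP h2] := H c.
by split=> e lt; [apply: h1|apply: h2]; rewrite e eqxx.
Qed.

Lemma corner c d : (row_of c <= row_of d)%N ->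
  exists2 b : cell la, row_of b = row_of c & col_of b = col_of d.
Proof.
move=> rcd; have /is_partitionP[H _] := pla.
have lt : (col_of d < la (row_of c))%N := leq_trans (valP d) (H _ _ rcd).
by exists (exist (fun p : 'I_n * 'I_n => (p.2 < la p.1)%N) (row_of c, col_of d) lt).
Qed.

Lemma syt_inv Q : is_syt Q -> exists Qi : 'I_n -> cell la, cancel Q Qi /\ cancel Qi Q.
Proof.
move=> /is_sytP[inj _].
have [|Qi K1 K2] := inj_card_bij inj; first by rewrite card_cell card_ord.
by exists Qi.
Qed.

Lemma cell_eq c d : row_of c = row_of d -> col_of c = col_of d -> c = d.
Proof.
move=> e1 e2; apply: val_inj; rewrite /= [val c]surjective_pairing [val d]surjective_pairing.
by congr (_, _).
Qed.

Lemma syt_le Q c d : is_syt Q -> (row_of c <= row_of d)%N -> (col_of c <= col_of d)%N ->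
  (Q c <= Q d)%N.
Proof.
move=> /is_sytP[_ H] r cc; have [b rb cb] := corner r.
apply: (@leq_trans (Q b)).
  move: cc; rewrite leq_eqVlt => /predU1P[/val_inj e|lt].
    by rewrite (@cell_eq c b) // cb.
  by apply/ltnW/(H c b).1; rewrite ?cb.
move: r; rewrite leq_eqVlt => /predU1P[/val_inj e|lt].
  by rewrite (@cell_eq b d) // rb.
by apply/ltnW/(H b d).2; rewrite ?rb.
Qed.

(** If i is not in [ides Q], then i + 1 lies in the row of i or further south; this is chained along
    the entries from Q c to Q d. *)
Lemma no_ides_row Q c d : is_syt Q -> (Q c <= Q d)%N ->
  (forall i : 'I_n.-1, (Q c <= i < Q d)%N -> i \notin ides Q) ->
  (row_of d <= row_of c)%N.
Proof.
move=> sQ; have [Qi [K1 K2]] := syt_inv sQ.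
move=> /subnKC; move: (Q d - Q c)%N => m.
elim: m d => [|m IH] d; first by rewrite addn0 => /val_inj/(can_inj K1) -> _.
move=> e no; have mn : (Q c + m < n)%N by have := ltn_ord (Q d); lia.
pose b := Qi (Ordinal mn); have Qb : Q b = (Q c + m)%N :> nat by rewrite K2.
apply: (@leq_trans (row_of b)); last first.
  by apply: IH => // i /andP[ci ib]; apply: no; lia.
have ip : (Q c + m < n.-1)%N by have := ltn_ord (Q d); lia.
have := no (Ordinal ip); rewrite inE /= => /(_ _)/existsP h.
rewrite leqNgt; apply/negP => lt; apply: h; first by lia.
exists b; apply/existsP; exists d; rewrite lt andbT.
by apply/andP; split; apply/eqP/val_inj => /=; lia.
Qed.

Lemma compatible_same_row Q k c d : is_syt Q -> compatible (ides Q) k ->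
  (Q c <= Q d)%N -> k (Q c) = k (Q d) -> (row_of d <= row_of c)%N.
Proof.
move=> sQ /compatibleP[km kI] le e; apply: no_ides_row sQ le _ => i /andP[ci id].
apply/negP => /kI; rewrite ltnNge => /negP; apply.
apply: leq_trans (km (rpos i) (Q d) id) _; rewrite -e; exact: km.
Qed.

Definition standard_fill (p : {ffun cell la -> 'I_n} * {ffun 'I_n -> 'I_M}) :
  {ffun cell la -> 'I_M} := [ffun c => p.2 (p.1 c)].

(* The standardization of [T] numbers its cells in this order. *)
Definition lex_lt T c d := (T c < T d)%N || (T c == T d) && (col_of c < col_of d)%N.

(** Among cells with the same letter, larger entries of Q are weakly south, hence strictly east:
    otherwise d would be weakly south-west of c and have a smaller entry. *)
Lemma syt_lex Q k c d : is_syt Q -> compatible (ides Q) k -> (Q c < Q d)%N ->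
  lex_lt (standard_fill (Q, k)) c d.
Proof.
move=> sQ ck lt; rewrite /lex_lt !ffunE /=; have /compatibleP[km _] := ck.
have := km _ _ (ltnW lt); rewrite leq_eqVlt => /predU1P[/val_inj e|-> //].
rewrite e ltnn eqxx /= ltnNge; apply/negP => cd.
have r := compatible_same_row sQ ck (ltnW lt) e.
by have := syt_le sQ r cd; rewrite leqNgt lt.
Qed.

Lemma lex_lt_asym T c d : lex_lt T c d -> ~~ lex_lt T d c.
Proof.
rewrite /lex_lt -!val_eqE /=; lia.
Qed.

Lemma standard_fill_ssyt Q k : is_syt Q -> compatible (ides Q) k ->
  is_ssyt (standard_fill (Q, k)).
Proof.
move=> sQ ck; have /is_sytP[_ H] := sQ; have /compatibleP[km _] := ck.
apply/is_ssytP => c d; rewrite !ffunE /=; have [h1 h2] := H c d; split=> e lt.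
  by apply/km/ltnW/h1.
have lt' := h2 e lt; rewrite ltn_neqAle km 1?ltnW // andbT.
apply/negP => /eqP/val_inj e'.
by have := compatible_same_row sQ ck (ltnW lt') e'; rewrite leqNgt lt.
Qed.

(** The filling determines Q as the rank in the order [lex_lt], which gives injectivity of
    destandardization. *)
Lemma syt_rank Q k c : is_syt Q -> compatible (ides Q) k ->
  Q c = #|[pred d | lex_lt (standard_fill (Q, k)) d c]| :> nat.
Proof.
move=> sQ ck; have [Qi [K1 K2]] := syt_inv sQ.
rewrite (eq_card (B := [pred d | (Q d < Q c)%N])); last first.
  move=> d; rewrite !inE; apply/idP/idP; last exact: syt_lex.
  apply: contraLR; rewrite -leqNgt leq_eqVlt => /predU1P[/val_inj/(can_inj K1) ->|lt].
    by rewrite /lex_lt !ltnn andbF.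
  exact/lex_lt_asym/syt_lex.
transitivity #|[pred i : 'I_n | (i < Q c)%N]|; first by rewrite card_ltn // ltnW.
rewrite -(card_image (can_inj K1) [pred d | (Q d < Q c)%N]).
apply: eq_card => i; rewrite inE; apply/idP/fintype.imageP => [lt|[d + ->] //].
by exists (Qi i); rewrite ?inE K2.
Qed.

Lemma standard_fill_inj Q k Q' k' : is_syt Q -> compatible (ides Q) k ->
  is_syt Q' -> compatible (ides Q') k' ->
  standard_fill (Q, k) = standard_fill (Q', k') -> (Q, k) = (Q', k').
Proof.
move=> sQ ck sQ' ck' e.
have eQ : Q = Q'.
  by apply/ffunP => c; apply: val_inj; rewrite /= (syt_rank c sQ ck) e -syt_rank.
rewrite -eQ; congr (_, _); apply/ffunP => j; have [Qi [K1 K2]] := syt_inv sQ.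
have := congr1 (fun f : {ffun cell la -> 'I_M} => f (Qi j)) e.
by rewrite !ffunE /= -eQ K2.
Qed.

Lemma standard_fill_surj T : is_ssyt T -> exists Q, exists k,
  [/\ is_syt Q, compatible (ides Q) k & standard_fill (Q, k) = T].
Proof.
move=> /is_ssytP sT.
have tr : transitive (lex_lt T).
  by move=> b a c; rewrite /lex_lt -!val_eqE /=; lia.
have irr c : lex_lt T c c = false by rewrite /lex_lt !ltnn andbF.
have tot c d : c != d -> lex_lt T c d || lex_lt T d c.
  move=> cd; rewrite /lex_lt -!val_eqE /=.
  case: (ltngtP (T c) (T d)) => //= /val_inj e.
  case: (ltngtP (col_of c) (col_of d)) => // /val_inj ec.
  case: (ltngtP (row_of c) (row_of d)) => [lt|lt|/val_inj er].
  - by have := (sT c d).2 ec lt; rewrite e ltnn.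
  - by have := (sT d c).2 (esym ec) lt; rewrite e ltnn.
  - by case/eqP: cd; apply: cell_eq.
have ltn c : (#|[pred d | lex_lt T d c]| < n)%N.
  rewrite -[X in (_ < X)%N]card_cell; apply/proper_card/properP; split.
    by apply/fintype.subsetP.
  by exists c => //; rewrite inE irr.
have [Q mono] : exists Q : {ffun cell la -> 'I_n},
    forall c d, lex_lt T c d -> (Q c < Q d)%N.
  exists [ffun c => Ordinal (ltn c)] => c d cd; rewrite !ffunE /=; apply/proper_card/properP; split.
    by apply/fintype.subsetP => b; rewrite !inE => bc; apply: tr cd.
  by exists c; rewrite !inE ?irr.
have refl c d : (Q c < Q d)%N -> lex_lt T c d.
  move=> cd; have [e|ne] := eqVneq c d; first by rewrite e ltnn in cd.
  have /orP[//|/mono] := tot c d ne; by rewrite ltnNge ltnW.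
have Qinj : injective Q.
  move=> c d e; apply/eqP; apply/negPn/negP => /tot/orP[]/mono; by rewrite e ltnn.
have sQ : is_syt Q.
  apply/is_sytP; split=> // c d; have [h1 h2] := sT c d; split=> e lt; apply: mono.
    by rewrite /lex_lt lt andbT orbC -leq_eqVlt h1.
  by rewrite /lex_lt h2.
have [Qi [K1 K2]] := syt_inv sQ.
have Tle c d : (Q c <= Q d)%N -> (T c <= T d)%N.
  rewrite leq_eqVlt => /predU1P[/val_inj/Qinj -> //|/refl].
  by rewrite /lex_lt => /orP[/ltnW //|/andP[/eqP -> _]].
exists Q, [ffun j => T (Qi j)]; split=> //; last by apply/ffunP => c; rewrite !ffunE /= K1.
apply/compatibleP; split=> [i j ij|i]; rewrite !ffunE; first by apply: Tle; rewrite !K2.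
rewrite inE => /existsP[c /existsP[d /and3P[/eqP Qc /eqP Qd lt]]].
rewrite -Qc -Qd !K1; have /refl/orP[//|/andP[_ cc]] : (Q c < Q d)%N by rewrite Qc Qd.
(* For equal letters d would be strictly east and north of c; the corner b in the row of c and the
   column of d then gives T c <= T b < T d. *)
have [b rb cb] := corner (ltnW lt).
apply: (@leq_ltn_trans (T b)); first by apply: (sT c b).1; rewrite ?cb.
by apply: (sT b d).2; rewrite ?rb.
Qed.

Lemma ssyt_standardize (V : nmodType) (G : {ffun cell la -> 'I_M} -> V) :
  \sum_(T | is_ssyt T) G T =
  \sum_(Q | is_syt Q) \sum_(k | compatible (ides Q) k) G (standard_fill (Q, k)).
Proof.
rewrite pair_big_dep /=.
rewrite (@big_image_in _ _ _ _ _
  (fun p => is_syt p.1 && compatible (ides p.1) p.2) _ standard_fill).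
- by apply: eq_bigr => -[].
- by move=> [Q k] [Q' k'] /andP[/= sQ ck] /andP[/= sQ' ck']; apply: standard_fill_inj.
- by move=> [Q k] /andP[/= sQ ck]; apply: standard_fill_ssyt.
by move=> T /standard_fill_surj[Q [k [sQ ck <-]]]; exists (Q, k); rewrite ?sQ.
Qed.
End Standardization.

(** * Compatible sequences and partitions *)

Section CompatibleSequences.
Variables (n d : nat) (I : {set 'I_n.-1}).
Implicit Types (k : {ffun 'I_n -> 'I_d.+1}) (nu : 'X_{1..n}).

(** The number of strict drops forced from position i on, hence the least value at i of a decreasing
    sequence of naturals with these drops. For I = [ides Q] the offsets add up to [maj Q]. *)
Definition offset (i : nat) : nat := (\sum_(j in I) (i <= j))%N.

Lemma offset_step (i : 'I_n.-1) : offset i = (offset i.+1 + (i \in I))%N.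
Proof.
rewrite /offset; have [iI|iI] := boolP (i \in I).
  rewrite (bigD1 i) //= [in RHS](bigD1 i) //= leqnn ltnn add0n addnC; congr addn.
  apply: eq_bigr => j /andP[_ ji]; congr nat_of_bool.
  rewrite ltn_neqAle [i == j :> nat]eq_sym.
  by rewrite (_ : (j == i :> nat) = false) //; apply/negbTE.
rewrite addn0; apply: eq_bigr => j jI; congr nat_of_bool.
rewrite ltn_neqAle; case: eqP => // e; move: iI.
by rewrite (_ : i = j) ?jI //; apply: val_inj.
Qed.

Lemma offset_anti i j : (i <= j)%N -> (offset j <= offset i)%N.
Proof.
move=> ij; apply: leq_sum => l _.
by have := leq_trans ij; case: (leqP j l) => // h ->.
Qed.

Lemma offset_last (i : nat) : (n.-1 <= i)%N -> offset i = 0%N.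
Proof.
move=> ni; apply: big1 => j _; rewrite leqNgt (leq_trans (ltn_ord j)) //.
Qed.

Lemma sum_offset : (\sum_(i < n) offset i = \sum_(j in I) j.+1)%N.
Proof.
rewrite exchange_big /=; apply: eq_bigr => j _.
have jn : (j.+1 <= n)%N by have := ltn_ord j; lia.
rewrite -[RHS](card_ltn jn) -sum1_card [RHS]big_mkcond; apply: eq_bigr => i _.
by rewrite inE ltnS; case: leqP.
Qed.

(* [d - k i = nu (rev_ord i) + offset i]: subtracting the forced strict steps
   from the decreasing sequence [d - k i] leaves a partition. *)
Lemma sum_compatible (V : nmodType) (v : V) :
  \sum_(k : {ffun 'I_n -> 'I_d.+1} | compatible I k && (\sum_i (d - k i) == d)%N) v =
  \sum_(nu : 'X_{1..n < d.+1} | increasing nu && (\sum_(j in I) j.+1 + mdeg nu == d)%N) v.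
Proof.
pose h (nu : 'X_{1..n < d.+1}) : {ffun 'I_n -> 'I_d.+1} :=
  [ffun i => inord (d - (nu (rev_ord i) + offset i))].
have sumE nu : (\sum_i (nu (rev_ord i) + offset i) = \sum_(j in I) j.+1 + mdeg nu)%N.
  rewrite big_split /= sum_offset addnC; congr addn.
  by rewrite mdegE [RHS](reindex_inj rev_ord_inj).
have hE (nu : 'X_{1..n < d.+1}) : (\sum_(j in I) j.+1 + mdeg nu == d)%N ->
    forall i, (h nu i = d - (nu (rev_ord i) + offset i) :> nat)%N /\
              (nu (rev_ord i) + offset i <= d)%N.
  rewrite -sumE => /eqP e i; split; last by rewrite -[X in (_ <= X)%N]e (bigD1 i) //= leq_addr.
  by rewrite ffunE inordK // ltnS leq_subr.
rewrite (@big_image_in _ _ _ _ _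
  (fun nu : 'X_{1..n < d.+1} => increasing nu && (\sum_(j in I) j.+1 + mdeg nu == d)%N) _ h) //.
- move=> nu mu /andP[_ /hE en] /andP[_ /hE em] e; apply: val_inj => /=.
  apply/mnmP => i; rewrite -(rev_ordK i).
  have [e1 l1] := en (rev_ord i); have [e2 l2] := em (rev_ord i).
  by have := congr1 (fun f : {ffun 'I_n -> 'I_d.+1} => f (rev_ord i) : nat) e; lia.
- move=> nu /andP[/increasingP inc sm]; have en := hE nu sm.
  have rev_le (i j : 'I_n) : (i <= j)%N -> (nu (rev_ord j) <= nu (rev_ord i))%N.
    by move=> ij; apply: inc => /=; lia.
  apply/andP; split; last first.
    apply/eqP; rewrite -[RHS](eqP sm) -sumE; apply: eq_bigr => i _.
    by have [-> l] := en i; rewrite subKn.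
  apply/compatibleP; split=> [i j ij|i iI].
    have [-> _] := en i; have [-> _] := en j.
    by have := rev_le _ _ ij; have := offset_anti ij; lia.
  have [-> _] := en (lpos i); have [-> l] := en (rpos i).
  have := rev_le (lpos i) (rpos i) (leqnSn i); have := offset_step i; rewrite iI.
  by have [_] := en (lpos i); rewrite /=; lia.
move=> k /andP[/compatibleP[km kI] /eqP sk].
have kd i : (k i <= d)%N by rewrite -ltnS.
(* This says, without subtracting offsets, that d - k i - offset i is weakly decreasing. Against the
   last position, of offset 0, it yields [off_le]. *)
have step m : forall i j : 'I_n, (j = i + m :> nat)%N ->
    (offset i + (d - k j) <= (d - k i) + offset j)%N.
  elim: m => [|m IH] i j ij.
    by rewrite (_ : j = i) 1?addnC //; apply: val_inj; rewrite /= ij addn0.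
  have ip : (i < n.-1)%N by have := ltn_ord j; lia.
  pose i' := Ordinal ip; have -> : i = lpos i' by apply: val_inj.
  have ij' : (j = rpos i' + m :> nat)%N by rewrite /= ij; lia.
  have := IH _ _ ij'; have := offset_step i'; rewrite /=.
  have := km (lpos i') (rpos i') (leqnSn _); have := kI i'; have := kd (rpos i').
  by case: (i' \in I) => [/= + /(_ erefl)|/= + _]; lia.
have off_le (i : 'I_n) : (offset i <= d - k i)%N.
  have n0 : (n.-1 < n)%N by have := ltn_ord i; lia.
  have := @step (n.-1 - i)%N i (Ordinal n0); rewrite /= (offset_last (leqnn _)).
  by have := ltn_ord i; lia.
pose nu : 'X_{1..n} := [multinom (d - k (rev_ord i) - offset (rev_ord i))%N | i < n].
have nuE i : (nu (rev_ord i) + offset i = d - k i)%N by rewrite mnmE rev_ordK subnK.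
have snu : (\sum_(j in I) j.+1 + mdeg nu = d)%N.
  by rewrite -sumE -[RHS]sk; apply: eq_bigr => i _; rewrite nuE.
have lt : (mdeg nu < d.+1)%N by rewrite ltnS -[X in (_ <= X)%N]snu leq_addl.
exists (BMultinom lt) => /=.
  rewrite snu eqxx andbT; apply/increasingP => i j ij; rewrite !mnmE.
  have := @step (rev_ord i - rev_ord j)%N (rev_ord j) (rev_ord i).
  have := off_le (rev_ord i); have := off_le (rev_ord j).
  by rewrite /=; have := ltn_ord i; have := ltn_ord j; lia.
have sm : (\sum_(j in I) j.+1 + mdeg (BMultinom lt) == d)%N by rewrite /= snu.
apply/ffunP => i; apply: val_inj; have [e _] := hE _ sm i.
by rewrite /= e /= nuE subKn.
Qed.
End CompatibleSequences.

(* The generating function of the n-element multisets of pairs (i, j), where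
   (i, j) has degree d - i and weight x_j, of total degree d. *)
Definition multiset_sum (F : fieldType) (n N d : nat) : {mpoly F[N]} :=
  \sum_(B : {ffun 'I_d.+1 * 'I_N -> 'I_n.+1} |
         (\sum_p B p == n)%N && (\sum_(p : 'I_d.+1 * 'I_N) B p * (d - p.1) == d)%N)
    \prod_(p : 'I_d.+1 * 'I_N) 'X_(p.2) ^+ B p.

Section Middle.
Variables (F : fieldType) (n N d : nat).
Local Notation S := {mpoly F[N]}.

Let x (i : nat) : {poly S} := oapp (fun j : 'I_N => ('X_j : S)%:P) 0 (insub i).
Let y (i : nat) : {poly S} := 'X^(d - i).

Let xE (j : 'I_N) : x j = ('X_j)%:P.
Proof. by rewrite /x valK. Qed.

Lemma multiset_sumE :
  multiset_sum F n N d = (\sum_(la : {ffun 'I_n -> 'I_n.+1} | is_partition la)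
     strip_schur y d.+1 (shape_of la) * strip_schur x N (shape_of la))`_d.
Proof.
rewrite -(sum_partitions (G := fun ka => strip_schur y d.+1 ka * strip_schur x N ka)).
  rewrite cauchy coef_sum /multiset_sum big_mkcondr /= ; apply: eq_bigr => B _.
  rewrite [in RHS](eq_bigr (fun p : 'I_d.+1 * 'I_N =>
    ('X_(p.2) ^+ B p)%:P * 'X^(B p * (d - p.1)))) => [|p _]; last first.
    by rewrite exprMn xE rmorphXn /= /y -exprM mulnC.
  rewrite big_split /= -rmorph_prod /=.
  rewrite prodrXr mul_polyC coefZ coefXn eq_sym.
  by case: eqP => _; rewrite ?mulr1 ?mulr0.
move=> ka nz; apply: (@strip_schur_partition _ _ y d.+1).
by apply: contraNneq nz => ->; rewrite mul0r.
Qed.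

Lemma strip_schur_x (la : {ffun 'I_n -> 'I_n.+1}) : is_partition la ->
  strip_schur x N (shape_of la) = (schur la F N)%:P.
Proof.
move=> pla; rewrite -ssyt_sum // /schur rmorph_sum; apply: eq_bigr => T _.
by rewrite rmorph_prod; apply: eq_bigr => c _; rewrite xE.
Qed.

(** Degree d of the principal specialization s_la(1, q, q^2, ...), equal to the sum of the q^(maj Q)
    divided by (1 - q) ... (1 - q^n); the powers up to q^d suffice. *)
Lemma strip_schur_y (la : {ffun 'I_n -> 'I_n.+1}) : is_partition la ->
  (strip_schur y d.+1 (shape_of la))`_d =
  \sum_(Q : {ffun cell la -> 'I_n} | is_syt Q)
    \sum_(nu : 'X_{1..n < d.+1} | increasing nu && (maj Q + mdeg nu == d)%N) 1.
Proof.
move=> pla; rewrite -ssyt_sum // (ssyt_standardize pla) coef_sum.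
apply: eq_bigr => Q sQ; rewrite -sum_compatible coef_sum [RHS]big_mkcondr /=.
have [Qi [K1 K2]] := syt_inv pla sQ.
apply: eq_bigr => k _; rewrite /y prodrXr coefXn eq_sym.
rewrite (eq_bigr (fun c => d - k (Q c))%N) => [|c _]; last by rewrite ffunE.
rewrite [in LHS](reindex Qi) /=; last by exists Q => j _.
under eq_bigr do rewrite K2.
by case: eqP.
Qed.

Lemma sum_schur_code :
  \sum_(la : {ffun 'I_n -> 'I_n.+1} | is_partition la)
    \sum_(Q : {ffun cell la -> 'I_n} | is_syt Q)
      \sum_(nu : 'X_{1..n < d.+1} | increasing nu && (maj Q + mdeg nu == d)%N)
         schur la F N = multiset_sum F n N d.
Proof.
rewrite multiset_sumE coef_sum; apply: eq_bigr => la pla.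
rewrite strip_schur_x // coefMC strip_schur_y // mulr_suml; apply: eq_bigr => Q _.
by rewrite mulr_suml; apply: eq_bigr => nu _; rewrite mul1r.
Qed.
End Middle.

(** * Words, contents and stabilizers *)

Section Contents.
Variables (n : nat) (P : finType) (A : comNzRingType) (g : P -> A).
Local Notation word := {ffun 'I_n -> P}.
Implicit Types (u v : word) (p : P) (B : {ffun P -> 'I_n.+1}).

Definition occurrences u p : nat := #|[pred j | u j == p]|.

Lemma occurrences_le u p : (occurrences u p < n.+1)%N.
Proof. by rewrite ltnS -[X in (_ <= X)%N]card_ord max_card. Qed.

Definition content u : {ffun P -> 'I_n.+1} := [ffun p => Ordinal (occurrences_le u p)].

Definition letters u : n.-tuple P := [tuple u i | i < n].

Definition word_of (t : n.-tuple P) : word := [ffun i => tnth t i].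

Lemma word_ofK t : letters (word_of t) = t.
Proof. by apply: eq_from_tnth => i; rewrite tnth_mktuple ffunE. Qed.

Lemma count_letters u p : count_mem p (letters u) = content u p.
Proof.
rewrite ffunE /= /occurrences -sum1_card -sum1_count big_map big_enum_cond.
by apply: eq_bigl => j; rewrite inE.
Qed.

Lemma perm_letters u v : perm_eq (letters u) (letters v) = (content u == content v).
Proof.
apply/idP/eqP => [/seq.permP e|e]; last first.
  by rewrite /perm_eq; apply/allP => p _ /=; rewrite !count_letters e.
by apply/ffunP => p; apply: val_inj; rewrite /= -!count_letters e.
Qed.

Lemma sum_content u : (\sum_p content u p = n)%N.
Proof.
rewrite -[RHS]card_ord -[RHS]sum1_card (partition_big u predT) //=.
by apply: eq_bigr => p _; rewrite ffunE /= /occurrences -sum1_card.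
Qed.

Lemma prod_content u : \prod_j g (u j) = \prod_p g p ^+ content u p.
Proof.
rewrite (partition_big u predT) //=; apply: eq_bigr => p _.
rewrite (eq_bigr (fun=> g p)) => [|j /eqP -> //].
by rewrite prodr_const ffunE.
Qed.

Lemma content_surj B : (\sum_p B p = n)%N -> exists u, content u = B.
Proof.
move=> sB; pose s := flatten [seq nseq (B p) p | p <- enum P].
have ss : size s == n.
  rewrite size_flatten /shape -map_comp sumnE big_map big_enum /= -[X in _ == X]sB.
  by apply/eqP/eq_bigr => p _; rewrite /= size_nseq.
exists (word_of (Tuple ss)); apply/ffunP => p; apply: val_inj.
rewrite /= -count_letters word_ofK /= /s count_flatten -map_comp sumnE big_map big_enum /=.
rewrite (bigD1 p) //= count_nseq /= eqxx mul1n big1 ?addn0 // => q qp.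
by rewrite count_nseq /= (negPf qp) mul0n.
Qed.

Lemma content_perm u v : content u = content v ->
  exists s : 'S_n, forall j, u (s j) = v j.
Proof.
move/eqP; rewrite -perm_letters perm_sym => /tuple_permP[s e].
exists s => j; have := congr1 (fun t => nth (v j) t j) e.
by rewrite -!tnth_nth !tnth_mktuple.
Qed.

Lemma sum_sorted_words (r : rel P) : total r -> transitive r -> antisymmetric r ->
  \sum_(u : word | sorted r (letters u)) \prod_j g (u j) =
  \sum_(B : {ffun P -> 'I_n.+1} | (\sum_p B p == n)%N) \prod_p g p ^+ B p.
Proof.
move=> rt rtr ra.
rewrite (@big_image_in _ _ _ _ _ (fun u => sorted r (letters u)) _ content).
- by apply: eq_bigr => u _; apply: prod_content.
- move=> u v su sv /eqP; rewrite -perm_letters => /(sorted_eq rtr ra su sv) e.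
  apply/ffunP => j; have := congr1 (fun t => nth (u j) t j) e.
  by rewrite -!tnth_nth !tnth_mktuple.
- by move=> u _; rewrite sum_content.
move=> B /eqP/content_surj[u uB].
have ss : size (sort r (letters u)) == n by rewrite size_sort size_tuple.
exists (word_of (Tuple ss)); first by rewrite word_ofK /= sort_sorted.
by rewrite -uB; apply/eqP; rewrite -perm_letters word_ofK /= perm_sort.
Qed.

Definition permute u (s : 'S_n) : word := [ffun j => u (s j)].

Lemma content_permute u s : content (permute u s) = content u.
Proof.
apply/ffunP => p; apply: val_inj; rewrite !ffunE /= /occurrences -!sum1_card.
rewrite [RHS](reindex_inj (@perm_inj _ s)); apply: eq_bigl => j.
by rewrite !inE ffunE.
Qed.

(** Orbit-stabilizer: the permutations carrying u0 to u form a coset of the stabilizer of u, and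
    these cosets partition the group. *)
Lemma card_stabilizers u0 :
  (\sum_(u : word | content u == content u0) #|[pred s : 'S_n | permute u s == u]| = n`!)%N.
Proof.
rewrite -card_Sn -sum1_card.
rewrite (partition_big (permute u0) (fun u => content u == content u0)) /=; last first.
  by move=> s _; rewrite content_permute.
apply: eq_bigr => u /eqP cu.
have [t tE] := content_perm (esym cu).
rewrite -sum1_card [RHS](reindex_inj (@mulIg _ t)); apply: eq_bigl => s.
rewrite !inE; congr (_ == _); apply/ffunP => j.
by rewrite !ffunE permM tE.
Qed.

(** Weighted Burnside lemma; the orbits of words are their contents. *)
Lemma sum_stabilizers :
  \sum_(s : 'S_n) \sum_(u : word | permute u s == u) \prod_j g (u j) =
  (n`!)%:R * \sum_(B : {ffun P -> 'I_n.+1} | (\sum_p B p == n)%N) \prod_p g p ^+ B p.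
Proof.
rewrite (exchange_big_dep predT) //=.
rewrite (partition_big content (fun B => \sum_p B p == n)%N) /=; last first.
  by move=> u _; rewrite sum_content.
rewrite mulr_sumr; apply: eq_bigr => B /eqP/content_surj[u0 <-].
rewrite -(card_stabilizers u0) natr_sum mulr_suml; apply: eq_bigr => u /eqP <-.
rewrite -prod_content -sum1_card natr_sum mulr_suml.
by apply: eq_bigr => s _; rewrite mul1r.
Qed.
End Contents.

Section FixedWords.
Variables (F : fieldType) (n N : nat) (s : 'S_n).
Implicit Types (w : {ffun 'I_n -> 'I_N}).

Lemma fixed_porbit w i j : permute w s = w -> j \in porbit s i -> w j = w i.
Proof.
move=> /ffunP ws /porbitP[k ->]; elim: k => [|k IH]; first by rewrite expg0 perm1.
by rewrite expgSr permM -{}IH -[RHS]ws ffunE.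
Qed.

(** Expanding the product chooses one letter per cycle, and a word is fixed by s exactly when it is
    constant on cycles. *)
Lemma prod_power_sum :
  \prod_(c in porbits s) power_sum F N #|c| =
  \sum_(w | permute w s == w) \prod_j 'X_(w j).
Proof.
pose T := {c : {set 'I_n} | c \in porbits s}.
have orbP j : porbit s j \in porbits s by apply: imset_f.
pose orb j : T := exist _ (porbit s j) (orbP j).
have orb_ex (c : T) : exists j, orb j == c.
  by have /imsetP[j _ e] := valP c; exists j; apply/eqP/val_inj.
pose rep (c : T) : 'I_n := xchoose (orb_ex c).
have repK c : orb (rep c) = c by apply/eqP/(xchooseP (orb_ex c)).
rewrite (@big_image_in _ _ _ _ _ predT _ (val : T -> {set 'I_n})) //=; first last.
- by move=> c cs; exists (exist _ c cs).
- by move=> c _; apply: valP.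
- by move=> c d _ _; apply: val_inj.
rewrite /power_sum bigA_distr_bigA.
rewrite (@big_image_in _ _ _ _ _ predT _
  (fun f : {ffun T -> 'I_N} => [ffun j => f (orb j)])) /=.
- apply: eq_bigr => f _; rewrite (partition_big orb predT) //=; apply: eq_bigr => c _.
  rewrite (eq_bigr (fun=> 'X_(f c))) => [|j /eqP e]; last by rewrite ffunE e.
  rewrite prodr_const; congr (_ ^+ _); apply: eq_card => j.
  transitivity (orb j == c); last by [].
  by rewrite -[c]repK -val_eqE /= eq_porbit_mem.
- move=> f f' _ _ /ffunP e; apply/ffunP => c; have := e (rep c).
  by rewrite !ffunE repK.
- move=> f _; apply/eqP/ffunP => j; rewrite !ffunE; congr (f _); apply: val_inj => /=.
  by apply/eqP; rewrite eq_porbit_mem; have := mem_porbit s 1 j; rewrite expg1.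
move=> w /eqP ws; exists [ffun c => w (rep c)] => //; apply/ffunP => j; rewrite !ffunE.
by apply: fixed_porbit ws _; rewrite -eq_porbit_mem; have /= -> := congr1 val (repK (orb j)).
Qed.
End FixedWords.

(** * Pairs of a monomial and a word as words of pairs *)

Section PairWords.
Variables (F : fieldType) (n N d : nat).
Local Notation S := {mpoly F[N]}.
Local Notation P := ('I_d.+1 * 'I_N)%type.
Implicit Types (m : 'X_{1..n}) (w : {ffun 'I_n -> 'I_N}) (u : {ffun 'I_n -> P}).

Definition pair_weight (p : P) : {poly S} := ('X_(p.2))%:P * 'X^(d - p.1).

Lemma multiset_sum_coef : multiset_sum F n N d =
  (\sum_(B : {ffun P -> 'I_n.+1} | (\sum_p B p == n)%N) \prod_p pair_weight p ^+ B p)`_d.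
Proof.
rewrite coef_sum /multiset_sum big_mkcondr /= ; apply: eq_bigr => B _.
rewrite [in RHS](eq_bigr (fun p : P => ('X_(p.2) ^+ B p)%:P * 'X^(B p * (d - p.1)))).
  rewrite big_split /= -rmorph_prod /= prodrXr mul_polyC coefZ coefXn eq_sym.
  by case: eqP => _; rewrite ?mulr1 ?mulr0.
by move=> p _; rewrite exprMn rmorphXn /= -exprM mulnC.
Qed.

Definition pair_word m w : {ffun 'I_n -> P} := [ffun j => (inord (d - m j), w j)].

Lemma sum_pair_words (R : pred {ffun 'I_n -> P}) :
  (\sum_(u | R u) \prod_j pair_weight (u j))`_d =
  \sum_(m : 'X_{1..n < d.+1} | mdeg m == d)
    \sum_(w | R (pair_word m w)) \prod_j 'X_(w j).
Proof.
rewrite coef_sum pair_big_dep /=.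
rewrite (eq_bigr (fun u : {ffun 'I_n -> P} =>
   if (\sum_j (d - (u j).1) == d)%N then \prod_j 'X_((u j).2) else 0)); last first.
  move=> u _; rewrite big_split /= -rmorph_prod /= prodrXr mul_polyC coefZ coefXn eq_sym.
  by case: eqP => _; rewrite ?mulr1 ?mulr0.
rewrite -big_mkcondr /=.
pose h (p : 'X_{1..n < d.+1} * {ffun 'I_n -> 'I_N}) := pair_word p.1 p.2.
have mle (m : 'X_{1..n < d.+1}) j : (m j <= d)%N.
  by rewrite -ltnS (leq_ltn_trans _ (bmdeg m)) // mdegE (bigD1 j) //= leq_addr.
have h1 (p : 'X_{1..n < d.+1} * {ffun 'I_n -> 'I_N}) j : (h p j).1 = (d - p.1 j)%N :> nat.
  by rewrite ffunE /= inordK // ltnS leq_subr.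
have h2 p j : (h p j).2 = p.2 j by rewrite ffunE.
have hsum p : (\sum_j (d - (h p j).1) = mdeg p.1)%N.
  by rewrite mdegE; apply: eq_bigr => j _; rewrite h1 subKn.
rewrite (@big_image_in _ _ _ _ _ 
  (fun p : 'X_{1..n < d.+1} * {ffun 'I_n -> 'I_N} =>
    (mdeg p.1 == d) && R (pair_word p.1 p.2)) _ h).
- by apply: eq_bigr => p _; apply: eq_bigr => j _; rewrite h2.
- move=> [m w] [m' w'] _ _ e; congr (_, _).
    apply: val_inj; apply/mnmP => j.
    have := congr1 (fun u : {ffun 'I_n -> P} => (u j).1 : nat) e; rewrite !h1 /=.
    by have := mle m j; have := mle m' j; lia.
  by apply/ffunP => j; have := congr1 (fun u : {ffun 'I_n -> P} => (u j).2) e; rewrite !h2.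
- by move=> p /andP[/eqP md Rp]; rewrite hsum md eqxx Rp.
move=> u /andP[Ru /eqP su].
pose m : 'X_{1..n} := [multinom (d - (u j).1)%N | j < n].
have md : mdeg m = d by rewrite mdegE -[RHS]su; apply: eq_bigr => j _; rewrite mnmE.
have lt : (mdeg m < d.+1)%N by rewrite md.
have hu : h (BMultinom lt, [ffun j => (u j).2]) = u.
  apply/ffunP => j; apply: injective_projections; last by rewrite h2 ffunE.
  by apply: val_inj; rewrite /= h1 /= mnmE subKn // -ltnS.
exists (BMultinom lt, [ffun j => (u j).2]) => //=.
by rewrite md eqxx -[pair_word _ _]/(h (BMultinom lt, _)) hu.
Qed.

Definition word_le (p q : P) := (p.2 < q.2)%N || (p.2 == q.2) && (p.1 <= q.1)%N.

Lemma sorted_letters (r : rel P) u :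
  sorted r (letters u) = [forall i : 'I_n.-1, r (u (lpos i)) (u (rpos i))].
Proof.
have nthE x0 (j : 'I_n) : nth x0 (letters u) j = u j.
  by rewrite -tnth_nth tnth_mktuple.
have [x0|no] := pickP (fun _ : 'I_n.-1 => true); last first.
  rewrite (_ : [forall i, _] = true); last by apply/forallP => i; have := no i.
  have : (size (letters u) <= 1)%N.
    rewrite size_tuple leqNgt; apply/negP => n1.
    have lt : (0 < n.-1)%N by lia.
    by have := no (Ordinal lt).
  by case: (tval (letters u)) => [|a [|b l]].
move=> _; apply/(sortedP (u (lpos x0)))/forallP => H i.
  have := H i; rewrite size_tuple -[i.+1]/(nat_of_ord (rpos i)) nthE.
  by rewrite -[nat_of_ord i]/(nat_of_ord (lpos i)) nthE; apply; apply: ltn_ord.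
rewrite size_tuple => lt; have ip : (i < n.-1)%N by lia.
have := H (Ordinal ip).
by rewrite -(nthE (u (lpos x0)) (lpos _)) -(nthE (u (lpos x0)) (rpos _)).
Qed.

(** Exponents are stored as d - m j, so a pair word is sorted for [word_le] exactly when w is weakly
    increasing, and strictly so at the ascents of m: the condition defining the fundamental
    quasisymmetric function. *)
Lemma sum_ascents :
  \sum_(m : 'X_{1..n < d.+1} | mdeg m == d) fundamental_qsym F N (ascents m) =
  multiset_sum F n N d.
Proof.
rewrite multiset_sum_coef -(@sum_sorted_words n P _ pair_weight word_le).
- rewrite sum_pair_words; apply: eq_bigr => m _; apply: eq_bigl => w.
  rewrite sorted_letters; apply: eq_forallb => i; rewrite inE /word_le !ffunE /=.
  have mle j : (m j <= d)%N.
    by rewrite -ltnS (leq_ltn_trans _ (bmdeg m)) // mdegE (bigD1 j) //= leq_addr.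
  rewrite !inordK ?ltnS ?leq_subr // -val_eqE /=.
  have := mle (lpos i); have := mle (rpos i).
  case: (ltngtP (w (lpos i)) (w (rpos i))) => //=; first by rewrite implybT.
  by rewrite implybF => _ h1 h2; rewrite -leqNgt; lia.
- move=> p q; rewrite /word_le -!val_eqE /=; lia.
- move=> q p r; rewrite /word_le -!val_eqE /=; lia.
move=> p q; rewrite /word_le -!val_eqE /= => h; rewrite [p]surjective_pairing [q]surjective_pairing.
by congr (_, _); apply: val_inj => /=; lia.
Qed.

(** A pair word is fixed by s exactly when its monomial and its word both are, so the fixed pairs
    factor into the trace and the power sums. *)
Lemma sum_fixed :
  \sum_(s : 'S_n)
    (\sum_(m : 'X_{1..n < d.+1} | mdeg m == d) ([multinom m (s i) | i < n] == m)%:R : F) *: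
      \prod_(c in porbits s) power_sum F N #|c| = (n`!)%:R *: multiset_sum F n N d.
Proof.
rewrite multiset_sum_coef [RHS]scaler_nat -coefMn -mulr_natl.
rewrite -sum_stabilizers coef_sum; apply: eq_bigr => s _.
rewrite sum_pair_words prod_power_sum scaler_suml; apply: eq_bigr => m _.
rewrite scaler_nat; have mle j : (m j <= d)%N.
  by rewrite -ltnS (leq_ltn_trans _ (bmdeg m)) // mdegE (bigD1 j) //= leq_addr.
have E w : (permute (pair_word m w) s == pair_word m w) =
    ([multinom m (s i) | i < n] == m) && (permute w s == w).
  apply/eqP/andP => [/ffunP e|[/eqP/mnmP e1 /eqP/ffunP e2]].
    split; apply/eqP; [apply/mnmP|apply/ffunP] => j; have := e j; rewrite !ffunE.
      by move=> /(congr1 (fun p : P => p.1 : nat)); rewrite /= !inordK ?ltnS ?leq_subr // mnmE;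
        have := mle j; have := mle (s j); lia.
    by move=> /(congr1 (fun p : P => p.2)).
  apply/ffunP => j; have := e1 j; have := e2 j.
  by rewrite !ffunE mnmE => -> ->.
under [RHS]eq_bigl do rewrite E.
by case: (_ == bmnm m); rewrite /= ?mulr1n ?mulr0n ?big_pred0_eq.
Qed.
End PairWords.

(** * Comparison of the three series *)

Section Convolution.
Variables (n : nat) (V : zmodType).
Implicit Types (Z : nat -> V).

(* The product of sum_d Z_d q^d with 1 / ((1 - q) ... (1 - q^n)), the generating
   function of the increasing sequences of length n. *)
Definition conv Z d : V :=
  \sum_(nu : 'X_{1..n < d.+1} | increasing nu) Z (d - mdeg nu)%N.

(** Triangularity: the zero sequence contributes Z d and all others only values of Z in lower
    degree. *)
Lemma conv_inj Z Z' : (forall d, conv Z d = conv Z' d) -> Z =1 Z'.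
Proof.
move=> H; elim/ltn_ind => d IH; have := H d.
have lt0 : (mdeg (0%MM : 'X_{1..n}) < d.+1)%N by rewrite mdeg0.
have split0 (Y : nat -> V) : conv Y d = Y d +
    \sum_(nu : 'X_{1..n < d.+1} | increasing nu && (nu != BMultinom lt0)) Y (d - mdeg nu)%N.
  by rewrite /conv (bigD1 (BMultinom lt0)) ?increasing0 //= mdeg0 subn0.
rewrite !split0.
rewrite (eq_bigr (fun nu : 'X_{1..n < d.+1} => Z' (d - mdeg nu)%N)); first exact: addIr.
move=> nu /andP[_ nz]; apply: IH.
have : mdeg nu != 0%N.
  by rewrite mdeg_eq0; apply: contraNneq nz => e; apply/eqP/val_inj.
by have := bmdeg nu; lia.
Qed.

Lemma conv_code (G : 'X_{1..n} -> V) d :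
  \sum_(m : 'X_{1..n < d.+1} | mdeg m == d) G (codeA m) =
  conv (fun e => \sum_(a : 'X_{1..n < e.+1} | substair a && (mdeg a == e)) G a) d.
Proof.
rewrite /conv; transitivity (\sum_(nu : 'X_{1..n < d.+1} | increasing nu)
   \sum_(a : 'X_{1..n < d.+1} | substair a && (mdeg a == d - mdeg nu)%N) G a).
  rewrite pair_big_dep /=; apply/esym.
  have ltA (m : 'X_{1..n < d.+1}) : (mdeg (codeA m) < d.+1)%N.
    by apply: leq_ltn_trans (bmdeg m); rewrite -[X in (_ <= X)%N]mdeg_code leq_addr.
  have ltN (m : 'X_{1..n < d.+1}) : (mdeg (codeN m) < d.+1)%N.
    by apply: leq_ltn_trans (bmdeg m); rewrite -[X in (_ <= X)%N]mdeg_code leq_addl.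
  pose h (m : 'X_{1..n < d.+1}) := (BMultinom (ltN m), BMultinom (ltA m)).
  rewrite (@big_image_in _ _ _ _ _ (fun m : 'X_{1..n < d.+1} => mdeg m == d) _ h) //.
  - move=> m m' _ _ e; apply: val_inj; rewrite /= -[bmnm m]codeK -[bmnm m']codeK.
    by congr decode; [have := congr1 snd e|have := congr1 fst e]; move/(congr1 val).
  - move=> m /eqP md; rewrite /= codeN_increasing codeA_substair /=.
    by apply/eqP; have := mdeg_code m; lia.
  move=> [nu a] /= /andP[inu /andP[sa /eqP da]].
  have dn := bmdeg nu; have de : mdeg (decode a nu) = d by rewrite mdeg_decode //; lia.
  have lt : (mdeg (decode a nu) < d.+1)%N by rewrite de.
  exists (BMultinom lt); first by rewrite /= de.
  by congr (_, _); apply: val_inj; rewrite /= ?codeN_decode ?codeA_decode.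
apply: eq_bigr => nu _.
rewrite (@big_bmnm_widen V n d.+1 (d - mdeg nu).+1
  (fun a => substair a && (mdeg a == d - mdeg nu)%N) G).
  by apply: eq_bigl => a; case: (substair a) => //=; lia.
by rewrite ltnS leq_subr.
Qed.
End Convolution.

Section Graded.
Variables (F : fieldType) (n N : nat).

Definition side_hecke e : {mpoly F[N]} :=
  qsym_frobenius_char (@hecke0_coinv F n) (coinv_deg F n e) N.

Definition side_schur e : {mpoly F[N]} :=
  \sum_(la : {ffun 'I_n -> 'I_n.+1} | is_partition la)
    \sum_(Q : {ffun cell la -> 'I_n} | is_syt Q && (maj Q == e)) schur la F N.

Definition side_frobenius e : {mpoly F[N]} :=
  frobenius_char (@coinv_perm F n) (coinv_deg F n e) N.

Lemma conv_hecke d : conv n side_hecke d = multiset_sum F n N d.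
Proof.
rewrite -sum_ascents.
transitivity (\sum_(m : 'X_{1..n < d.+1} | mdeg m == d)
    fundamental_qsym F N (ascents (codeA m))).
  rewrite (conv_code (fun a => fundamental_qsym F N (ascents a))) /conv.
  by apply: eq_bigr => nu _; rewrite /side_hecke qsym_coinv_deg.
apply: eq_bigr => m _; congr (fundamental_qsym F N _); apply/setP => i.
by rewrite !inE codeA_ascent.
Qed.

Lemma conv_schur d : conv n side_schur d = multiset_sum F n N d.
Proof.
rewrite -sum_schur_code /conv /side_schur exchange_big; apply: eq_bigr => la _ /=.
rewrite [RHS](exchange_big_dep (fun nu : 'X_{1..n < d.+1} => increasing nu)) /=; last first.
  by move=> Q nu _ /andP[].
apply: eq_bigr => nu inu; apply: eq_bigl => Q; rewrite inu; congr (_ && _).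
by have := bmdeg nu; lia.
Qed.

Lemma conv_frobenius d : (n`!)%:R != 0 :> F ->
  conv n side_frobenius d = multiset_sum F n N d.
Proof.
move=> nz; apply: (scalerI nz); rewrite -sum_fixed /conv scaler_sumr.
transitivity (\sum_(nu : 'X_{1..n < d.+1} | increasing nu) \sum_(s : 'S_n)
   trace_on (coinv_deg F n (d - mdeg nu)) (coinv_perm F s) *:
   \prod_(c in porbits s) power_sum F N #|c|).
  by apply: eq_bigr => nu _; rewrite /side_frobenius /frobenius_char scalerA divff // scale1r.
rewrite exchange_big; apply: eq_bigr => s _ /=; rewrite -scaler_suml; congr (_ *: _).
rewrite -sum_trace_code (conv_code (fun a => art_coord (decode a 0%MM) (msym s 'X_[a]))).
by apply: eq_bigr => nu _; rewrite trace_coinv_deg.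
Qed.

(** The bound n * n is deliberately crude: it also bounds [maj] in [maj_lt], so the series share one
    truncation. *)
Lemma side_hecke_out e : (n * n < e)%N -> side_hecke e = 0.
Proof.
move=> ne; rewrite /side_hecke qsym_coinv_deg big_pred0 // => a.
apply/negP => /andP[/forallP sa /eqP da]; move: ne; rewrite -da ltnNge mdegE.
move/negP; apply; rewrite -[X in (_ <= X * _)%N]card_ord -sum_nat_const.
by apply: leq_sum => j _; apply: leq_trans (sa j) (ltnW (ltn_ord j)).
Qed.

Lemma graded_sum_trunc (f : nat -> {mpoly F[N]}) D : (forall e, (D <= e)%N -> f e = 0) ->
  graded_sum f = \sum_(e < D) 'X^e *: map_mpoly (@polyC F) (f e).
Proof.
move=> f0; rewrite /graded_sum.
rewrite (@fsbigE _ _ _ _ _ (iota 0 D)) ?iota_uniq //.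
  have -> : iota 0 D = index_iota 0 D by rewrite /index_iota subn0.
  rewrite big_mkord.
  by apply: eq_bigl => e; rewrite in_setT.
move=> e _; rewrite mem_iota /= add0n -leqNgt => /f0 ->.
by rewrite raddf0 scaler0.
Qed.

Lemma maj_lt (la : {ffun 'I_n -> 'I_n.+1}) (Q : {ffun cell la -> 'I_n}) :
  (maj Q < (n * n).+1)%N.
Proof.
rewrite ltnS /maj; apply: (@leq_trans (\sum_(i < n.-1) i.+1)).
  by rewrite [X in (_ <= X)%N](bigID (fun i => i \in ides Q)) /= leq_addr.
apply: (@leq_trans (\sum_(i < n.-1) n)).
  by apply: leq_sum => i _; have := ltn_ord i; lia.
by rewrite sum_nat_const card_ord leq_mul2r leq_pred orbT.
Qed.

Lemma map_schur (la : {ffun 'I_n -> 'I_n.+1}) :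
  map_mpoly (@polyC F) (schur la F N) = schur la {poly F} N.
Proof.
rewrite /schur rmorph_sum; apply: eq_bigr => T _; rewrite rmorph_prod.
by apply: eq_bigr => c _; rewrite /= map_mpolyX.
Qed.

Lemma sum_side_schur :
  \sum_(e < (n * n).+1) 'X^e *: map_mpoly (@polyC F) (side_schur e) =
  \sum_(la : {ffun 'I_n -> 'I_n.+1} | is_partition la)
    \sum_(Q : {ffun cell la -> 'I_n} | is_syt Q) 'X^(maj Q) *: schur la {poly F} N.
Proof.
under eq_bigr => e _ do rewrite /side_schur rmorph_sum scaler_sumr.
rewrite exchange_big; apply: eq_bigr => la _ /=.
under eq_bigr => e _ do rewrite rmorph_sum scaler_sumr /=.
rewrite (exchange_big_dep (fun Q : {ffun cell la -> 'I_n} => is_syt Q)) /=; last first.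
  by move=> e Q _ /andP[].
apply: eq_bigr => Q sQ; rewrite (big_pred1 (Ordinal (maj_lt Q))) => [|e].
  by rewrite map_schur.
by rewrite sQ eq_sym.
Qed.
End Graded.

Local Open Scope complex_scope.

Theorem theorem5 (R : realType) (n N : nat) :
  graded_qsym_frobenius_char (@hecke0_coinv R[i] n) (coinv_deg R[i] n) N
    = \sum_(la : {ffun 'I_n -> 'I_n.+1} | is_partition la)
        \sum_(Q : {ffun cell la -> 'I_n} | is_syt Q)
          'X^(maj Q) *: schur la {poly R[i]} N
  /\
  \sum_(la : {ffun 'I_n -> 'I_n.+1} | is_partition la)
      \sum_(Q : {ffun cell la -> 'I_n} | is_syt Q)
        'X^(maj Q) *: schur la {poly R[i]} N
    = graded_frobenius_char (@coinv_perm R[i] n) (coinv_deg R[i] n) N.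
Proof.
have nz : (n`!)%:R != 0 :> R[i] by rewrite Num.Theory.pnatr_eq0 -lt0n fact_gt0.
have e1 : side_hecke R[i] n N =1 side_schur R[i] n N.
  by apply: (@conv_inj n) => d; rewrite conv_hecke conv_schur.
have e2 : side_hecke R[i] n N =1 side_frobenius R[i] n N.
  by apply: (@conv_inj n) => d; rewrite conv_hecke conv_frobenius.
have out e : ((n * n).+1 <= e)%N -> side_hecke R[i] n N e = 0 by apply: side_hecke_out.
rewrite -sum_side_schur /graded_qsym_frobenius_char /graded_frobenius_char.
rewrite (graded_sum_trunc out) (@graded_sum_trunc _ _ (side_frobenius R[i] n N) (n * n).+1).
  by split; apply: eq_bigr => e _; rewrite -?e1 -?e2.
(* Vanishing in high degree is inherited from the Hecke side. *)
by move=> e le; rewrite -e2 out.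
Qed.
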